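(* Let $T>0$, $0<\gamma<1$, and let $\{Y_t: t\in[0,T]\}$ be a sample continuous $\gamma$-fractional Brownian motion such that $Y_0=0$ with probability one. Set $X_t=Y_t+Z$, where $Z$ is a random variable independent of $\{Y_t:t\in[0,T]\}$ and having a bounded density function. Then $$\{I_{X_s\le x}-\Pr(X_s\le x): s\in[0,T],\ x\in\mathbb{R}\}$$ satisfies the central limit theorem in $\ell_\infty([0,T]\times\mathbb{R})$.
   Context: A $\gamma$-fractional Brownian motion is a centered Gaussian process with $(\mathbb{E}(Y_s-Y_t)^2)^{1/2}=c_\gamma|s-t|^{\gamma}$ for a constant $c_\gamma>0$. Let $S=C([0,T])$ with its Borel $\sigma$-field $\mathcal{S}$, let $P$ be the law of $X$ on $S$, and let $X_1,X_2,\dots$ be the coordinate projections on $(S^{\mathbb N},\mathcal{S}^{\mathbb N},P^{\mathbb N})$ (i.i.d. copies of $X$). Put, with $E=[0,T]$, $\mathcal{C}=\{C_{s,x}:s\in E,x\in\mathbb{R}\}$, $C_{s,x}=\{z\in S:z(s)\le x\}$, and $$\nu_n(s,x)=\frac1{\sqrt n}\sum_{j=1}^n\bigl[I_{X_j(s)\le x}-\Pr(X(s)\le x)\bigr].$$ Points $(s,x)$ are identified with sets $C_{s,x}$. ''Satisfies the central limit theorem in $\ell_\infty(E\times\mathbb{R})$'' means $\mathcal{C}\in\operatorname{CLT}(P)$: there is a centered Radon Gaussian measure $\gamma_P$ on the space $\ell_\infty$ of bounded real functions (sup norm) on the index set such that $\lim_n\mathbb{E}^*(G(\nu_n))=\int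 G\,d\gamma_P$ for every bounded continuous real function $G$ on $\ell_\infty$. Here $\mathbb{E}^*$ is the upper integral, and Radon means a finite Borel measure inner regular with respect to compact sets. *)

(* Defs.v *)
From HB Require Import structures.
From mathcomp Require Import all_boot all_order all_algebra.
From mathcomp Require Import all_classical all_reals all_analysis.

Set Implicit Arguments.
Unset Strict Implicit.
Unset Printing Implicit Defensive.

Import Order.TTheory GRing.Theory Num.Theory.
Import numFieldNormedType.Exports.

Local Open Scope classical_set_scope.
Local Open Scope ring_scope.

Definition borelType (T : ptopologicalType) := g_sigma_algebraType (@open T).

(* The space of bounded real functions on I with the sup norm. *)
Section linf.
Context {I : Type} {R : realType}.

Definition bounded_functions : {pred I -> R} :=
  mem [set f : I -> R | bounded_fun f].

Lemma bounded_functionsP (f : I -> R) :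
  f \in bounded_functions <-> exists M : R, forall i, `|f i| <= M.
Proof.
rewrite inE /=; split => [/pinfty_ex_gt0[M _ fM]|[M fM]].
  by exists M => i; exact: fM.
exists M; split => [|N MN i _ /=]; first exact: num_real.
exact: le_trans (fM i) (ltW MN).
Qed.

Lemma bounded_functions_submod_closed : submod_closed bounded_functions.
Proof.
split=> [|a f g /bounded_functionsP[M fM] /bounded_functionsP[N gN]].
  by apply/bounded_functionsP; exists 0 => i; rewrite normr0.
apply/bounded_functionsP; exists (`|a| * M + N) => i.
rewrite [(a *: f + g) i]/(a * f i + g i) (le_trans (ler_normD _ _))//.
by rewrite lerD// normrM ler_wpM2l.
Qed.

HB.instance Definition _ := GRing.isSubmodClosed.Build R (I -> R)
  bounded_functions bounded_functions_submod_closed.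

End linf.

Definition linf (I : Type) (R : realType) : Type :=
  {f : I -> R | f \in bounded_functions}.

Section linf_normedModType.
Context {I : Type} {R : realType}.

HB.instance Definition _ := [isSub for @sval _ _ : linf I R -> (I -> R)].
HB.instance Definition _ := [Choice of linf I R by <:].
HB.instance Definition _ := [SubChoice_isSubLmodule of linf I R by <:].

(* The supremum is 0 when I is empty. *)
Definition linf_norm (f : linf I R) : R := sup (range (fun i => `|\val f i|)).

Lemma linf_norm_ub (f : linf I R) i : `|\val f i| <= linf_norm f.
Proof.
apply: ub_le_sup; last by exists i.
have /bounded_functionsP[M fM] := valP f.
by exists M => _ [j _ <-].
Qed.

Lemma linf_norm_ge0 (f : linf I R) : 0 <= linf_norm f.
Proof.
have [[i]|nI] := pselect (inhabited I).
  exact: le_trans (normr_ge0 _) (linf_norm_ub f i).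
suff -> : linf_norm f = sup set0 by rewrite sup0.
by congr sup; apply/seteqP; split => // x [i]; case: nI.
Qed.

Lemma linf_norm_le (f : linf I R) (M : R) :
  0 <= M -> (forall i, `|\val f i| <= M) -> linf_norm f <= M.
Proof.
move=> M0 fM; have [[i]|nI] := pselect (inhabited I).
  by apply: ge_sup => [|_ [j _ <-]//]; exists `|\val f i|, i.
suff -> : linf_norm f = sup set0 by rewrite sup0.
by congr sup; apply/seteqP; split => // x [i]; case: nI.
Qed.

Let linf_ler_normD (f g : linf I R) :
  linf_norm (f + g) <= linf_norm f + linf_norm g.
Proof.
apply: linf_norm_le => [|i]; first by rewrite addr_ge0// linf_norm_ge0.
rewrite (le_trans (ler_normD (\val f i) (\val g i)))//.
by rewrite lerD// linf_norm_ub.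
Qed.

Let linf_normZ_le (a : R) (f : linf I R) :
  linf_norm (a *: f) <= `|a| * linf_norm f.
Proof.
apply: linf_norm_le => [|i]; first by rewrite mulr_ge0// linf_norm_ge0.
rewrite [X in `|X|](_ : _ = a * \val f i)//.
by rewrite normrM ler_wpM2l// linf_norm_ub.
Qed.

Let linf_normrZ (a : R) (f : linf I R) :
  linf_norm (a *: f) = `|a| * linf_norm f.
Proof.
apply/eqP; rewrite eq_le linf_normZ_le/=.
have [->|a0] := eqVneq a 0; first by rewrite normr0 mul0r linf_norm_ge0.
rewrite -ler_pdivlMl ?normr_gt0// -normfV.
have {1}-> : f = a^-1 *: (a *: f) by rewrite scalerA mulVf// scale1r.
exact: linf_normZ_le.
Qed.

Let linf_normr0_eq0 (f : linf I R) : linf_norm f = 0 -> f = 0.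
Proof.
move=> f0; apply/val_inj/funext => i.
by apply/eqP; rewrite -normr_le0 -f0 linf_norm_ub.
Qed.

HB.instance Definition _ := Lmodule_isNormed.Build R (linf I R)
  linf_ler_normD linf_normrZ linf_normr0_eq0.

Lemma linf_normE (f : linf I R) : `|f| = sup (range (fun i => `|\val f i|)).
Proof. by []. Qed.

End linf_normedModType.

Section gaussian.
Context {R : realType}.

(* normal_prob 0 0 is not the Dirac mass, hence the separate degenerate case. *)
Definition centered_gaussian_law (mu : set R -> \bar R) : Prop :=
  exists2 s : R, 0 <= s & forall B, measurable B ->
    mu B = if s == 0 then \d_(0 : R) B else normal_prob 0 s B.

Definition radon (T : ptopologicalType)
    (mu : {finite_measure set (borelType T) -> \bar R}) : Prop :=
  forall A : set (borelType T), measurable A ->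
    mu A = ereal_sup [set mu K | K in [set K : set T | compact K /\ K `<=` A]].

Definition centered_gaussian_measure (V : normedModType R)
    (mu : probability (borelType V) R) : Prop :=
  forall L : {linear V -> R^o}, continuous L ->
    centered_gaussian_law (fun B => mu (L @^-1` B)).

End gaussian.

Section process.
Context {R : realType} {d : measure_display} {Omega : measurableType d}.
Variable Pr : probability Omega R.

Definition centered_gaussian_process (E : Type) (Y : E -> {RV Pr >-> R}) :
    Prop :=
  forall (n : nat) (t : 'I_n -> E) (a : 'I_n -> R),
    centered_gaussian_law
      (fun B => Pr ((fun w => \sum_(i < n) a i * Y (t i) w) @^-1` B)).

Definition sample_continuous (E : topologicalType) (Y : E -> {RV Pr >-> R}) :
    Prop :=
  {ae Pr, forall w, continuous (fun t => Y t w)}.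

Definition process_sigma_algebra (E : Type) (Y : E -> {RV Pr >-> R}) :
    set (set Omega) :=
  <<s [set A | exists t, exists2 B, measurable B & A = Y t @^-1` B] >>.

Definition independent_of_process (E : Type) (Z : {RV Pr >-> R})
    (Y : E -> {RV Pr >-> R}) : Prop :=
  forall A B, process_sigma_algebra Y A -> measurable B ->
    Pr (A `&` Z @^-1` B) = (Pr A * Pr (Z @^-1` B))%E.

Definition has_bounded_density (Z : {RV Pr >-> R}) : Prop :=
  exists f : R -> R, [/\ measurable_fun setT f,
    exists M, forall x, 0 <= f x <= M &
    forall B, measurable B ->
      distribution Pr Z B = (\int[lebesgue_measure]_(x in B) (f x)%:E)%E].

End process.

Section paths.
Context {R : realType}.

Definition time_interval (T : R) : Type := set_type `[0, T].
HB.instance Definition _ (T : R) := Topological.on (time_interval T).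

Definition fractional_brownian_motion (d : measure_display)
    (Omega : measurableType d) (Pr : probability Omega R) (T gamma : R)
    (Y : time_interval T -> {RV Pr >-> R}) : Prop :=
  centered_gaussian_process Y /\
  exists2 c : R, 0 < c & forall s t : time_interval T,
    ('E_Pr[fun w => ((Y s w - Y t w) ^+ 2)%R] `^ 2^-1)%E =
    (c * `|\val s - \val t| `^ gamma)%:E.

(* C([0, T]) with the topology of uniform convergence. *)
Definition continuous_paths (T : R) : Type :=
  set_type [set z : {uniform time_interval T -> R} |
    continuous (z : time_interval T -> R)].

Lemma zero_path_subproof (T : R) :
  (cst 0 : time_interval T -> R) \in
    [set z : {uniform time_interval T -> R} |
      continuous (z : time_interval T -> R)].
Proof. rewrite inE /= => x. exact: cst_continuous.
Qed.

HB.instance Definition _ (T : R) := Topological.on (continuous_paths T).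
HB.instance Definition _ (T : R) :=
  isPointed.Build (continuous_paths T) (SigSub (zero_path_subproof T)).

Definition lower_halfspace (T : R) (i : time_interval T * R) :
    set (borelType (continuous_paths T)) :=
  [set z : continuous_paths T | (\val z : time_interval T -> R) i.1 <= i.2].

Lemma measurable_lower_halfspace (T : R) (i : time_interval T * R) :
  measurable (lower_halfspace i).
Proof.
have cE : continuous
    (fun z : continuous_paths T => (\val z : time_interval T -> R) i.1).
  move=> z W /= /nbhs_ballP[e /= e0 eW].
  have : nbhs (set_val z) [set h : {uniform time_interval T -> R} | W (h i.1)].
    apply/uniform_nbhs; exists [set xy : R * R | ball xy.1 e xy.2].
    split; first exact: entourage_ball (PosNum e0).
    by move=> h /(_ i.1 I) /= ?; exact: eW.
  exact: (@initial_continuous (continuous_paths T) _ set_val z).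
have clH : closed (lower_halfspace i).
  by apply: (preimage_closed _ (@closed_le _ i.2)) => z _; exact: cE.
rewrite -[lower_halfspace i]setCK; apply: measurableC.
by apply: sub_sigma_algebra; rewrite /= openC.
Qed.

End paths.

Section clt.
Context {R : realType} {d : measure_display} {S : measurableType d}.

(* S^N with the product sigma-algebra. *)
Definition sequence_space (dS : measure_display) (U : measurableType dS) :=
  g_sigma_algebraType [set A : set (nat -> U) |
    exists j, exists2 B, measurable B & A = [set w | B (w j)]].

(* PN is the infinite product measure P^N; these values determine it. *)
Definition is_infinite_product (P : probability S R)
    (PN : probability (sequence_space S) R) : Prop :=
  forall (n : nat) (B : nat -> set S), (forall j, measurable (B j)) ->
    PN [set w | forall j, (j < n)%N -> B j (w j)] =
    (\prod_(j < n) P (B j))%E.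

(* Restricting to integrable majorants h avoids the library's value -oo for
   the integral of a function whose two parts both have infinite integral; for
   the other majorants the infimum is unaffected. *)
Definition upper_expectation (d' : measure_display) (U : measurableType d')
    (mu : probability U R) (f : U -> R) : \bar R :=
  ereal_inf [set (\int[mu]_x h x)%E | h in [set h : U -> \bar R |
    mu.-integrable setT h /\ forall x, ((f x)%:E <= h x)%E]].

Section empirical_process.
Context {I : Type} (C : I -> set S).
Hypothesis mC : forall i, measurable (C i).
Variable P : probability S R.

Definition empirical_process_fun (n : nat) (w : sequence_space S) (i : I) : R :=
  (Num.sqrt n%:R)^-1 * \sum_(j < n) (\1_(C i) (w j) - fine (P (C i))).

Lemma empirical_process_subproof (n : nat) (w : sequence_space S) :
  empirical_process_fun n w \in bounded_functions.
Proof.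
apply/bounded_functionsP; exists ((Num.sqrt n%:R)^-1 * \sum_(j < n) 2) => i.
have n0 : 0 <= (Num.sqrt n%:R : R)^-1 by rewrite invr_ge0 sqrtr_ge0.
rewrite normrM (ger0_norm n0) ler_wpM2l//.
rewrite (le_trans (ler_norm_sum _ _ _))// ler_sum// => j _.
rewrite (le_trans (ler_normB _ _))// (_ : 2 = 1 + 1)// lerD//.
  by rewrite indicE; case: (_ \in _); rewrite ?normr1// normr0.
have PC := fin_num_measure P (C i) (mC i).
by rewrite ger0_norm ?fine_ge0// -lee_fin fineK// probability_le1.
Qed.

Definition empirical_process (n : nat) (w : sequence_space S) : linf I R :=
  SigSub (empirical_process_subproof n w).

Definition satisfies_clt (PN : probability (sequence_space S) R) : Prop :=
  exists gammaP : probability (borelType (linf I R)) R,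
    [/\ radon gammaP, centered_gaussian_measure gammaP &
      forall G : linf I R -> R, continuous G -> bounded_fun G ->
        upper_expectation PN (fun w => G (empirical_process n w))
          @[n --> \oo] --> (\int[gammaP]_z (G z)%:E)%E].

End empirical_process.
End clt.

(* Main.v *)
From HB Require Import structures.
From mathcomp Require Import all_boot all_order all_algebra.
From mathcomp Require Import all_classical all_reals all_analysis.
From mathcomp Require Import measurable_realfun lra ring zify.
Require Import Defs.

(** The sets [C_(s,x)] satisfy the central limit theorem because they can be
    bracketed efficiently, and the law of the paths is rich enough to carry the
    limiting Gaussian process.

    Brackets. The times are divided into blocks by a grid of mesh [T b^-k], where
    [b^gamma >= 32]. Increments of [X] are increments of [Y]: normal variables,
    whose standard deviation over a step of the grid of level [k] is
    [O(32^-k)]. By chaining along the grids, a path moves by at most [2 / 16^k]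
    within a block, off an event of probability [O(16^-k)] ([smooth_block],
    [rough_block_pr]). So, for [t] in a block whose left end is [a], the event
    [X_t <= x] lies, up to that event, between [X_a + 2/16^k <= x] and
    [X_a - 2/16^k <= x]. As [Z] is independent of [Y] and has a bounded density,
    [X_a] has a Lipschitz distribution function [F] ([process_sum_spread]); as
    [F(X_a)] is uniform ([cdf_between]), rounding [F(x)] to a multiple of [16^-k]
    gives brackets of mass [O(16^-k)], and there are only [O((16 b)^k)] of them
    ([fractional_bracketing]).

    Equicontinuity. A normalized sum of [n] bounded centered variables has a
    Gaussian exponential moment as long as the exponent is below a multiple of
    [sqrt n] ([exp_moment]). Between levels [k] and [k+1] the lower brackets
    change by a set of mass [O(16^-k)], so the empirical process changes by more
    than [2^-k] with a probability of order [exp (- 2^k / 4)], while the number of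
    changes is geometric in [k]. Summing over the levels with [16^k <= n], after
    which the mass of a bracket is negligible even when multiplied by [sqrt n],
    one sees that the empirical process is uniformly close to a step function
    with finitely many values ([asymptotic_equicontinuity]).

    The limit. The function [a (z(T) - z(0))] of a path [z] is standard normal for
    a suitable [a] ([standard_increment]), so its values at the coordinates of the
    sequence space are independent standard normal variables. Combining them with
    the Gram-Schmidt coefficients of the indicators of the brackets gives jointly
    Gaussian variables with the covariance of these indicators ([gaussian_copy],
    [gram_schmidt_parseval]). They are the finite-dimensional limits of the
    empirical process, by the continuity theorem for characteristic functions
    ([clt_cos], [levy_continuity], [finite_dimensional_clt]), and so inherit its
    tail bounds ([gaussian_copy_tail]). By Borel and Cantelli, the step functions
    that they define converge uniformly, almost surely ([cvg_gaussian_step]). The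
    limit is approximated by countably many rational step functions, hence is
    Borel measurable and has a Radon law ([measurable_to_borel],
    [radon_of_separable_support]); continuous linear functionals of it are limits
    of normal variables, hence normal ([gaussian_limit_linear]).

    Convergence. For a Lipschitz functional, both processes may be replaced by
    their step functions of a fixed level, and these converge in law
    ([lipschitz_clt]). A bounded continuous functional is the increasing limit of
    Lipschitz ones, and so is its opposite ([lipschitz_minorant],
    [continuous_clt]). This gives a central limit theorem under bracketing
    ([bracketing_clt]). *)

Set Implicit Arguments.
Unset Strict Implicit.
Unset Printing Implicit Defensive.

Import Order.TTheory GRing.Theory Num.Theory.
Import numFieldNormedType.Exports.

Local Open Scope classical_set_scope.
Local Open Scope ring_scope.

(** * Means of bounded functions *)

Section mean.
Context {R : realType} {d : measure_display} {T : measurableType d}.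
Variable P : probability T R.
Implicit Types (f g : T -> R) (A B : set T).

Definition bounded_measurable f :=
  measurable_fun setT f /\ exists M : R, forall x, `|f x| <= M.

(** Real-valued, unlike the extended integral: on bounded measurable functions
    it is linear and monotone, and can be handled by real arithmetic. *)
Definition mean f : R := \int[P]_x f x.

Definition pr A : R := fine (P A).

Lemma bounded_measurable_integrable f : bounded_measurable f ->
  P.-integrable setT (EFin \o f).
Proof.
move=> [mf [M fM]]; apply: measurable_bounded_integrable => //.
  by rewrite (le_lt_trans (probability_le1 _ _))// ltry.
exists M; split; first exact: num_real.
by move=> x Mx y _; exact: le_trans (fM y) (ltW Mx).
Qed.

Lemma integral_mean f : bounded_measurable f ->
  (\int[P]_x (f x)%:E)%E = (mean f)%:E.
Proof.
move=> bf; rewrite /mean /Rintegral fineK//.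
exact: (integrable_fin_num measurableT (bounded_measurable_integrable bf)).
Qed.

Lemma bounded_measurable_cst (c : R) : bounded_measurable (fun=> c).
Proof. by split; [exact: measurable_cst|exists `|c|]. Qed.

Lemma bounded_measurableD f g : bounded_measurable f -> bounded_measurable g ->
  bounded_measurable (fun x => f x + g x).
Proof.
move=> [mf [M fM]] [mg [N gN]]; split; first exact: measurable_funD.
by exists (M + N) => x; rewrite (le_trans (ler_normD _ _))// lerD.
Qed.

Lemma bounded_measurableM f g : bounded_measurable f -> bounded_measurable g ->
  bounded_measurable (fun x => f x * g x).
Proof.
move=> [mf [M fM]] [mg [N gN]]; split; first exact: measurable_funM.
by exists (M * N) => x; rewrite normrM ler_pM.
Qed.

Lemma bounded_measurableZ (c : R) f : bounded_measurable f ->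
  bounded_measurable (fun x => c * f x).
Proof. by move=> bf; apply: bounded_measurableM => //; exact: bounded_measurable_cst. Qed.

Lemma bounded_measurableN f : bounded_measurable f ->
  bounded_measurable (fun x => - f x).
Proof.
move=> /(bounded_measurableZ (-1)); congr bounded_measurable.
by apply/funext => x; rewrite mulN1r.
Qed.

Lemma bounded_measurableB f g : bounded_measurable f -> bounded_measurable g ->
  bounded_measurable (fun x => f x - g x).
Proof. by move=> bf /bounded_measurableN; exact: bounded_measurableD. Qed.

Lemma bounded_measurable_sum (J : Type) (s : seq J) (Q : pred J) (F : J -> T -> R) :
  (forall j, bounded_measurable (F j)) ->
  bounded_measurable (fun x => \sum_(j <- s | Q j) F j x).
Proof.
move=> bF; elim: s => [|j s IH].
  by under eq_fun do rewrite big_nil; exact: bounded_measurable_cst.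
under eq_fun do rewrite big_cons; case: (Q j) => //.
exact: bounded_measurableD.
Qed.

Lemma bounded_measurable_prod (J : Type) (s : seq J) (Q : pred J) (F : J -> T -> R) :
  (forall j, bounded_measurable (F j)) ->
  bounded_measurable (fun x => \prod_(j <- s | Q j) F j x).
Proof.
move=> bF; elim: s => [|j s IH].
  by under eq_fun do rewrite big_nil; exact: bounded_measurable_cst.
under eq_fun do rewrite big_cons; case: (Q j) => //.
exact: bounded_measurableM.
Qed.

Lemma bounded_measurable_indic A : measurable A -> bounded_measurable (\1_A : T -> R).
Proof.
move=> mA; split; first exact: measurable_indic.
by exists 1 => x; rewrite indicE; case: (_ \in _); rewrite ?normr1 ?normr0.
Qed.

Lemma bounded_measurable_comp (h : R -> R) f : continuous h ->
  (exists M : R, forall x, `|h x| <= M) -> measurable_fun setT f ->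
  bounded_measurable (fun x => h (f x)).
Proof.
move=> ch [M hM] mf; split; last by exists M.
by apply: measurableT_comp => //; exact: continuous_measurable_fun.
Qed.

Lemma bounded_measurable_cos f : measurable_fun setT f ->
  bounded_measurable (fun x => cos (f x)).
Proof.
apply: bounded_measurable_comp; first exact: continuous_cos.
by exists 1 => x; exact: cos_max.
Qed.

Lemma meanD f g : bounded_measurable f -> bounded_measurable g ->
  mean (fun x => f x + g x) = mean f + mean g.
Proof. by move=> bf bg; rewrite /mean RintegralD//; exact: bounded_measurable_integrable. Qed.

Lemma meanB f g : bounded_measurable f -> bounded_measurable g ->
  mean (fun x => f x - g x) = mean f - mean g.
Proof. by move=> bf bg; rewrite /mean RintegralB//; exact: bounded_measurable_integrable. Qed.

Lemma meanZ (c : R) f : bounded_measurable f ->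
  mean (fun x => c * f x) = c * mean f.
Proof. by move=> bf; rewrite /mean RintegralZl//; exact: bounded_measurable_integrable. Qed.

Lemma mean_cst (c : R) : mean (fun=> c) = c.
Proof. by rewrite /mean Rintegral_cst// [X in fine X](_ : _ = 1%E) ?mulr1//; exact: probability_setT. Qed.

Lemma mean_sum (J : Type) (s : seq J) (Q : pred J) (F : J -> T -> R) :
  (forall j, bounded_measurable (F j)) ->
  mean (fun x => \sum_(j <- s | Q j) F j x) = \sum_(j <- s | Q j) mean (F j).
Proof.
move=> bF; elim: s => [|j s IH].
  by under eq_fun do rewrite big_nil; rewrite big_nil mean_cst.
under eq_fun do rewrite big_cons; rewrite big_cons -IH; case: (Q j) => //.
by rewrite meanD//; exact: bounded_measurable_sum.
Qed.

Lemma mean_le f g : bounded_measurable f -> bounded_measurable g ->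
  (forall x, f x <= g x) -> mean f <= mean g.
Proof.
move=> bf bg fg; apply: le_Rintegral => //; exact: bounded_measurable_integrable.
Qed.

Lemma mean_ge0 f : (forall x, 0 <= f x) -> 0 <= mean f.
Proof. by move=> f0; apply: Rintegral_ge0. Qed.

Lemma mean_norm_le f (M : R) : bounded_measurable f -> (forall x, `|f x| <= M) ->
  `|mean f| <= M.
Proof.
move=> bf fM; rewrite ler_norml -{1}(mean_cst (- M)) -{2}(mean_cst M).
by apply/andP; split; apply: mean_le => //; try exact: bounded_measurable_cst;
  move=> x; have := fM x; rewrite ler_norml => /andP[].
Qed.

Lemma mean_dist_le f g (M : R) : bounded_measurable f -> bounded_measurable g ->
  (forall x, `|f x - g x| <= M) -> `|mean f - mean g| <= M.
Proof.
by move=> bf bg fg; rewrite -meanB//; apply: mean_norm_le => //; exact: bounded_measurableB.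
Qed.

Lemma eq_mean f g : f =1 g -> mean f = mean g.
Proof. by move=> fg; congr mean; exact/funext. Qed.

Lemma prE A : measurable A -> P A = (pr A)%:E.
Proof. by move=> mA; rewrite /pr fineK// fin_num_measure. Qed.

Lemma mean_indic A : measurable A -> mean (\1_A) = pr A.
Proof. by move=> mA; rewrite /mean /Rintegral integral_indic// setIT. Qed.

Lemma pr_ge0 A : 0 <= pr A.
Proof. by rewrite /pr fine_ge0. Qed.

Lemma pr_le A B : measurable A -> measurable B -> A `<=` B -> pr A <= pr B.
Proof.
by move=> mA mB AB; rewrite -lee_fin -!prE//; apply: le_measure; rewrite ?inE.
Qed.

Lemma pr_le1 A : measurable A -> pr A <= 1.
Proof. by move=> mA; rewrite -lee_fin -prE// probability_le1. Qed.

Lemma pr_setT : pr setT = 1.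
Proof. by rewrite /pr probability_setT. Qed.

Lemma prU_le A B : measurable A -> measurable B -> pr (A `|` B) <= pr A + pr B.
Proof.
move=> mA mB; rewrite -lee_fin EFinD -!prE//; last exact: measurableU.
exact: measureU2.
Qed.

Lemma pr_setC A : measurable A -> pr (~` A) = 1 - pr A.
Proof.
by move=> mA; apply: EFin_inj; rewrite EFinB -!prE ?probability_setC//; exact: measurableC.
Qed.

Lemma measurable_bigsetU_seq (J : Type) (s : seq J) (Q : pred J) (F : J -> set T) :
  (forall j, Q j -> measurable (F j)) -> measurable (\big[setU/set0]_(j <- s | Q j) F j).
Proof.
move=> mF; elim/big_ind : _ => //; exact: measurableU.
Qed.

Lemma pr_bigU_le (J : Type) (s : seq J) (Q : pred J) (F : J -> set T) :
  (forall j, Q j -> measurable (F j)) ->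
  pr (\big[setU/set0]_(j <- s | Q j) F j) <= \sum_(j <- s | Q j) pr (F j).
Proof.
move=> mF; elim: s => [|j s IH]; first by rewrite !big_nil /pr measure0.
rewrite !big_cons; case: ifP => Qj //.
by rewrite (le_trans (prU_le _ _))// ?lerD2l//; [exact: mF|exact: measurable_bigsetU_seq].
Qed.

Lemma markov_mean f A (c : R) : bounded_measurable f -> measurable A ->
  (forall x, 0 <= f x) -> (forall x, A x -> c <= f x) -> 0 < c ->
  pr A <= mean f / c.
Proof.
move=> bf mA f0 fc c0; rewrite ler_pdivlMr// mulrC -mean_indic//.
rewrite -meanZ; last exact: bounded_measurable_indic.
apply: mean_le => //; first by apply: bounded_measurableZ; exact: bounded_measurable_indic.
move=> x; rewrite indicE; case: (boolP (x \in A)); last by rewrite mulr0.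
by rewrite inE mulr1 => /fc.
Qed.

Lemma mean_dominated (f_ : nat -> T -> R) f (M : R) :
  (forall n, measurable_fun setT (f_ n)) -> measurable_fun setT f ->
  (forall n x, `|f_ n x| <= M) ->
  {ae P, forall x, f_ n x @[n --> \oo] --> f x} ->
  mean (f_ n) @[n --> \oo] --> mean f.
Proof.
move=> mf_ mf fM cf.
have := @dominated_convergence _ _ _ P setT measurableT
  (fun n => EFin \o f_ n) (EFin \o f) (EFin \o cst M).
have mE (g : T -> R) : measurable_fun setT g -> measurable_fun setT (EFin \o g).
  by move=> ?; exact/measurable_EFinP.
move=> /(_ (fun n => mE _ (mf_ n)) (mE _ mf)).
have aeE : \forall x \ae P, setT x -> (EFin \o f_ n) x @[n --> \oo] --> (EFin \o f) x.
  by apply: filterS cf => x cfx _; apply: cvg_EFin => //; exact: nearW.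
move=> /(_ aeE (bounded_measurable_integrable (bounded_measurable_cst M))).
have aeM : \forall x \ae P, forall n, setT x -> (`|(EFin \o f_ n) x| <= (EFin \o cst M) x)%E.
  by apply/aeW => x n _ /=; rewrite lee_fin.
move=> /(_ aeM)[intf _ cvI].
rewrite /mean /Rintegral; apply: fine_cvg.
by rewrite fineK//; exact: integrable_fin_num.
Qed.

End mean.

Section mean_image.
Context {R : realType} {d d' : measure_display} {T : measurableType d}
  {U : measurableType d'}.
Variables (P : probability T R) (X : {mfun T >-> U}).

Lemma bounded_measurable_compfun (f : U -> R) :
  bounded_measurable f -> bounded_measurable (fun x => f (X x)).
Proof.
move=> [mf [M fM]]; split; last by exists M => x; exact: fM.
exact: (measurableT_comp mf).
Qed.

Lemma mean_distribution (f : U -> R) : bounded_measurable f ->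
  mean (distribution P X) f = mean P (fun x => f (X x)).
Proof.
move=> bf; rewrite /mean /Rintegral integral_pushforward//.
- by have [mf _] := bf; exact/measurable_EFinP.
- rewrite preimage_setT.
  exact: (bounded_measurable_integrable _ (bounded_measurable_compfun bf)).
Qed.

End mean_image.

Section bounded_measurable_approximation.
Context {R : realType} {d : measure_display} {T : measurableType d}.

Lemma count_below_dist (N : nat) (y : R) : 0 <= y -> y <= N%:R ->
  `|y - \sum_(i < N) (i.+1%:R <= y :> R)%:R| <= 1.
Proof.
elim: N => [|N IH] y0 yN.
  by rewrite big_ord0 subr0 ger0_norm// (le_trans yN)// ler01.
rewrite big_ord_recr/=; have [yleN|yN'] := leP y N%:R.
  rewrite [(N.+1%:R <= y)](_ : _ = false) ?addr0; first exact: IH.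
  by apply/negbTE; rewrite -ltNge (le_lt_trans yleN)// ltr_nat.
rewrite (eq_bigr (fun=> 1)); last first.
  by move=> i _; rewrite (le_trans _ (ltW yN'))// ler_nat.
rewrite sumr_const card_ord; have [NSy|yNS] := leP N.+1%:R y.
  rewrite (_ : y = N.+1%:R); last by apply/eqP; rewrite eq_le yN.
  by rewrite -natr1 subrr normr0 ler01.
rewrite addr0 ger0_norm; first by rewrite lerBlDl -natr1 in yN *.
by rewrite subr_ge0 ltW.
Qed.

(** Layer-cake: a bounded function is, up to a uniform error, a finite
    combination of the indicators of its superlevel sets. *)
Lemma bounded_measurable_approx (h : T -> R) (e : R) :
  bounded_measurable h -> 0 < e ->
  exists (N : nat) (c0 c : R) (A : 'I_N -> set T), (forall i, measurable (A i)) /\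
    forall x, `|h x - (c0 + \sum_(i < N) c * \1_(A i) x)| <= e.
Proof.
move=> [mh [M hM]] e0.
pose N := (Num.truncn ((M + M) / e)).+1.
pose A (i : 'I_N) := [set x | i.+1%:R <= (h x + M) / e].
exists N, (- M), e, A; split.
  move=> i; rewrite /A.
  have -> : [set x | i.+1%:R <= (h x + M) / e] =
      (fun x => (h x + M) / e) @^-1` `[i.+1%:R, +oo[.
    by apply/seteqP; split => x /=; rewrite in_itv/= andbT.
  rewrite -[X in measurable X]setTI; apply: measurable_funM => //.
  exact: measurable_funD.
move=> x; rewrite -mulr_sumr.
have hx : 0 <= (h x + M) / e.
  rewrite divr_ge0 ?(ltW e0)//.
  by have := hM x; rewrite ler_norml => /andP[+ _]; rewrite -subr_ge0 opprK.
have hN : (h x + M) / e <= N%:R.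
  rewrite (le_trans _ (ltW (Num.Theory.truncnS_gt _)))// ler_pM2r ?invr_gt0// lerD2r.
  by have := hM x; rewrite ler_norml => /andP[_].
have := count_below_dist hx hN.
rewrite -(ler_pM2l e0) mulr1; apply: le_trans.
rewrite -{2}(gtr0_norm e0) -normrM mulrBr mulrCA divff ?gt_eqF// mulr1.
rewrite opprD opprK addrA; under eq_bigr do rewrite indicE mem_setE.
by [].
Qed.

End bounded_measurable_approximation.

(** * Independence of the coordinates *)

Section product_space.
Context {R : realType} {d : measure_display} {S : measurableType d}.
Variables (P : probability S R) (PN : probability (sequence_space S) R).
Hypothesis PN_product : is_infinite_product P PN.
Implicit Types (F G : sequence_space S -> R) (h : S -> R) (k n : nat).

Lemma measurable_coordinate j :
  measurable_fun setT (fun w : sequence_space S => w j : S).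
Proof.
move=> _ B mB; rewrite setTI.
by apply: sub_sigma_algebra; exists j, B.
Qed.

Lemma measurable_cylinder n (B : nat -> set S) : (forall j, measurable (B j)) ->
  measurable [set w : sequence_space S | forall j, (j < n)%N -> B j (w j)].
Proof.
move=> mB.
have -> : [set w : sequence_space S | forall j, (j < n)%N -> B j (w j)] =
    \bigcap_(j in [set j | (j < n)%N]) [set w : sequence_space S | B j (w j)].
  by apply/seteqP; split => w /= wB j; exact: wB.
apply: bigcap_measurableType => j _.
rewrite -[X in measurable X]setTI; exact: measurable_coordinate.
Qed.

Lemma bounded_measurable_coordinate h j : bounded_measurable h ->
  bounded_measurable (fun w : sequence_space S => h (w j)).
Proof.
move=> [mh [M hM]]; split; last by exists M => w; exact: hM.
exact: (measurableT_comp mh (measurable_coordinate j)).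
Qed.

Lemma prod_indic_cylinder k n (B : nat -> set S) (w : sequence_space S) :
  \prod_(k <= j < n) \1_(B j) (w j) =
  \1_([set w | forall j, (j < n)%N -> (if (k <= j)%N then B j else setT) (w j)]) w :> R.
Proof.
rewrite [RHS]indicE.
have [wB|nwB] := pselect (forall j, (j < n)%N -> (if (k <= j)%N then B j else setT) (w j)).
  rewrite [in RHS]mem_set// big_nat_cond big1// => j /andP[/andP[kj jn] _].
  by rewrite indicE mem_set//; have := wB j jn; rewrite kj.
rewrite [in RHS]memNset//; have [j jn nj] : exists2 j, (j < n)%N & ~ (if (k <= j)%N then B j else setT) (w j).
  by apply: contrapT => h; apply: nwB => j jn; apply: contrapT => nj; apply: h; exists j.
have kj : (k <= j)%N by move: nj; case: ifP => // _ /(_ I).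
rewrite (bigD1_seq j) ?mem_index_iota ?kj ?iota_uniq//= indicE memNset ?mul0r//.
by move: nj; rewrite kj.
Qed.

(** Being a function of the first [k] coordinates, in the form in which it is
    used: independence from the events on the other ones. *)
Definition past k F := bounded_measurable F /\
  forall (B : nat -> set S) n, (forall j, measurable (B j)) ->
    mean PN (fun w => F w * \prod_(k <= j < n) \1_(B j) (w j)) =
    mean PN F * \prod_(k <= j < n) pr P (B j).

Lemma past0_cst (c : R) : past 0 (fun=> c).
Proof.
split; first exact: bounded_measurable_cst.
move=> B n mB; rewrite mean_cst.
have mC := measurable_cylinder n mB.
under eq_mean do rewrite prod_indic_cylinder/=.
rewrite meanZ ?mean_indic//; last exact: bounded_measurable_indic.
congr *%R; apply: EFin_inj; rewrite -prE// PN_product// big_mkord.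
by rewrite -prodEFin; apply: eq_bigr => j _; rewrite prE.
Qed.

Lemma pastS k F : past k F -> past k.+1 F.
Proof.
move=> [bF FB]; split=> // B n mB.
have [kn|nk] := ltnP k n; last first.
  under eq_mean do rewrite big_geq ?(leq_trans nk)// mulr1.
  by rewrite [in RHS]big_geq ?mulr1// (leq_trans nk).
pose B' j := if j == k then setT else B j.
have mB' j : measurable (B' j) by rewrite /B'; case: ifP.
have BE j : (k < j)%N -> B' j = B j by move=> kj; rewrite /B' gtn_eqF.
have -> : \prod_(k.+1 <= j < n) pr P (B j) = \prod_(k <= j < n) pr P (B' j).
  rewrite (big_ltn kn) {1}/B' eqxx pr_setT mul1r.
  by apply: eq_big_nat => j /andP[kj _]; rewrite BE.
rewrite -FB//; apply: eq_mean => w; rewrite (big_ltn kn) {1}/B' eqxx indicT mul1r.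
by congr *%R; apply: eq_big_nat => j /andP[kj _]; rewrite BE.
Qed.

Lemma past_cst k (c : R) : past k (fun=> c).
Proof. by elim: k => [|k]; [exact: past0_cst|exact: pastS]. Qed.

Let bounded_measurable_tail k n (B : nat -> set S) : (forall j, measurable (B j)) ->
  bounded_measurable (fun w : sequence_space S => \prod_(k <= j < n) \1_(B j) (w j) : R).
Proof.
move=> mB; apply: bounded_measurable_prod => j.
by apply: bounded_measurable_coordinate; exact: bounded_measurable_indic.
Qed.

Lemma pastZ k (c : R) F : past k F -> past k (fun w => c * F w).
Proof.
move=> [bF FB]; split; first exact: bounded_measurableZ.
move=> B n mB; rewrite meanZ// -mulrA -FB// -meanZ; last first.
  by apply: bounded_measurableM => //; exact: bounded_measurable_tail.
by apply: eq_mean => w; rewrite mulrA.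
Qed.

Lemma pastD k F G : past k F -> past k G -> past k (fun w => F w + G w).
Proof.
move=> [bF FB] [bG GB]; split; first exact: bounded_measurableD.
move=> B n mB; rewrite meanD// mulrDl -FB// -GB// -meanD.
- by apply: eq_mean => w; rewrite mulrDl.
- by apply: bounded_measurableM => //; exact: bounded_measurable_tail.
- by apply: bounded_measurableM => //; exact: bounded_measurable_tail.
Qed.

Lemma pastB k F G : past k F -> past k G -> past k (fun w => F w - G w).
Proof.
move=> pF /(pastZ (-1)) pG; have := pastD pF pG.
by congr past; apply/funext => w; rewrite mulN1r.
Qed.

(** The integrand [h] is approximated uniformly by combinations of indicators,
    for which the product formula is one more factor in the cylinder. *)
Let past_tail k F h (B : nat -> set S) n : past k F -> bounded_measurable h ->
    (k < n)%N -> (forall j, measurable (B j)) ->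
  mean PN (fun w => F w * h (w k) * \prod_(k.+1 <= j < n) \1_(B j) (w j)) =
  mean PN F * mean P h * \prod_(k.+1 <= j < n) pr P (B j).
Proof.
move=> [bF FB] bh kn mB.
set Q := \prod_(_ <= j < _) pr P _.
pose G (w : sequence_space S) : R := \prod_(k.+1 <= j < n) \1_(B j) (w j).
have bG : bounded_measurable G by exact: bounded_measurable_tail.
have bFG : bounded_measurable (fun w => F w * G w) by exact: bounded_measurableM.
(* the identity for indicators is the hypothesis on F *)
have indicP A : measurable A ->
    mean PN (fun w => F w * \1_A (w k) * G w) = mean PN F * pr P A * Q.
  move=> mA; pose B' j := if j == k then A else B j.
  have mB' j : measurable (B' j) by rewrite /B'; case: ifP.
  have BE j : (k < j)%N -> B' j = B j by move=> kj; rewrite /B' gtn_eqF.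
  have BQ : \prod_(k <= j < n) pr P (B' j) = pr P A * Q.
    rewrite (big_ltn kn) {1}/B' eqxx; congr *%R.
    by apply: eq_big_nat => j /andP[kj _]; rewrite BE.
  rewrite -mulrA -BQ -FB//; apply: eq_mean => w.
  rewrite (big_ltn kn) {1}/B' eqxx mulrA; congr *%R.
  by apply: eq_big_nat => j /andP[kj _]; rewrite BE.
have cstP : mean PN (fun w => F w * G w) = mean PN F * Q.
  have := indicP setT measurableT; rewrite pr_setT mulr1 => <-.
  by apply: eq_mean => w; rewrite indicT mulr1.
have [_ [K FGK]] := bFG.
have [K' FK'] : exists K', `|mean PN F * Q| <= K' by exists `|mean PN F * Q|.
have K'0 : 0 <= K' by rewrite (le_trans _ FK').
have K0 : 0 <= K by apply: le_trans (FGK point); exact: normr_ge0.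
apply/eqP; rewrite -subr_eq0 -normr_le0; apply/ler_addgt0Pl => e e0; rewrite addr0.
have ee0 : 0 < e / (K + K' + 1) by rewrite divr_gt0// ltr_wpDl// addr_ge0.
have [N [c0 [c [A [mA hA]]]]] := bounded_measurable_approx bh ee0.
pose s x : R := c0 + \sum_(i < N) c * \1_(A i) x.
have bs : bounded_measurable s.
  apply: bounded_measurableD; first exact: bounded_measurable_cst.
  by apply: bounded_measurable_sum => i; apply: bounded_measurableZ; exact: bounded_measurable_indic.
have bFhG h' : bounded_measurable h' -> bounded_measurable (fun w => F w * h' (w k) * G w).
  by move=> bh'; do 2 apply: bounded_measurableM => //; exact: bounded_measurable_coordinate.
have sP : mean PN (fun w => F w * s (w k) * G w) = mean PN F * mean P s * Q.
  have bA i : bounded_measurable (\1_(A i) : S -> R) by exact: bounded_measurable_indic.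
  have ms : mean P s = c0 + \sum_(i < N) c * pr P (A i).
    rewrite /s meanD; [|exact: bounded_measurable_cst|]; last first.
      by apply: bounded_measurable_sum => i; exact: bounded_measurableZ.
    rewrite mean_cst mean_sum; last by move=> i; exact: bounded_measurableZ.
    by congr +%R; apply: eq_bigr => i _; rewrite meanZ ?mean_indic.
  transitivity (mean PN (fun w => c0 * (F w * G w) +
      \sum_(i < N) c * (F w * \1_(A i) (w k) * G w))).
    apply: eq_mean => w; rewrite mulrDr mulrDl; congr +%R; first by rewrite mulrAC mulrC.
    by rewrite mulr_sumr mulr_suml; apply: eq_bigr => i _; rewrite (mulrCA (F w)) -!mulrA.
  rewrite meanD; [|exact: bounded_measurableZ|]; last first.
    by apply: bounded_measurable_sum => i; apply: bounded_measurableZ; exact: bFhG.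
  rewrite meanZ// cstP mean_sum; last by move=> i; apply: bounded_measurableZ; exact: bFhG.
  rewrite ms mulrDr mulrDl mulr_sumr mulr_suml; congr +%R; first by rewrite mulrAC mulrC.
  by apply: eq_bigr => i _; rewrite meanZ ?indicP//; [ring|exact: bFhG].
rewrite (_ : _ - _ = (mean PN (fun w => F w * h (w k) * G w) - mean PN (fun w => F w * s (w k) * G w))
   + (mean PN F * Q) * (mean P s - mean P h)); last first.
  by rewrite sP /G; ring.
rewrite (le_trans (ler_normD _ _))//.
apply: (@le_trans _ _ (K * (e / (K + K' + 1)) + K' * (e / (K + K' + 1)))).
  apply: lerD; last first.
    rewrite normrM ler_pM// distrC; apply: mean_dist_le => //.
  apply: mean_dist_le; [exact: bFhG|exact: bFhG|move=> w].
  rewrite -mulrBl -mulrBr mulrAC normrM ler_pM//.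
rewrite -mulrDl mulrCA ger_pMr// ler_pdivrMr ?mul1r ?lerDl//.
by rewrite ltr_wpDl// addr_ge0.
Qed.

Lemma past_mean_mul k F h : past k F -> bounded_measurable h ->
  mean PN (fun w => F w * h (w k)) = mean PN F * mean P h.
Proof.
move=> pF bh; have := past_tail pF bh (ltnSn k) (fun=> measurableT).
by rewrite big_geq// mulr1 => <-; apply: eq_mean => w; rewrite big_geq// mulr1.
Qed.

Lemma past_mul k F h : past k F -> bounded_measurable h ->
  past k.+1 (fun w => F w * h (w k)).
Proof.
move=> pF bh; split.
  by apply: bounded_measurableM; [exact: pF.1|exact: bounded_measurable_coordinate].
move=> B n mB; rewrite past_mean_mul//.
have [kn|nk] := ltnP k n; first exact: past_tail.
have nk1 : (n <= k.+1)%N by rewrite (leq_trans nk).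
rewrite [in RHS]big_geq// mulr1 -(past_mean_mul pF bh).
by apply: eq_mean => w; rewrite big_geq// mulr1.
Qed.

Lemma past_prod n (h : nat -> S -> R) : (forall j, bounded_measurable (h j)) ->
  past n (fun w => \prod_(j < n) h j (w j)).
Proof.
move=> bh; elim: n => [|n IH].
  by under eq_fun do rewrite big_ord0; exact: past_cst.
under eq_fun do rewrite big_ord_recr/=; exact: past_mul.
Qed.

Lemma mean_prod n (h : nat -> S -> R) : (forall j, bounded_measurable (h j)) ->
  mean PN (fun w => \prod_(j < n) h j (w j)) = \prod_(j < n) mean P (h j).
Proof.
move=> bh; elim: n => [|n IH].
  by rewrite big_ord0; under eq_mean do rewrite big_ord0; rewrite mean_cst.
rewrite big_ord_recr/= -IH -(past_mean_mul (past_prod n bh) (bh n)).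
by apply: eq_mean => w; rewrite big_ord_recr.
Qed.

(** Angle addition splits the cosine into products over the last coordinate and
    the previous ones; shifting [b] by [pi / 2] turns the sines of the
    induction into cosines. *)
Lemma past_cos_sum n (u : nat -> S -> R) (b : R) :
  (forall j, measurable_fun setT (u j)) ->
  past n (fun w => cos (b + \sum_(j < n) u j (w j))).
Proof.
move=> mu; elim: n b => [|n IH] b.
  by under eq_fun do rewrite big_ord0; exact: past_cst.
have bsin (f : S -> R) : measurable_fun setT f -> bounded_measurable (fun x => sin (f x)).
  apply: bounded_measurable_comp; first exact: continuous_sin.
  by exists 1 => x; exact: sin_max.
have sinE x : sin x = cos (x - pi / 2) :> R by rewrite cosB cos_pihalf sin_pihalf mulr0 mulr1 add0r.
under eq_fun do rewrite big_ord_recr/= addrA cosD.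
apply: pastB.
  by apply: (past_mul (h := fun x => cos (u n x))) => //; exact: bounded_measurable_cos.
apply: (past_mul (h := fun x => sin (u n x))); last exact: bsin.
by under eq_fun do rewrite sinE addrAC; exact: IH.
Qed.

End product_space.

(** * Elementary inequalities *)

Section real_inequalities.
Context {R : realType}.
Implicit Types x y b : R.

Lemma mvt_bound (f f' : R -> R) (M y : R) :
  (forall t : R, is_derive t 1 f (f' t)) -> (forall t, `|t| <= `|y| -> `|f' t| <= M) ->
  `|f y - f 0| <= M * `|y|.
Proof.
move=> df f'M.
have cf a b : {within `[a, b], continuous f}.
  apply: continuous_subspaceT => t; apply: differentiable_continuous.
  exact/derivable1_diffP/ex_derive.
have [y0|y0] := leP 0 y.
  have [t + ->] := MVT_segment y0 (fun t _ => df t) (cf 0 y).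
  rewrite in_itv/= => /andP[t0 ty]; rewrite subr0 normrM ler_wpM2r// f'M//.
  by rewrite !ger0_norm.
have [t + E] := MVT_segment (ltW y0) (fun t _ => df t) (cf y 0).
rewrite in_itv/= => /andP[ty t0]; rewrite distrC E sub0r normrM normrN ler_wpM2r// f'M//.
by rewrite !ler0_norm ?lerN2// ltW.
Qed.

Lemma sin_abs_le y : `|sin y| <= `|y|.
Proof.
have := @mvt_bound sin cos 1 y _ (fun t _ => cos_max t).
by rewrite sin0 subr0 mul1r; apply => t; exact: is_derive_sin.
Qed.

Lemma cos_abs_le y : `|cos y - 1| <= y ^+ 2.
Proof.
have := @mvt_bound cos (fun t => - sin t) `|y| y _ _.
rewrite cos0 -normrM -expr2 [X in _ -> _ -> _ <= X]ger0_norm ?sqr_ge0//; apply => t.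
by move=> ty; rewrite normrN (le_trans (sin_abs_le t)).
Qed.

Lemma sin_taylor3 y : `|sin y - y| <= `|y| ^+ 3.
Proof.
have := @mvt_bound (fun t => sin t - t) (fun t => cos t - 1) (`|y| ^+ 2) y _ _.
rewrite sin0 !subr0 -exprSr; apply => t ty.
by rewrite (le_trans (cos_abs_le t))// -real_normK ?num_real// lerXn2r// nnegrE.
Qed.

Lemma cos_taylor4 y : `|cos y - 1 + y ^+ 2 / 2| <= `|y| ^+ 4.
Proof.
have := @mvt_bound (fun t => cos t - 1 + t ^+ 2 / 2) (fun t => - sin t + t) (`|y| ^+ 3) y _ _.
rewrite cos0 subrr expr0n/= mul0r addr0 !subr0 -exprSr; apply => [t|t ty].
  apply: is_derive_eq.
  by rewrite /GRing.scale/=; field.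
rewrite addrC distrC (le_trans (sin_taylor3 t))// lerXn2r// nnegrE.
Qed.

Lemma expR_taylor2 y : `|y| <= 1 / 2 -> expR y <= 1 + y + 2 * y ^+ 2.
Proof.
move=> y2; have /andP[y2l y2r] : - (1 / 2) <= y <= 1 / 2 by rewrite -ler_norml.
have y1 : 0 < 1 - y by lra.
have : expR y <= (1 - y)^-1.
  rewrite -[leLHS]invrK -expRN lef_pV2 ?posrE ?expR_gt0//.
  by rewrite (le_trans _ (expR_ge1Dx _)).
move=> /le_trans; apply; rewrite -div1r ler_pdivrMr//; nra.
Qed.

Lemma expRN_taylor2 y : 0 <= y -> `|expR (- y) - (1 - y)| <= y ^+ 2.
Proof.
move=> y0; rewrite ger0_norm; last by rewrite subr_ge0 expR_ge1Dx.
have : expR (- y) <= (1 + y)^-1.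
  by rewrite expRN lef_pV2 ?posrE ?expR_gt0 ?expR_ge1Dx// ltr_wpDr.
rewrite lerBlDr => /le_trans -> //.
rewrite -div1r ler_pdivrMr; last by rewrite ltr_wpDr.
nra.
Qed.

Lemma cvg_sqrtVn : (Num.sqrt n%:R)^-1 @[n --> \oo] --> (0 : R).
Proof.
apply/cvgrPdist_le => /= e e0; near=> n.
have n0 : (0 < n)%N by near: n; exists 1%N.
rewrite sub0r normrN ger0_norm ?invr_ge0 ?sqrtr_ge0//.
rewrite -[leRHS]invrK lef_pV2 ?posrE ?invr_gt0 ?sqrtr_gt0 ?ltr0n//.
rewrite -[leLHS]ger0_norm ?invr_ge0 ?(ltW e0)// -sqrtr_sqr ler_sqrt ?ler0n//.
by near: n; exact: nbhs_infty_ger.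
Unshelve. all: by end_near. Qed.

Lemma expr_dist_le (a b : R) n : `|a| <= 1 -> `|b| <= 1 ->
  `|a ^+ n - b ^+ n| <= n%:R * `|a - b|.
Proof.
move=> a1 b1; elim: n => [|n IH]; first by rewrite !expr0 subrr normr0 mul0r.
have -> : a ^+ n.+1 - b ^+ n.+1 = a * (a ^+ n - b ^+ n) + (a - b) * b ^+ n.
  by rewrite !exprS; ring.
rewrite (le_trans (ler_normD _ _))// -natr1 [(n%:R + 1) * _]mulrDl mul1r lerD//.
  by rewrite normrM (le_trans _ IH)// ler_piMl.
by rewrite normrM ler_piMr// normrX exprn_ile1.
Qed.

End real_inequalities.

(** * Normalized sums of bounded variables *)

Section normalized_sums.
Context {R : realType} {d : measure_display} {S : measurableType d}.
Variables (P : probability S R) (PN : probability (sequence_space S) R).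
Hypothesis PN_product : is_infinite_product P PN.
Implicit Types (f : S -> R) (n : nat) (w : sequence_space S).

Definition normalized_sum n f w : R := (Num.sqrt n%:R)^-1 * \sum_(j < n) f (w j).

Lemma measurable_normalized_sum n f : measurable_fun setT f ->
  measurable_fun setT (normalized_sum n f).
Proof.
move=> mf; apply: measurable_funM => //; apply: measurable_sum => j.
exact: (measurableT_comp mf (measurable_coordinate j)).
Qed.

Lemma bounded_measurable_normalized_sum n f : bounded_measurable f ->
  bounded_measurable (normalized_sum n f).
Proof.
move=> bf; apply: bounded_measurableZ; apply: bounded_measurable_sum => j.
exact: bounded_measurable_coordinate.
Qed.

Lemma sqrtVn_sqr n : (0 < n)%N -> n%:R * (Num.sqrt n%:R)^-1 ^+ 2 = 1 :> R.
Proof.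
by move=> n0; rewrite exprVn sqr_sqrtr ?ler0n// divff// pnatr_eq0 -lt0n.
Qed.

(** Each step of the angle addition leaves an error proportional to the mean of
    the sine, which centering makes negligible. *)
Let cos_sum_step n (u : S -> R) (b : R) : measurable_fun setT u ->
  `|mean PN (fun w => cos (b + \sum_(j < n) u (w j))) - cos b * mean P (fun s => cos (u s)) ^+ n|
   <= n%:R * `|mean P (fun s => sin (u s))|.
Proof.
move=> mu.
have bcos : bounded_measurable (fun s => cos (u s)) by exact: bounded_measurable_cos.
have sinE x : sin x = cos (x - pi / 2) :> R.
  by rewrite cosB cos_pihalf sin_pihalf mulr0 mulr1 add0r.
have bsin : bounded_measurable (fun s => sin (u s)).
  apply: (bounded_measurable_comp (h := sin)) => //; first exact: continuous_sin.
  by exists 1 => x; exact: sin_max.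
elim: n b => [|n IH] b.
  under eq_mean do rewrite big_ord0 addr0.
  by rewrite mean_cst expr0 mulr1 subrr normr0 mul0r.
under eq_mean do rewrite big_ord_recr/= addrA cosD.
have pc := past_cos_sum PN_product n b (fun=> mu).
have ps : past P PN n (fun w => sin (b + \sum_(j < n) u (w j))).
  under eq_fun do rewrite sinE addrAC.
  exact: (past_cos_sum PN_product n (b - pi / 2) (fun=> mu)).
have bm h F : past P PN n F -> bounded_measurable h -> bounded_measurable (fun w : sequence_space S => F w * h (w n)).
  by move=> pF bh; have [] := past_mul pF bh.
rewrite meanB; [|exact: (bm (fun x => cos (u x)))|exact: (bm (fun x => sin (u x)))].
rewrite (past_mean_mul pc bcos) (past_mean_mul ps bsin).
set A := mean PN _; set B := mean PN _; set c := mean P _; set e := mean P _.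
have c1 : `|c| <= 1 by apply: mean_norm_le => // s; exact: cos_max.
have B1 : `|B| <= 1 by apply: mean_norm_le => [|s]; [exact: ps.1|exact: sin_max].
rewrite (_ : _ - _ = c * (A - cos b * c ^+ n) - B * e); last by rewrite exprS; ring.
rewrite (le_trans (ler_normB _ _))// -natr1 mulrDl mul1r lerD//.
  by rewrite normrM (le_trans _ (IH b))// ler_piMl.
by rewrite normrM ler_piMl.
Qed.

(** The factors differ from those of the Gaussian characteristic function by
    [O(n^(-3/2))]: centering removes the first-order term of the sine, and the
    power of exponent [n] has Lipschitz constant [n] on the unit interval. *)
Lemma clt_cos f (b : R) : bounded_measurable f -> mean P f = 0 ->
  mean PN (fun w => cos (b + normalized_sum n f w)) @[n --> \oo] -->
  cos b * expR (- (mean P (fun s => f s ^+ 2) / 2)).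
Proof.
move=> bf f0; set s2 := mean P _.
have [mf [K0 fK0]] := bf.
pose K : R := `|K0| + 1.
have K1 : 1 <= K by rewrite /K lerDr.
have K_ge0 : 0 <= K by rewrite (le_trans _ K1).
have fK s : `|f s| <= K by rewrite (le_trans (fK0 s))// (le_trans (ler_norm _))// lerDl.
have bf2 : bounded_measurable (fun s => f s ^+ 2).
  by under eq_fun do rewrite expr2; exact: bounded_measurableM.
have s20 : 0 <= s2 by apply: mean_ge0 => s; exact: sqr_ge0.
pose x n : R := (Num.sqrt n%:R)^-1.
have x0 n : 0 <= x n by rewrite invr_ge0 sqrtr_ge0.
have xn0 : x n @[n --> \oo] --> (0 : R) by exact: cvg_sqrtVn.
pose err n : R := K ^+ 3 * x n + (K ^+ 4 * x n ^+ 2 + s2 ^+ 2 * x n ^+ 2).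
apply/cvgrPdist_le => /= e e0.
have : err n @[n --> \oo] --> K ^+ 3 * 0 + (K ^+ 4 * 0 ^+ 2 + s2 ^+ 2 * 0 ^+ 2).
  by apply: cvgD; [|apply: cvgD]; apply: cvgMr => //; rewrite !expr2; exact: cvgM.
rewrite expr0n/= !mulr0 !addr0 => /cvgrPdist_le /(_ e e0) errn.
near=> n.
have n0 : (0 < n)%N by near: n; exists 1%N.
apply: (@le_trans _ _ (err n)); last first.
  have : `|0 - err n| <= e by near: n; exact: errn.
  by rewrite sub0r normrN => /(le_trans (ler_norm _)).
have nx2 : n%:R * x n ^+ 2 = 1 := sqrtVn_sqr n0.
pose u s := x n * f s.
have mu : measurable_fun setT u by exact: measurable_funM.
have uK s : `|u s| <= x n * K by rewrite normrM ger0_norm// ler_wpM2l.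
have bu : bounded_measurable u by exact: bounded_measurableZ.
have bcos : bounded_measurable (fun s => cos (u s)) by exact: bounded_measurable_cos.
have bsin : bounded_measurable (fun s => sin (u s)).
  apply: (bounded_measurable_comp (h := sin)) => //; first exact: continuous_sin.
  by exists 1 => y; exact: sin_max.
set c := mean P (fun s => cos (u s)); pose sn := mean P (fun s => sin (u s)).
have sn_le : n%:R * `|sn| <= K ^+ 3 * x n.
  have : `|sn| <= (x n * K) ^+ 3.
    have u0 : mean P u = 0 by rewrite meanZ// f0 mulr0.
    rewrite -[sn]subr0 -u0; apply: mean_dist_le => // s.
    by rewrite (le_trans (sin_taylor3 _))// lerXn2r// nnegrE mulr_ge0.
  move=> /(ler_wpM2l (ler0n R n)) /le_trans; apply.
  rewrite (_ : n%:R * _ = n%:R * x n ^+ 2 * (K ^+ 3 * x n)); last by ring.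
  by rewrite nx2 mul1r.
have c_le : n%:R * `|c - (1 - x n ^+ 2 * s2 / 2)| <= K ^+ 4 * x n ^+ 2.
  have : `|c - (1 - x n ^+ 2 * s2 / 2)| <= (x n * K) ^+ 4.
    have -> : 1 - x n ^+ 2 * s2 / 2 = mean P (fun s => 1 - x n ^+ 2 / 2 * f s ^+ 2).
      rewrite meanB ?mean_cst ?meanZ//; [by rewrite mulrAC|exact: bounded_measurable_cst|].
      exact: bounded_measurableZ.
    apply: mean_dist_le => //.
      by apply: bounded_measurableB; [exact: bounded_measurable_cst|exact: bounded_measurableZ].
    move=> s; have := cos_taylor4 (u s).
    have -> : cos (u s) - 1 + u s ^+ 2 / 2 = cos (u s) - (1 - x n ^+ 2 / 2 * f s ^+ 2).
      by rewrite {2}/u; ring.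
    move=> /le_trans; apply.
    by rewrite lerXn2r// nnegrE mulr_ge0.
  move=> /(ler_wpM2l (ler0n R n)) /le_trans; apply.
  rewrite (_ : n%:R * _ = n%:R * x n ^+ 2 * (K ^+ 4 * x n ^+ 2)); last by ring.
  by rewrite nx2 mul1r.
have g_le : n%:R * `|expR (- (x n ^+ 2 * s2 / 2)) - (1 - x n ^+ 2 * s2 / 2)| <= s2 ^+ 2 * x n ^+ 2.
  have y0 : 0 <= x n ^+ 2 * s2 / 2 by rewrite divr_ge0// mulr_ge0// sqr_ge0.
  move: (expRN_taylor2 y0) => /(ler_wpM2l (ler0n R n)) /le_trans; apply.
  have -> : n%:R * (x n ^+ 2 * s2 / 2) ^+ 2 = n%:R * x n ^+ 2 * (x n ^+ 2 * (s2 ^+ 2 / 4)) by field.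
  rewrite nx2 mul1r mulrC; have := sqr_ge0 (x n); have := sqr_ge0 s2; nra.
have expE : expR (- (s2 / 2)) = expR (- (x n ^+ 2 * s2 / 2)) ^+ n.
  rewrite -expRM_natl; congr expR.
  rewrite (_ : n%:R * _ = - (n%:R * x n ^+ 2 * (s2 / 2))); last by ring.
  by rewrite nx2 mul1r.
have c1 : `|c| <= 1 by apply: mean_norm_le => // s; exact: cos_max.
have g1 : `|expR (- (x n ^+ 2 * s2 / 2))| <= 1.
  rewrite ger0_norm ?expR_ge0// -expR0 ler_expR oppr_le0.
  by rewrite divr_ge0// mulr_ge0// sqr_ge0.
have := cos_sum_step n b mu; rewrite -/c -/sn.
have -> : mean PN (fun w => cos (b + \sum_(j < n) u (w j))) =
          mean PN (fun w => cos (b + normalized_sum n f w)).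
  by apply: eq_mean => w; rewrite /normalized_sum mulr_sumr.
set A := mean PN _ => A_le.
have D_le := expr_dist_le n c1 g1; rewrite -expE in D_le.
have cg_le : n%:R * `|c - expR (- (x n ^+ 2 * s2 / 2))| <= K ^+ 4 * x n ^+ 2 + s2 ^+ 2 * x n ^+ 2.
  rewrite (le_trans _ (lerD c_le g_le))// -mulrDr ler_wpM2l//.
  rewrite [X in _ <= _ + X]distrC; exact: ler_distD.
rewrite distrC.
have -> : A - cos b * expR (- (s2 / 2)) =
   (A - cos b * c ^+ n) + cos b * (c ^+ n - expR (- (s2 / 2))) by ring.
rewrite (le_trans (ler_normD _ _))// lerD//; first exact: le_trans sn_le.
rewrite normrM (le_trans (ler_piMl _ (cos_max b)))//.
exact: le_trans cg_le.
Unshelve. all: by end_near. Qed.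

(** Independence turns the moment into an [n]th power; [e^y <= 1 + y + 2 y^2]
    for small [y] and centering give a factor [1 + O(l^2 / n)]. The constraint
    on [l] keeps every term in the range where the bound of the exponential
    holds. *)
Lemma exp_moment f (K l : R) n : (0 < n)%N -> bounded_measurable f -> mean P f = 0 ->
  (forall s, `|f s| <= K) -> `|l| * K <= Num.sqrt n%:R / 2 ->
  mean PN (fun w => expR (l * normalized_sum n f w)) <=
  expR (2 * l ^+ 2 * mean P (fun s => f s ^+ 2)).
Proof.
move=> n0 bf f0 fK lK; set s2 := mean P _.
pose x : R := (Num.sqrt n%:R)^-1.
have sn0 : 0 < Num.sqrt n%:R :> R by rewrite sqrtr_gt0 ltr0n.
have x0 : 0 <= x by rewrite invr_ge0 sqrtr_ge0.
pose u s := l * x * f s.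
have bu : bounded_measurable u by exact: bounded_measurableZ.
have u2 s : `|u s| <= 1 / 2.
  rewrite /u !normrM (ger0_norm x0) mulrAC /x ler_pdivrMr//.
  by apply: (@le_trans _ _ (`|l| * K)); [rewrite ler_wpM2l|rewrite (le_trans lK)// mul1r [leRHS]mulrC].
have bexp : bounded_measurable (fun s => expR (u s)).
  split; first by apply: measurableT_comp => //; exact: bu.1.
  exists (expR (1 / 2)) => s; rewrite ger0_norm ?expR_ge0// ler_expR.
  by rewrite (le_trans (ler_norm _)).
have -> : mean PN (fun w => expR (l * normalized_sum n f w)) =
    mean P (fun s => expR (u s)) ^+ n.
  rewrite -[X in _ ^+ X]card_ord -prodr_const -(mean_prod PN_product n (fun=> bexp)).
  apply: eq_mean => w; rewrite /normalized_sum mulrA mulr_sumr.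
  by rewrite expR_sum.
have bf2 : bounded_measurable (fun s => f s ^+ 2).
  by under eq_fun do rewrite expr2; exact: bounded_measurableM.
have bu2 : bounded_measurable (fun s => u s ^+ 2).
  by under eq_fun do rewrite expr2; exact: bounded_measurableM.
have s20 : 0 <= s2 by apply: mean_ge0 => s; exact: sqr_ge0.
have : mean P (fun s => expR (u s)) <= 1 + 2 * ((l * x) ^+ 2 * s2).
  have -> : 1 + 2 * ((l * x) ^+ 2 * s2) = mean P (fun s => 1 + u s + 2 * u s ^+ 2).
    rewrite meanD; [|by apply: bounded_measurableD => //; exact: bounded_measurable_cst|
       exact: bounded_measurableZ].
    rewrite meanD//; last exact: bounded_measurable_cst.
    have -> : mean P u = 0 by rewrite meanZ// f0 mulr0.
    rewrite mean_cst addr0 meanZ//; congr (_ + 2 * _).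
    by rewrite -[LHS]meanZ//; apply: eq_mean => s; rewrite /u !exprMn.
  apply: mean_le => //; first by apply: bounded_measurableD;
    [apply: bounded_measurableD => //; exact: bounded_measurable_cst|exact: bounded_measurableZ].
  by move=> s; exact: expR_taylor2.
move=> /le_trans /(_ (expR_ge1Dx _)) m_le.
have -> : expR (2 * l ^+ 2 * s2) = expR (2 * ((l * x) ^+ 2 * s2)) ^+ n.
  rewrite -expRM_natl; congr expR; rewrite exprMn.
  rewrite (_ : _ * (2 * _) = 2 * l ^+ 2 * s2 * (n%:R * x ^+ 2)); last by ring.
  by rewrite sqrtVn_sqr// mulr1.
by rewrite lerXn2r// nnegrE ?expR_ge0// mean_ge0// => s; exact: expR_ge0.
Qed.

Lemma measurable_gt_normalized_sum n f (t : R) : measurable_fun setT f ->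
  measurable [set w | t < `|normalized_sum n f w|].
Proof.
move=> mf; rewrite [X in measurable X](_ : _ = (fun w => `|normalized_sum n f w|) @^-1` `]t, +oo[).
  rewrite -[X in measurable X]setTI; apply: measurableT_comp => //.
  exact: measurable_normalized_sum.
by apply/seteqP; split => w /=; rewrite in_itv/= andbT.
Qed.

(** Markov's inequality for the sum of the two exponential moments of exponents
    [l] and [- l]; [l] is left free, as the optimal value may exceed what [n]
    allows. *)
Lemma normalized_sum_tail f (K l t : R) n : (0 < n)%N -> bounded_measurable f ->
  mean P f = 0 -> (forall s, `|f s| <= K) -> 0 <= l -> l * K <= Num.sqrt n%:R / 2 ->
  pr PN [set w | t < `|normalized_sum n f w|] <=
  2 * expR (2 * l ^+ 2 * mean P (fun s => f s ^+ 2) - l * t).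
Proof.
move=> n0 bf f0 fK l0 lK; set v := mean P _; set z := 2 * l ^+ 2 * v.
have bexp (l' : R) : bounded_measurable (fun w => expR (l' * normalized_sum n f w)).
  have [mn [M nM]] := bounded_measurable_normalized_sum n bf.
  split; first by apply: measurableT_comp => //; exact: measurable_funM.
  exists (expR (`|l'| * M)) => w; rewrite ger0_norm ?expR_ge0// ler_expR.
  by rewrite (le_trans (ler_norm _))// normrM ler_wpM2l.
have lK' l' : `|l'| = l -> mean PN (fun w => expR (l' * normalized_sum n f w)) <= expR z.
  move=> E; rewrite (le_trans (exp_moment n0 bf f0 fK _)) ?E//.
  by rewrite -[l' ^+ 2]real_normK ?num_real// E.
apply: (@le_trans _ _ (mean PN (fun w => expR (l * normalized_sum n f w) +
    expR (- l * normalized_sum n f w)) / expR (l * t))).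
  apply: markov_mean => //; first exact: bounded_measurableD.
  - exact: (measurable_gt_normalized_sum n t bf.1).
  - move=> w /= tw; case: (leP 0 (normalized_sum n f w)) => h.
      rewrite ger0_norm// in tw; rewrite -[leLHS]addr0 lerD ?expR_ge0// ler_expR.
      by rewrite ler_wpM2l// ltW.
    rewrite ltr0_norm// in tw; rewrite -[leLHS]add0r lerD ?expR_ge0// ler_expR.
    by rewrite mulNr -mulrN ler_wpM2l// ltW.
  - exact: expR_gt0.
rewrite meanD// ler_pdivrMr ?expR_gt0// -mulrA -expRD subrK mulr_natl mulr2n.
by apply: lerD; apply: lK'; rewrite ?normrN ger0_norm.
Qed.

End normalized_sums.

(** * The normal law *)

Section derivative_quadratic.
Context {R : realType}.

Lemma cos_taylor2 (a k : R) : `|cos (a + k) - cos a + k * sin a| <= 3 * k ^+ 2.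
Proof.
have -> : cos (a + k) - cos a + k * sin a = cos a * (cos k - 1) - sin a * (sin k - k).
  by rewrite cosD; ring.
have -> : 3 * k ^+ 2 = k ^+ 2 + 2 * k ^+ 2 by ring.
rewrite (le_trans (ler_normB _ _))// lerD//.
  by rewrite normrM (le_trans _ (cos_abs_le k))// ler_piMl// cos_max.
rewrite normrM (le_trans (ler_piMl _ (sin_max a)))//.
have [k1|k1] := leP `|k| 1.
  rewrite (le_trans (sin_taylor3 k))// -(real_normK (num_real k)) exprS.
  by rewrite ler_wpM2r ?sqr_ge0// (le_trans k1)// ler1n.
rewrite (le_trans (ler_normB _ _))// (le_trans (lerD (sin_abs_le k) (lexx _)))//.
rewrite -(real_normK (num_real k)); have := normr_ge0 k; nra.
Qed.

(** A derivative with a quadratic remainder: it allows differentiation under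
    the integral sign by a pointwise Taylor bound, without dominated
    convergence. *)
Lemma is_derive_quadratic (u : R -> R) (t D C : R) :
  (forall h, `|u (t + h) - u t - h * D| <= C * h ^+ 2) -> is_derive t 1 u D.
Proof.
move=> uC.
have C0 : 0 <= C.
  by have := uC 1; rewrite expr1n mulr1; apply: le_trans.
have cu : h^-1 *: ((u \o shift t) (h *: 1) - u t) @[h --> 0^'] --> D.
  apply/cvgrPdist_le => /= e e0; near=> h.
  have h0 : h != 0 by near: h; exact: nbhs_dnbhs_neq.
  have hC : `|h| <= e / (C + 1).
    near: h; apply: dnbhs0_le; rewrite divr_gt0// ltr_wpDl//.
  rewrite /shift/= [h%:A]mulr1 (addrC h) distrC.
  have -> : h^-1 *: (u (t + h) - u t) - D = h^-1 * (u (t + h) - u t - h * D).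
    by rewrite mulrBr mulKf.
  rewrite normrM normfV ler_pdivrMl ?normr_gt0// (le_trans (uC h))//.
  rewrite -real_normK ?num_real// expr2 mulrA mulrC ler_wpM2l// mulrC.
  rewrite (le_trans (ler_wpM2r C0 hC))// mulrAC ler_pdivrMr ?ltr_wpDl//.
  by rewrite ler_wpM2l ?(ltW e0)// lerDl.
have du : derivable u t 1 by apply/cvg_ex; exists D.
by apply: DeriveDef => //; apply/cvg_lim.
Unshelve. all: by end_near. Qed.

End derivative_quadratic.

Section normal_law.
Context {R : realType}.
Variable s : R.
Hypothesis s0 : s != 0.
Local Notation mu := (@lebesgue_measure R).
Local Notation pdf := (normal_pdf 0 s).
Local Notation N := (normal_prob 0 s).

(** Completing the square: exponential tilting shifts the mean. *)
Lemma normal_pdf_tilt (l x : R) :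
  expR (l * x) * pdf x = expR (l ^+ 2 * s ^+ 2 / 2) * normal_pdf (l * s ^+ 2) s x.
Proof.
rewrite !normal_pdfE// !(mulrCA _ (normal_peak s)); congr *%R.
rewrite /normal_fun -!expRD; congr expR; field.
by [].
Qed.

Lemma integrable_tilt (l : R) :
  mu.-integrable setT (EFin \o (fun x => expR (l * x) * pdf x)).
Proof.
under eq_fun do rewrite normal_pdf_tilt.
have := integrable_normal_pdf (l * s ^+ 2) s.
move=> /(integrableZl measurableT (expR (l ^+ 2 * s ^+ 2 / 2))).
by apply: eq_integrable => // x _; rewrite /= EFinM.
Qed.

Lemma Rintegral_tilt (l : R) :
  \int[mu]_x (expR (l * x) * pdf x) = expR (l ^+ 2 * s ^+ 2 / 2).
Proof.
under eq_Rintegral do rewrite normal_pdf_tilt.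
rewrite RintegralZl//; last exact: integrable_normal_pdf.
by rewrite /Rintegral integral_normal_pdf mulr1.
Qed.

(** Twice the hyperbolic cosine: its product with the density is integrable by
    the tilting formula, and it dominates the polynomial weights below. *)
Let cosh2 x : R := expR (1 * x) + expR (- 1 * x).

Let integrable_weight (f : R -> R) (C : R) : measurable_fun setT f -> (forall x : R, `|f x| <= C * cosh2 x) ->
  mu.-integrable setT (EFin \o (fun x => f x * pdf x)).
Proof.
move=> mf fC.
have := integrableD measurableT (integrable_tilt 1) (integrable_tilt (- 1)).
move=> /(integrableZl measurableT C); apply: le_integrable => //.
  apply/measurable_EFinP; apply: measurable_funM => //; exact: measurable_normal_pdf.
move=> x _; rewrite /= lee_fin normrM (ger0_norm (normal_pdf_ge0 _ _ _)).
rewrite -mulrDl mulrA (le_trans _ (ler_norm _))// ler_wpM2r ?normal_pdf_ge0//.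
Qed.

Let cosh2_ge x : 1 + x ^+ 2 / 2 <= cosh2 x.
Proof.
rewrite /cosh2 mul1r mulN1r; case: (leP 0 x) => x0.
  rewrite (le_trans (expR_ge1Dxn 1 x0))// lerDl expR_ge0//.
have x0' : 0 <= - x by rewrite oppr_ge0 ltW.
by have := expR_ge1Dxn 1 x0'; rewrite sqrrN => /le_trans; apply; rewrite lerDr expR_ge0.
Qed.

Let cosh2_ge1 x : 1 <= cosh2 x.
Proof. by rewrite (le_trans _ (cosh2_ge x))// lerDl divr_ge0// sqr_ge0. Qed.

Let cosh2_gesqr x : x ^+ 2 <= 2 * cosh2 x.
Proof. by have := cosh2_ge x; lra. Qed.

Let cosh2_genorm x : `|x| <= 2 * cosh2 x.
Proof.
rewrite (le_trans _ (ler_wpM2l (ler0n R 2) (cosh2_ge x)))//.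
have := real_normK (num_real x); have := sqr_ge0 (`|x| - 1); nra.
Qed.

Let integrable_bounded (f : R -> R) (C : R) : measurable_fun setT f -> (forall x : R, `|f x| <= C) ->
  mu.-integrable setT (EFin \o (fun x => f x * pdf x)).
Proof.
move=> mf fC; apply: (@integrable_weight _ C) => // x.
by rewrite (le_trans (fC x))// ler_peMr// (le_trans _ (fC x)).
Qed.

Lemma cvg_Rintegral_symmetric (g : R -> R) : mu.-integrable setT (EFin \o g) ->
  \int[mu]_(x in `[- n%:R, n%:R]) g x @[n --> \oo] --> \int[mu]_x g x.
Proof.
move=> ig; have mg := measurable_int _ ig.
pose g_ n x := (g \_ `[- n%:R, n%:R]) x.
have mg_ n : measurable_fun setT (EFin \o g_ n).
  apply/measurable_EFinP; apply/(measurable_restrictT _ _).1 => //.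
  by apply: measurable_funTS; exact/measurable_EFinP.
have := @dominated_convergence _ _ _ mu setT measurableT
  (fun n => EFin \o g_ n) (EFin \o g) (EFin \o (Num.norm \o g)) mg_ mg.
case.
- apply: aeW => x _; apply: cvg_EFin; first exact: nearW.
  apply: cvg_near_cst; near=> n; rewrite /g_ /= patchE mem_set//=.
  rewrite in_itv/= -ler_norml; near: n; exact: nbhs_infty_ger.
- exact: integrable_norm.
- apply: aeW => x n _; rewrite /= lee_fin /g_ patchE; case: ifP => //.
  by rewrite normr0.
move=> _ _ cI; rewrite /Rintegral; apply: fine_cvg.
rewrite fineK ?(integrable_fin_num measurableT ig)//.
apply: cvg_trans cI; apply: near_eq_cvg; near=> n.
rewrite [RHS]integral_mkcond; apply: eq_integral => x _.
by rewrite /g_ /= restrict_EFin.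
Unshelve. all: by end_near. Qed.

Lemma is_derive_normal_pdf (x : R) : is_derive x 1 pdf (- (x / s ^+ 2) * pdf x).
Proof.
rewrite normal_pdfE//.
have -> : (fun x => normal_peak s * normal_fun 0 s x) =
   (fun x => normal_peak s * expR (- (x ^+ 2) * (s ^+ 2 *+ 2)^-1)).
  by apply/funext => y; rewrite /normal_fun subr0.
apply: is_derive_eq; rewrite /GRing.scale/= /normal_fun subr0 -mulr_natr.
by field.
Qed.

(** The integral of the derivative of [sin (b + t x) * pdf x] over the line
    vanishes, since that function tends to [0] at infinity. *)
Let stein (b t : R) : \int[mu]_x (x * sin (b + t * x) * pdf x) =
  s ^+ 2 * t * \int[mu]_x (cos (b + t * x) * pdf x).
Proof.
pose F x := sin (b + t * x) * pdf x.
pose f x := t * (cos (b + t * x) * pdf x) - (s ^+ 2)^-1 * (x * sin (b + t * x) * pdf x).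
have maff : measurable_fun setT (fun x : R => b + t * x).
  by apply: measurable_funD => //; exact: measurable_funM.
have msin : measurable_fun setT (fun x : R => sin (b + t * x)).
  by apply: measurableT_comp => //; apply: continuous_measurable_fun; exact: continuous_sin.
have mcos : measurable_fun setT (fun x : R => cos (b + t * x)).
  by apply: measurableT_comp => //; apply: continuous_measurable_fun; exact: continuous_cos.
have ic : mu.-integrable setT (EFin \o (fun x : R => cos (b + t * x) * pdf x)).
  by apply: (@integrable_bounded _ 1) => // x; exact: cos_max.
have is_ : mu.-integrable setT (EFin \o (fun x => x * sin (b + t * x) * pdf x)).
  apply: (@integrable_weight _ 2); first exact: measurable_funM.
  move=> x; rewrite normrM (le_trans _ (cosh2_genorm x))// ler_piMr//.
  exact: sin_max.
have ic' : mu.-integrable setT (EFin \o (fun x => t * (cos (b + t * x) * pdf x))).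
  by have := integrableZl measurableT t ic; apply: eq_integrable => // x _; rewrite /= EFinM.
have is' : mu.-integrable setT (EFin \o (fun x => (s ^+ 2)^-1 * (x * sin (b + t * x) * pdf x))).
  by have := integrableZl measurableT (s ^+ 2)^-1 is_; apply: eq_integrable => // x _; rewrite /= EFinM.
have if_ : mu.-integrable setT (EFin \o f).
  by have := integrableB measurableT ic' is'; apply: eq_integrable => // x _; rewrite /= EFinB.
have dF (x : R) : is_derive x 1 F (f x).
  have dp := is_derive_normal_pdf x.
  apply: is_derive_eq; rewrite /GRing.scale/= /f; field.
  by [].
have cont (g g' : R -> R) : (forall x : R, is_derive x 1 g (g' x)) -> continuous g.
  move=> dg x; apply: differentiable_continuous.
  exact/derivable1_diffP/ex_derive.
have cF : continuous F by exact: cont dF.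
have cpdf : continuous pdf by exact: (cont _ _ is_derive_normal_pdf).
have csin : continuous (fun x : R => sin (b + t * x)).
  by apply: (cont _ (fun x : R => cos (b + t * x) * t)) => x; apply: is_derive_eq; rewrite /GRing.scale/=; ring.
have ccos : continuous (fun x : R => cos (b + t * x)).
  by apply: (cont _ (fun x => - sin (b + t * x) * t)) => x; apply: is_derive_eq; rewrite /GRing.scale/=; ring.
have cf : continuous f.
  move=> x; apply: cvgB; apply: cvgM; do ?exact: cvg_cst.
    by apply: cvgM; [exact: ccos|exact: cpdf].
  apply: cvgM; last exact: cpdf.
  by apply: cvgM; [exact: cvg_id|exact: csin].
have FTC n : (0 < n)%N -> \int[mu]_(x in `[- n%:R, n%:R]) f x = F n%:R - F (- n%:R).
  move=> n0; rewrite /Rintegral (@continuous_FTC2 _ f F) //.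
  - by rewrite gtrN// ltr0n.
  - exact: continuous_subspaceT.
  - split; first by move=> x _; exact: ex_derive.
    + by apply: cvg_at_right_filter; exact: cF.
    + by apply: cvg_at_left_filter; exact: cF.
  - by move=> x _; rewrite derive1E; exact: derive_val.
have decay x : 0 < x ^+ 2 -> `|F x| <= normal_peak s * (2 * s ^+ 2) / x ^+ 2.
  move=> x2; rewrite normrM (le_trans (ler_piMl (normr_ge0 _) (sin_max _)))//.
  rewrite ger0_norm ?normal_pdf_ge0// normal_pdfE// -mulrA ler_wpM2l ?normal_peak_ge0//.
  have s20 : 0 < s ^+ 2 by rewrite exprn_even_gt0.
  have y0 : 0 < x ^+ 2 / (2 * s ^+ 2) by rewrite divr_gt0// mulr_gt0.
  rewrite /normal_fun subr0 mulNr expRN -[leRHS]invrK lef_pV2 ?posrE ?expR_gt0 ?invr_gt0//; last first.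
    by rewrite divr_gt0// mulr_gt0.
  rewrite invf_div -(mulr_natl (s ^+ 2) 2); apply: le_trans (expR_ge1Dx _).
  by rewrite lerDr.
have F0 : (F n%:R - F (- n%:R)) @[n --> \oo] --> (0 : R).
  pose K := normal_peak s * (2 * s ^+ 2).
  have K0 : 0 <= K by rewrite mulr_ge0 ?normal_peak_ge0// mulr_ge0// sqr_ge0.
  apply/cvgrPdist_le => /= e e0; near=> n.
  have n0 : (0 < n)%N by near: n; exists 1%N.
  have n1 : 1 <= n%:R :> R by rewrite ler1n.
  have nn : n%:R <= n%:R ^+ 2 :> R by rewrite expr2 ler_peMl.
  have Kn x : x ^+ 2 = n%:R ^+ 2 -> `|F x| <= K / n%:R.
    move=> x2; rewrite (le_trans (decay _ _)) ?x2 ?(lt_le_trans _ nn) ?ltr0n//.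
    by rewrite ler_wpM2l// lef_pV2 ?posrE ?(lt_le_trans _ nn) ?ltr0n.
  rewrite sub0r normrN (le_trans (ler_normB _ _))// (le_trans (lerD (Kn _ _) (Kn _ _))) ?sqrrN//.
  rewrite -mulrDl ler_pdivrMr ?ltr0n// mulrC -ler_pdivrMr//.
  by near: n; exact: nbhs_infty_ger.
have : \int[mu]_x f x = 0.
  apply: (@cvg_unique _ _ (\int[mu]_(x in `[- n%:R, n%:R]) f x @[n --> \oo])) => //.
    exact: cvg_Rintegral_symmetric.
  apply: cvg_trans F0; apply: near_eq_cvg; near=> n; rewrite FTC//.
  by near: n; exists 1%N.
rewrite /f RintegralB// !RintegralZl// => /eqP; rewrite subr_eq0 => /eqP E.
have : s ^+ 2 != 0 by rewrite expf_neq0.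
by move=> s20; rewrite -mulrA E mulVKf.
Unshelve. all: by end_near. Qed.

(** By Stein's identity the integral [u], as a function of [t], solves the
    equation [u' = - s^2 t u], whose solutions are multiples of [e^(- s^2 t^2 /
    2)]. *)
Lemma Rintegral_cos_normal_pdf (b t : R) :
  \int[mu]_x (cos (b + t * x) * pdf x) = cos b * expR (- (t ^+ 2 * s ^+ 2 / 2)).
Proof.
pose u t := \int[mu]_x (cos (b + t * x) * pdf x).
have maff t' : measurable_fun setT (fun x : R => b + t' * x).
  by apply: measurable_funD => //; exact: measurable_funM.
have msin t' : measurable_fun setT (fun x : R => sin (b + t' * x)).
  by apply: measurableT_comp => //; apply: continuous_measurable_fun; exact: continuous_sin.
have mcos t' : measurable_fun setT (fun x : R => cos (b + t' * x)).
  by apply: measurableT_comp => //; apply: continuous_measurable_fun; exact: continuous_cos.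
have ic t' : mu.-integrable setT (EFin \o (fun x : R => cos (b + t' * x) * pdf x)).
  by apply: (@integrable_bounded _ 1) => // x; exact: cos_max.
have is_ t' : mu.-integrable setT (EFin \o (fun x => x * sin (b + t' * x) * pdf x)).
  apply: (@integrable_weight _ 2); first exact: measurable_funM.
  move=> x; rewrite normrM (le_trans _ (cosh2_genorm x))// ler_piMr//.
  exact: sin_max.
have i2 : mu.-integrable setT (EFin \o (fun x => x ^+ 2 * pdf x)).
  apply: (@integrable_weight _ 2); first exact: measurable_funX.
  by move=> x; rewrite ger0_norm ?sqr_ge0.
have du (t' : R) : is_derive t' 1 u (- (s ^+ 2 * t' * u t')).
  apply: (@is_derive_quadratic _ _ _ _ (3 * \int[mu]_x (x ^+ 2 * pdf x))) => h.
  rewrite mulrN opprK /u -stein -RintegralB// -RintegralZl// -RintegralD//; first last.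
  - by have := integrableZl measurableT h (is_ t'); apply: eq_integrable => // x _; rewrite /= EFinM.
  - by have := integrableB measurableT (ic (t' + h)) (ic t'); apply: eq_integrable => // x _; rewrite /= EFinB.
  have ih : mu.-integrable setT (EFin \o (fun x => cos (b + (t' + h) * x) * pdf x -
      cos (b + t' * x) * pdf x + h * (x * sin (b + t' * x) * pdf x))).
    have := integrableD measurableT (integrableB measurableT (ic (t' + h)) (ic t'))
       (integrableZl measurableT h (is_ t')).
    by apply: eq_integrable => // x _; rewrite /= EFinD EFinB EFinM.
  apply: (le_trans (le_normr_Rintegral measurableT ih)).
  have i2' : mu.-integrable setT (EFin \o (fun x => 3 * h ^+ 2 * (x ^+ 2 * pdf x))).
    by have := integrableZl measurableT (3 * h ^+ 2) i2; apply: eq_integrable => // x _; rewrite /= EFinM.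
  rewrite mulrAC -RintegralZl//; apply: le_Rintegral => //; first exact: integrable_norm.
  move=> x _; rewrite -mulrBl mulrA -mulrDl normrM (ger0_norm (normal_pdf_ge0 _ _ _)) [leRHS]mulrA.
  rewrite ler_wpM2r ?normal_pdf_ge0//.
  rewrite mulrDl addrA; set a := b + t' * x.
  have -> : h * (x * sin a) = (h * x) * sin a by rewrite mulrA.
  by have := cos_taylor2 a (h * x); rewrite exprMn [X in _ <= X -> _]mulrA.
pose v t := u t * expR (t ^+ 2 * (s ^+ 2 / 2)).
have dv (t' : R) : is_derive t' 1 v 0.
  have := du t' => dut.
  by apply: is_derive_eq; rewrite /GRing.scale/=; field.
have vc : v t = v 0 by exact: is_derive_0_is_cst.
have u0 : u 0 = cos b.
  transitivity (\int[mu]_x (cos b * pdf x)).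
    by apply: eq_Rintegral => x _; rewrite mul0r addr0.
  rewrite RintegralZl//; last exact: integrable_normal_pdf.
  by rewrite /Rintegral integral_normal_pdf mulr1.
move: vc; rewrite /v expr0n/= mul0r expR0 mulr1 u0 => <-.
by rewrite -(mulrA (u t)) -expRD (mulrA (t ^+ 2)) subrr expR0 mulr1.
Qed.

Lemma mean_normal_prob (f : R -> R) : @bounded_measurable R _ (measurableTypeR R) f ->
  mean N f = \int[mu]_x (f x * pdf x).
Proof.
move=> bf; rewrite /mean /Rintegral; congr fine.
have bi := bounded_measurable_integrable N bf.
rewrite -(Radon_Nikodym_change_of_variables (normal_prob_dominates 0 s))//=.
have mf : measurable_fun setT (EFin \o f) by apply/measurable_EFinP; exact: bf.1.
apply: ae_eq_integral => //.
- apply: emeasurable_funM => //; apply: (measurable_int mu).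
  apply: (integrableS _ _ (@subsetT _ _)) => //=.
  by apply: Radon_Nikodym_integrable; exact: normal_prob_dominates.
- apply/measurable_EFinP; apply: measurable_funM; first exact: bf.1.
  exact: measurable_normal_pdf.
- under [X in ae_eq _ _ _ X]eq_fun do rewrite EFinM.
  apply: ae_eqe_mul2l => /=.
  rewrite Radon_NikodymE//=; first exact: normal_prob_dominates.
  move=> abmu; case: cid => /= h [h1 h2 h3].
  apply: integral_ae_eq => //=.
  + by apply/measurable_EFinP; exact: measurable_normal_pdf.
  + by move=> E _ mE; rewrite -h3.
Qed.

Lemma normal_prob_cos (b t : R) :
  mean N (fun x : measurableTypeR R => cos (b + t * x)) = cos b * expR (- (t ^+ 2 * s ^+ 2 / 2)).
Proof.
rewrite mean_normal_prob ?Rintegral_cos_normal_pdf//; apply: bounded_measurable_cos.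
by apply: measurable_funD => //; exact: measurable_funM.
Qed.

(** Markov's inequality with exponent [1 / s]. An exponential tail suffices for
    chaining along geometric grids. *)
Lemma normal_prob_tail (y : R) : 0 < s ->
  pr N [set x | y < `|x|] <= 2 * expR (2^-1 - y / s).
Proof.
move=> sp.
have mA : measurable [set x : measurableTypeR R | y < `|x|].
  rewrite (_ : [set x | _] = `]y, +oo[ `|` `]-oo, - y[); first exact: measurableU.
  by apply/seteqP; split => x /=; rewrite !in_itv/= andbT ltr_normr (ltrNr x); move/orP.
rewrite -mean_indic// mean_normal_prob; last exact: bounded_measurable_indic.
pose l := s^-1.
have it a := integrable_tilt a.
have ii : mu.-integrable setT (EFin \o (fun x => \1_[set x : R | y < `|x|] x * pdf x)).
  apply: (@integrable_bounded _ 1) => [|x]; first exact: measurable_indic.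
  by rewrite indicE; case: (_ \in _); rewrite ?normr1 ?normr0.
have iZ : mu.-integrable setT (EFin \o (fun x => expR (- (l * y)) *
   (expR (l * x) * pdf x + expR (- l * x) * pdf x))).
  have := integrableZl measurableT (expR (- (l * y))) (integrableD measurableT (it l) (it (- l))).
  by apply: eq_integrable => // x _; rewrite /= EFinM EFinD.
apply: (@le_trans _ _ (\int[mu]_x (expR (- (l * y)) *
   (expR (l * x) * pdf x + expR (- l * x) * pdf x)))).
  apply: le_Rintegral => // x _; rewrite -mulrDl mulrA ler_wpM2r ?normal_pdf_ge0//.
  rewrite indicE; case: (boolP (x \in _)) => [|_]; last first.
    by rewrite mulr_ge0 ?expR_ge0// addr_ge0// expR_ge0.
  rewrite inE/= => yx; rewrite mulrDr -!expRD.
  have l0 : 0 <= l by rewrite invr_ge0 ltW.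
  case: (leP 0 x) => x0.
    rewrite ger0_norm// in yx; rewrite -[leLHS]addr0 lerD ?expR_ge0//.
    by rewrite -[leLHS]expR0 ler_expR addrC subr_ge0 ler_wpM2l// ltW.
  rewrite ltr0_norm// in yx; rewrite -[leLHS]add0r lerD ?expR_ge0//.
  by rewrite -[leLHS]expR0 ler_expR addrC subr_ge0 mulNr -mulrN ler_wpM2l// ltW.
have iD : mu.-integrable setT (EFin \o (fun x => expR (l * x) * pdf x + expR (- l * x) * pdf x)).
  have := integrableD measurableT (it l) (it (- l)).
  by apply: eq_integrable => // x _; rewrite /= EFinD.
rewrite RintegralZl// RintegralD// !Rintegral_tilt sqrrN /l exprVn mulVf ?expf_neq0//.
rewrite (_ : _ * (_ + _) = 2 * (expR (1 / 2) * expR (- (s^-1 * y)))); last by ring.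
by rewrite -expRD mul1r (mulrC y).
Qed.

End normal_law.

(** * Bernstein approximation on a bounded interval *)

Section bernstein.
Context {R : realType}.
Implicit Types (y : R) (f g : nat -> R).

(** The mean of [f] under the binomial law of parameters [m] and [y], defined by
    conditioning on one trial: the Bernstein polynomials without binomials. *)
Fixpoint bernstein y m f : R :=
  if m is m'.+1 then (1 - y) * bernstein y m' f + y * bernstein y m' (f \o S)
  else f 0.

Lemma bernstein_le y m f g : 0 <= y <= 1 -> (forall j, f j <= g j) ->
  bernstein y m f <= bernstein y m g.
Proof.
move=> /andP[y0 y1]; elim: m f g => [|m IH] f g fg /=; first exact: fg.
by rewrite lerD// ler_wpM2l ?subr_ge0// IH// => j; exact: fg.
Qed.

Lemma bernstein_cst y m (c : R) : bernstein y m (fun=> c) = c.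
Proof.
elim: m => //= m IH; by rewrite IH; ring.
Qed.

Lemma bernsteinD y m f g :
  bernstein y m (fun j => f j + g j) = bernstein y m f + bernstein y m g.
Proof.
elim: m f g => //= m IH f g.
rewrite IH [in X in y * X](_ : _ \o S = fun j => (f \o S) j + (g \o S) j)// IH; ring.
Qed.

Lemma bernsteinZ y m (c : R) f :
  bernstein y m (fun j => c * f j) = c * bernstein y m f.
Proof.
elim: m f => //= m IH f.
rewrite IH [in X in y * X](_ : _ \o S = fun j => c * (f \o S) j)// IH; ring.
Qed.

(** The shift [c] makes the induction on the number of trials go through; the
    variance is the case [c = 0]. *)
Lemma bernstein_variance y m (c : R) :
  bernstein y m (fun j => (j%:R - m%:R * y - c) ^+ 2) = m%:R * (y * (1 - y)) + c ^+ 2.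
Proof.
elim: m c => [|m IH] c /=; first by ring.
rewrite (_ : (fun j => _) = (fun j => (j%:R - m%:R * y - (y + c)) ^+ 2)); last first.
  by apply/funext => j; rewrite -natr1; congr (_ ^+ 2); ring.
rewrite (_ : _ \o S = (fun j => (j%:R - m%:R * y - (y + c - 1)) ^+ 2)); last first.
  by apply/funext => j /=; rewrite -natr1; congr (_ ^+ 2); ring.
rewrite !IH -natr1; ring.
Qed.

Lemma bernstein_sqr_dist y m : 0 <= y <= 1 -> (0 < m)%N ->
  bernstein y m (fun j => (j%:R / m%:R - y) ^+ 2) <= m%:R^-1.
Proof.
move=> /andP[y0 y1] m0; have mR0 : 0 < m%:R :> R by rewrite ltr0n.
rewrite (_ : (fun j => _) = (fun j => m%:R^-1 ^+ 2 * (j%:R - m%:R * y - 0) ^+ 2)); last first.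
  by apply/funext => j; rewrite -exprMn subr0 mulrBr mulKf ?gt_eqF// mulrC.
rewrite bernsteinZ bernstein_variance expr0n/= addr0 expr2 -mulrA mulKf ?gt_eqF//.
by rewrite ler_piMr ?invr_ge0 ?ltW//; nra.
Qed.

Lemma bernstein_dist y m f (c e : R) : 0 <= y <= 1 ->
  bernstein y m (fun j => `|f j - c|) <= e -> `|bernstein y m f - c| <= e.
Proof.
move=> y01 fe; rewrite -{1}(bernstein_cst y m c) -mulN1r -bernsteinZ -bernsteinD.
apply: le_trans fe; rewrite ler_norml; apply/andP; split.
  rewrite lerNl -[leLHS]mulN1r -bernsteinZ; apply: bernstein_le => // j.
  by rewrite !mulN1r -normrN ler_norm.
by apply: bernstein_le => // j; rewrite mulN1r ler_norm.
Qed.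

End bernstein.

Section sine_scale.
Context {R : realType}.

(** A change of variable that maps the line into the interval of Bernstein
    polynomials, is injective on a prescribed bounded interval for small [c],
    and is itself a trigonometric function. *)
Definition sine_scale (c x : R) : R := (1 + sin (c * x)) / 2.

Lemma sine_scale01 c x : 0 <= sine_scale c x <= 1.
Proof.
rewrite /sine_scale; have := sin_le1 (c * x); have := sin_geN1 (c * x) => h1 h2.
by apply/andP; split; lra.
Qed.

Lemma sin_dist_ge (a b : R) : `|a| <= 1 / 2 -> `|b| <= 1 / 2 ->
  `|a - b| <= 2 * `|sin a - sin b|.
Proof.
wlog ba : a b / b <= a => [hw a2 b2|a2 b2].
  have [ba|/ltW ab] := leP b a; first exact: hw.
  by rewrite distrC (distrC (sin a)); exact: hw.
have df (t : R) : is_derive t 1 (fun t => sin t - t / 2) (cos t - 1 / 2).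
  by apply: is_derive_eq; rewrite /GRing.scale/=; ring.
have cf : {within `[b, a], continuous (fun t => sin t - t / 2)}.
  apply: continuous_subspaceT => t; apply: differentiable_continuous.
  exact/derivable1_diffP/ex_derive.
have [t + E] := MVT_segment ba (fun t _ => df t) cf.
rewrite in_itv/= => /andP[bt ta].
have t2 : t ^+ 2 <= 1 / 4.
  move: a2 b2; rewrite !ler_norml => /andP[_ a2] /andP[b2 _].
  have : - (1 / 2) <= t <= 1 / 2 by apply/andP; split; lra.
  by move=> /andP[]; nra.
have := cos_abs_le t; rewrite ler_norml => /andP[ct _].
have ab0 : 0 <= a - b by rewrite subr_ge0.
have : 0 <= (cos t - 1 / 2) * (a - b) by rewrite mulr_ge0//; lra.
rewrite -E (ger0_norm ab0) => h.
have : a - b <= 2 * (sin a - sin b) by lra.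
by move/le_trans; apply; rewrite ler_wpM2l// ler_norm.
Qed.

Lemma sine_scale_dist_ge (c K x x' : R) : 0 < c -> c * K <= 1 / 2 ->
  `|x| <= K -> `|x'| <= K -> c * `|x - x'| <= 4 * `|sine_scale c x - sine_scale c x'|.
Proof.
move=> c0 cK xK xK'.
have cle z : `|z| <= K -> `|c * z| <= 1 / 2.
  by move=> zK; rewrite normrM gtr0_norm// (le_trans _ cK)// ler_pM2l.
have := sin_dist_ge (cle _ xK) (cle _ xK').
rewrite -mulrBr normrM (gtr0_norm c0) => /le_trans; apply.
rewrite /sine_scale -mulrBl normrM (_ : _ - _ = sin (c * x) - sin (c * x')); last by ring.
by rewrite [`|2^-1|]ger0_norm; lra.
Qed.

End sine_scale.

(** * Levy's continuity theorem *)

Section convergence_of_means.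
Context {R : realType} {N : nat}.
Local Notation V := ('I_N -> R).
Implicit Types (f g : V -> R) (v : V).

Definition l1_dist v v' : R := \sum_(i < N) `|v i - v' i|.

Definition bounded_lipschitz f := (exists B : R, forall v, `|f v| <= B) /\
  exists L : R, forall v v', `|f v - f v'| <= L * l1_dist v v'.

(** The abstract properties of the integral against a law on [R^N] that the
    continuity theorem uses; a sequence of laws of random vectors on one space,
    and its limit, are then treated without forming image measures. *)
Definition lipschitz_mean (M : (V -> R) -> R) := [/\
  forall f g, bounded_lipschitz f -> bounded_lipschitz g ->
    M (fun v => f v + g v) = M f + M g,
  forall (c : R) f, bounded_lipschitz f -> M (fun v => c * f v) = c * M f,
  forall f g, bounded_lipschitz f -> bounded_lipschitz g ->
    (forall v, f v <= g v) -> M f <= M g &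
  M (fun=> 1) = 1].

Definition coordinate_update v (l : 'I_N) (x : R) : V :=
  fun i => if i == l then x else v i.

Lemma l1_dist_ge0 v v' : 0 <= l1_dist v v'.
Proof. by apply: sumr_ge0. Qed.

Lemma l1_dist_coord v v' l : `|v l - v' l| <= l1_dist v v'.
Proof.
by rewrite /l1_dist (bigD1 l)//= lerDl sumr_ge0.
Qed.

Lemma l1_dist_update v v' l x :
  l1_dist (coordinate_update v l x) (coordinate_update v' l x) <= l1_dist v v'.
Proof.
apply: ler_sum => i _; rewrite /coordinate_update; case: ifP => // _.
by rewrite subrr normr0.
Qed.

Lemma l1_dist_update_self v l x : l1_dist (coordinate_update v l x) v = `|x - v l|.
Proof.
rewrite /l1_dist (bigD1 l)//= /coordinate_update eqxx big1 ?addr0// => i /negbTE ->.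
by rewrite subrr normr0.
Qed.

Lemma bounded_lipschitz_cst (c : R) : bounded_lipschitz (fun=> c).
Proof.
split; first by exists `|c|.
by exists 0 => v v'; rewrite subrr normr0 mul0r.
Qed.

Lemma bounded_lipschitzP f : bounded_lipschitz f -> exists B L : R,
  [/\ 0 <= B, 0 <= L, forall v, `|f v| <= B & forall v v', `|f v - f v'| <= L * l1_dist v v'].
Proof.
move=> [[B fB] [L fL]]; exists B, `|L|; split => //.
  by apply: le_trans (fB (fun=> 0)).
by move=> v v'; rewrite (le_trans (fL v v'))// ler_wpM2r ?l1_dist_ge0// ler_norm.
Qed.

Lemma bounded_lipschitzD f g : bounded_lipschitz f -> bounded_lipschitz g ->
  bounded_lipschitz (fun v => f v + g v).
Proof.
move=> [[B fB] [L fL]] [[B' gB] [L' gL]]; split.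
  by exists (B + B') => v; rewrite (le_trans (ler_normD _ _))// lerD.
exists (L + L') => v v'; rewrite opprD addrACA mulrDl.
by rewrite (le_trans (ler_normD _ _))// lerD.
Qed.

Lemma bounded_lipschitzM f g : bounded_lipschitz f -> bounded_lipschitz g ->
  bounded_lipschitz (fun v => f v * g v).
Proof.
move=> /bounded_lipschitzP[B [L [B0 L0 fB fL]]] /bounded_lipschitzP[B' [L' [B0' L0' gB gL]]]; split.
  by exists (B * B') => v; rewrite normrM ler_pM.
exists (B * L' + L * B') => v v'.
rewrite (_ : _ - _ = f v * (g v - g v') + (f v - f v') * g v'); last by ring.
rewrite (le_trans (ler_normD _ _))// [leRHS]mulrDl !normrM lerD//.
  by rewrite -mulrA ler_pM.
by rewrite mulrAC ler_pM.
Qed.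

Lemma bounded_lipschitzZ (c : R) f : bounded_lipschitz f ->
  bounded_lipschitz (fun v => c * f v).
Proof. by apply: bounded_lipschitzM; exact: bounded_lipschitz_cst. Qed.

Lemma bounded_lipschitzB f g : bounded_lipschitz f -> bounded_lipschitz g ->
  bounded_lipschitz (fun v => f v - g v).
Proof.
move=> bf /(bounded_lipschitzZ (-1)) bg; have := bounded_lipschitzD bf bg.
by congr bounded_lipschitz; apply/funext => v; rewrite mulN1r.
Qed.

Lemma bounded_lipschitz_comp (h : R -> R) f : (forall x x', `|h x - h x'| <= `|x - x'|) ->
  bounded_lipschitz f -> bounded_lipschitz (fun v => h (f v)).
Proof.
move=> hL [[B fB] [L fL]]; split; last first.
  by exists L => v v'; exact: le_trans (hL _ _) (fL _ _).
exists (`|h 0| + B) => v; rewrite -[h (f v)](subrK (h 0)) addrC.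
by rewrite (le_trans (ler_normD _ _))// lerD// (le_trans (hL _ _))// subr0 fB.
Qed.

Lemma max0_dist_le (z z' : R) : `|Num.max 0 z - Num.max 0 z'| <= `|z - z'|.
Proof.
case: (leP 0 z) => z0; case: (leP 0 z') => z0'.
- by [].
- by rewrite subr0 ger0_norm// (le_trans _ (ler_norm _))//; lra.
- by rewrite sub0r normrN ger0_norm// distrC (le_trans _ (ler_norm _))//; lra.
- by rewrite subrr normr0.
Qed.

Lemma cos_dist_le (x x' : R) : `|cos x - cos x'| <= `|x - x'|.
Proof.
have := @mvt_bound _ (fun t => cos (x' + t)) (fun t => - sin (x' + t)) 1 (x - x') _ _.
rewrite addr0 (addrC x') subrK mul1r; apply => t; last by move=> _; rewrite normrN sin_max.
by apply: is_derive_eq; rewrite /GRing.scale/=; ring.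
Qed.

Lemma bounded_lipschitz_cos (a : V) (b : R) :
  bounded_lipschitz (fun v => cos (b + \sum_(i < N) a i * v i)).
Proof.
split; first by exists 1 => v; exact: cos_max.
exists (\sum_(i < N) `|a i|) => v v'; rewrite (le_trans (cos_dist_le _ _))//.
rewrite opprD addrACA subrr add0r -sumrB (le_trans (ler_norm_sum _ _ _))//.
rewrite mulr_suml ler_sum// => i _; rewrite -mulrBr normrM ler_wpM2l//.
exact: l1_dist_coord.
Qed.

Lemma bounded_lipschitz_sine_scale (c : R) l : bounded_lipschitz (fun v => sine_scale c (v l)).
Proof.
split.
  by exists 1 => v; have /andP[h0 h1] := sine_scale01 c (v l); rewrite ger0_norm.
exists `|c| => v v'; rewrite /sine_scale -mulrBl opprD addrACA subrr add0r.
have sE x : sin x = cos (x - pi / 2) :> R.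
  by rewrite cosB cos_pihalf sin_pihalf mulr0 mulr1 add0r.
rewrite normrM [`|2^-1|]ger0_norm// ler_pdivrMr// !sE.
rewrite (le_trans (cos_dist_le _ _))// opprB addrA subrK -mulrBr normrM -mulrA ler_wpM2l//.
by rewrite (le_trans (l1_dist_coord v v' l))// ler_peMr ?l1_dist_ge0// ler1n.
Qed.

Lemma bounded_lipschitz_update g l x : bounded_lipschitz g ->
  bounded_lipschitz (fun v => g (coordinate_update v l x)).
Proof.
move=> /bounded_lipschitzP[B [L [B0 L0 gB gL]]]; split; first by exists B.
exists L => v v'; rewrite (le_trans (gL _ _))// ler_wpM2l//.
exact: l1_dist_update.
Qed.

Lemma bounded_lipschitz_bernstein (c : R) l m (F : nat -> V -> R) :
  (forall j, bounded_lipschitz (F j)) ->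
  bounded_lipschitz (fun v => bernstein (sine_scale c (v l)) m (F ^~ v)).
Proof.
elim: m F => [|m IH] F bF /=; first exact: bF.
apply: bounded_lipschitzD; apply: bounded_lipschitzM.
- apply: bounded_lipschitzB; first exact: bounded_lipschitz_cst.
  exact: bounded_lipschitz_sine_scale.
- exact: IH.
- exact: bounded_lipschitz_sine_scale.
- by apply: (IH (fun j => F j.+1)) => j.
Qed.

Lemma lipschitz_mean_dist M f g (e : R) : lipschitz_mean M -> bounded_lipschitz f ->
  bounded_lipschitz g -> bounded_lipschitz (fun v => `|f v - g v|) ->
  M (fun v => `|f v - g v|) <= e -> `|M f - M g| <= e.
Proof.
move=> [MD MZ Mle M1] bf bg bfg Me.
have -> : M f - M g = M (fun v => f v - g v).
  rewrite -mulN1r -MZ// -MD//; last exact: bounded_lipschitzZ.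
  by congr M; apply/funext => v; rewrite mulN1r.
rewrite (le_trans _ Me)// ler_norml; apply/andP; split.
  rewrite -mulN1r -MZ//; apply: Mle => //; first exact: bounded_lipschitzZ.
    exact: bounded_lipschitzB.
  by move=> v; rewrite mulN1r lerNl -normrN ler_norm.
by apply: Mle => //; [exact: bounded_lipschitzB|move=> v; exact: ler_norm].
Qed.

(** One coordinate is replaced by a Bernstein polynomial in its sine scale, at
    finitely many nodes: when the node [j / m] is close to the value of the
    scale at [v l], the points [x j] and [v l] are close, and the variance
    bound controls the other nodes. *)
Lemma bernstein_approximation l g (K e : R) : bounded_lipschitz g -> 0 < K -> 0 < e ->
  exists (c : R) (m : nat) (x : nat -> R), forall v, `|v l| <= K ->
    `|bernstein (sine_scale c (v l)) m (fun j => g (coordinate_update v l (x j))) - g v| <= e.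
Proof.
move=> /bounded_lipschitzP[B [L [B0 L0 gB gL]]] K0 e0.
pose c := (2 * K)^-1.
have c0 : 0 < c by rewrite invr_gt0 mulr_gt0.
have cK : c * K <= 1 / 2 by rewrite /c invfM -mulrA mulVf ?gt_eqF// mulr1 mul1r.
(* chosen so that scales within 2 eta come from points at which g differs by at
   most e / 2 *)
pose eta := c * e / (16 * (L + 1)).
have eta0 : 0 < eta by rewrite divr_gt0 ?mulr_gt0// ltr_wpDl.
have eta2 : 0 < eta ^+ 2 by rewrite exprn_gt0.
have eeta2 : 0 < e * eta ^+ 2 by rewrite mulr_gt0.
pose m := (Num.truncn (4 * B / (e * eta ^+ 2))).+1.
(* a node that is far from all the values of the scale on the interval gets the
   arbitrary point 0 *)
have near_node j : exists z : R, `|z| <= K /\ ((exists x, `|x| <= K /\ `|j%:R / m%:R - sine_scale c x| < eta) ->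
    `|j%:R / m%:R - sine_scale c z| < eta).
  have [[z [zK zeta]]|nex] := pselect (exists x, `|x| <= K /\ `|j%:R / m%:R - sine_scale c x| < eta).
    by exists z.
  by exists 0; split; [rewrite normr0 ltW|move=> /nex].
have [x xP] := choice near_node.
exists c, m, x => v vK; set y := sine_scale c (v l).
have y01 : 0 <= y <= 1 := sine_scale01 c (v l).
apply: bernstein_dist => //.
apply: (@le_trans _ _ (bernstein y m (fun j => e / 2 + (2 * B / eta ^+ 2) * (j%:R / m%:R - y) ^+ 2))).
  apply: bernstein_le => // j.
  have [h|h] := ltP `|j%:R / m%:R - y| eta.
    have [xK xeta] := xP j.
    have hx : `|j%:R / m%:R - sine_scale c (x j)| < eta by apply: xeta; exists (v l).
    apply: (@le_trans _ _ (e / 2)); last first.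
      by rewrite lerDl mulr_ge0 ?sqr_ge0// divr_ge0 ?sqr_ge0// mulr_ge0.
    rewrite (le_trans (gL _ _))// l1_dist_update_self.
    have : c * `|x j - v l| <= 8 * eta.
      rewrite (le_trans (sine_scale_dist_ge c0 cK xK vK))//.
      have : `|sine_scale c (x j) - y| <= eta + eta; last by move=> ?; lra.
      rewrite (le_trans (ler_distD (j%:R / m%:R) _ _))// distrC lerD// ltW//.
    rewrite -ler_pdivlMl// => /(ler_wpM2l L0)/le_trans; apply.
    rewrite /eta (_ : L * _ = (L / (L + 1)) * (e / 2)); last first.
      by field; rewrite !gt_eqF// ltr_wpDl.
    by rewrite ler_piMl ?divr_ge0 ?(ltW e0)// ler_pdivrMr ?ltr_wpDl// mul1r lerDl.
  apply: (@le_trans _ _ (2 * B)).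
    by rewrite (le_trans (ler_normB _ _))// mulr_natl mulr2n lerD.
  rewrite -[leLHS]add0r lerD ?divr_ge0 ?(ltW e0)// -mulrA ler_peMr ?mulr_ge0//.
  rewrite mulrC ler_pdivlMr ?exprn_gt0// mul1r -(real_normK (num_real (_ - y))).
  by rewrite lerXn2r// nnegrE ltW.
rewrite bernsteinD bernstein_cst bernsteinZ.
have m0 : (0 < m)%N by [].
have h := bernstein_sqr_dist y01 m0.
rewrite [leRHS](_ : _ = e / 2 + e / 2); last by field.
rewrite lerD2l (le_trans (ler_wpM2l _ h))//; first by rewrite divr_ge0 ?sqr_ge0// mulr_ge0.
rewrite ler_pdivrMr ?ltr0n//.
have : 4 * B / (e * eta ^+ 2) < m%:R by exact: Num.Theory.truncnS_gt.
rewrite ltr_pdivrMr// => /ltW h'.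
by rewrite ler_pdivrMr//; lra.
Qed.

(** Induction on the number of coordinates on which the test function depends.
    Multiplying by the oscillating factor [e_] makes the class of test
    functions for which convergence holds stable under products with
    trigonometric polynomials, hence under Bernstein's approximation of the
    dependence on one more coordinate. The tightness hypothesis is stated with
    Lipschitz tests, the only functions on which the means are constrained. *)
Theorem levy_continuity (M_ : nat -> (V -> R) -> R) (M : (V -> R) -> R) :
  (forall n, lipschitz_mean (M_ n)) -> lipschitz_mean M ->
  (forall e : R, 0 < e -> exists2 K : R, 0 < K & forall l f, bounded_lipschitz f ->
     (forall v, 0 <= f v <= 1) -> (forall v, `|v l| <= K -> f v = 0) ->
     (\forall n \near \oo, M_ n f <= e) /\ M f <= e) ->
  (forall (a : V) (b : R), M_ n (fun v => cos (b + \sum_(i < N) a i * v i)) @[n --> \oo] -->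
     M (fun v => cos (b + \sum_(i < N) a i * v i))) ->
  forall g, bounded_lipschitz g -> M_ n g @[n --> \oo] --> M g.
Proof.
move=> MM_ MM tight trig.
pose e_ (a : V) (b : R) v := cos (b + \sum_(i < N) a i * v i).
have be a b : bounded_lipschitz (e_ a b) := bounded_lipschitz_cos a b.
pose C g := forall (a : V) (b : R),
  M_ n (fun v => g v * e_ a b v) @[n --> \oo] --> M (fun v => g v * e_ a b v).
have CD f g : bounded_lipschitz f -> bounded_lipschitz g -> C f -> C g -> C (fun v => f v + g v).
  move=> bf bg Cf Cg a b.
  have E M' : lipschitz_mean M' -> M' (fun v => (f v + g v) * e_ a b v) =
      M' (fun v => f v * e_ a b v) + M' (fun v => g v * e_ a b v).
    move=> [MD _ _ _]; rewrite -MD; try exact: bounded_lipschitzM.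
    by congr M'; apply/funext => v; rewrite mulrDl.
  rewrite E// (_ : (fun n => _) = (fun n => M_ n (fun v => f v * e_ a b v) + M_ n (fun v => g v * e_ a b v))).
    by apply: cvgD.
  by apply/funext => n; rewrite E.
have CZ (k : R) f : bounded_lipschitz f -> C f -> C (fun v => k * f v).
  move=> bf Cf a b.
  have E M' : lipschitz_mean M' -> M' (fun v => (k * f v) * e_ a b v) = k * M' (fun v => f v * e_ a b v).
    move=> [_ MZ _ _]; rewrite -MZ; try exact: bounded_lipschitzM.
    by congr M'; apply/funext => v; rewrite mulrA.
  rewrite E// (_ : (fun n => _) = (fun n => k * M_ n (fun v => f v * e_ a b v))).
    by apply: cvgM => //; exact: cvg_cst.
  by apply/funext => n; rewrite E.
(* product with a sine: product-to-sum formulas *)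
have Csin (c : R) l f : bounded_lipschitz f -> C f -> C (fun v => sine_scale c (v l) * f v).
  move=> bf Cf a b.
  pose a1 i := a i + (if i == l then c else 0).
  pose a2 i := a i - (if i == l then c else 0).
  have sumE (s : R) v : \sum_(i < N) (a i + s * (if i == l then c else 0)) * v i =
      \sum_(i < N) a i * v i + s * (c * v l).
    under eq_bigr do rewrite mulrDl.
    rewrite big_split/=; congr +%R; rewrite (bigD1 l)//= eqxx big1 ?addr0 ?mulrA// => i /negbTE ->.
    by rewrite mulr0 mul0r.
  have pE v : sine_scale c (v l) * f v * e_ a b v =
      2^-1 * (f v * e_ a b v) + (4^-1 * (f v * e_ a1 (b - pi / 2) v) + - 4^-1 * (f v * e_ a2 (b - pi / 2) v)).
    have sE x : cos (x - pi / 2) = sin x :> R.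
      by rewrite cosB cos_pihalf sin_pihalf mulr0 mulr1 add0r.
    have -> : e_ a1 (b - pi / 2) v = sin (b + \sum_(i < N) a i * v i + c * v l).
      rewrite /e_ addrAC sE; congr sin; rewrite -[in RHS]addrA; congr +%R.
      have := sumE 1 v; rewrite mul1r => <-.
      by apply: eq_bigr => i _; rewrite mul1r.
    have -> : e_ a2 (b - pi / 2) v = sin (b + \sum_(i < N) a i * v i - c * v l).
      rewrite /e_ addrAC sE; congr sin; rewrite -[in RHS]addrA; congr +%R.
      have := sumE (-1) v; rewrite mulN1r => <-.
      by apply: eq_bigr => i _; rewrite mulN1r.
    by rewrite sinB sinD /e_ /sine_scale; field.
  have E M' : lipschitz_mean M' -> M' (fun v => sine_scale c (v l) * f v * e_ a b v) =
      2^-1 * M' (fun v => f v * e_ a b v) + (4^-1 * M' (fun v => f v * e_ a1 (b - pi / 2) v) +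
       - 4^-1 * M' (fun v => f v * e_ a2 (b - pi / 2) v)).
    move=> [MD MZ _ _]; under [X in M' X]eq_fun do rewrite pE.
    by rewrite !MD ?MZ//; do ?[exact: bounded_lipschitzM|apply: bounded_lipschitzZ|apply: bounded_lipschitzD].
  rewrite E// (_ : (fun n => _) = (fun n => 2^-1 * M_ n (fun v => f v * e_ a b v) +
      (4^-1 * M_ n (fun v => f v * e_ a1 (b - pi / 2) v) +
       - 4^-1 * M_ n (fun v => f v * e_ a2 (b - pi / 2) v)))); last by apply/funext => n; rewrite E.
  by apply: cvgD; [|apply: cvgD]; apply: cvgM => //; exact: cvg_cst.
have Cbern (c : R) l m (F : nat -> V -> R) : (forall j, bounded_lipschitz (F j)) -> (forall j, C (F j)) ->
    C (fun v => bernstein (sine_scale c (v l)) m (F ^~ v)).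
  elim: m F => [|m IH] F bF CF /=; first exact: CF.
  have b1 := bounded_lipschitz_bernstein c l m bF.
  have b2 := bounded_lipschitz_bernstein c l m (fun j => bF j.+1).
  have C1 := IH F bF CF.
  have C2 := IH (fun j => F j.+1) (fun j => bF j.+1) (fun j => CF j.+1).
  rewrite (_ : (fun v => _) = (fun v => bernstein (sine_scale c (v l)) m (F ^~ v) +
     (-1 * (sine_scale c (v l) * bernstein (sine_scale c (v l)) m (F ^~ v)) +
      sine_scale c (v l) * bernstein (sine_scale c (v l)) m (fun j => F j.+1 v)))); last first.
    by apply/funext => v; rewrite /comp; ring.
  have bs := bounded_lipschitz_sine_scale c l.
  have bs1 := bounded_lipschitzM bs b1.
  have bs2 := bounded_lipschitzM bs b2.
  apply: (CD) => //; first by apply: bounded_lipschitzD => //; exact: bounded_lipschitzZ.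
  apply: (CD) => //; first exact: bounded_lipschitzZ.
    by apply: CZ => //; exact: Csin.
  exact: Csin.
have Cdep k : (k <= N)%N -> forall g, bounded_lipschitz g ->
    (forall v v', (forall i : 'I_N, (i < k)%N -> v i = v' i) -> g v = g v') -> C g.
  elim: k => [|k IH] kN g bg gdep.
    have gc v : g v = g (fun=> 0) * 1 by rewrite mulr1; apply: gdep.
    rewrite (_ : g = fun v => g (fun=> 0) * 1); last exact/funext.
    apply: (CZ _ (fun=> 1)); first exact: bounded_lipschitz_cst.
    move=> a b; rewrite (_ : (fun v => 1 * e_ a b v) = e_ a b); first exact: trig.
    by apply/funext => v; rewrite mul1r.
  pose l := Ordinal kN.
  move=> a b; apply/cvgrPdist_le => /= e e0.
  have /bounded_lipschitzP[B [L [B0 L0 gB gL]]] := bg.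
  pose e1 := e / 5; have e10 : 0 < e1 by rewrite divr_gt0.
  have e20 : 0 < e1 / (2 * B + 1) by rewrite divr_gt0// ltr_wpDl// mulr_ge0.
  have [K K0 KP] := tight _ e20.
  have [c [m [x FP]]] := bernstein_approximation l bg K0 e10.
  pose F v := bernstein (sine_scale c (v l)) m (fun j => g (coordinate_update v l (x j))).
  have bF : bounded_lipschitz F.
    by apply: bounded_lipschitz_bernstein => j; exact: bounded_lipschitz_update.
  have FB v : `|F v| <= B.
    rewrite -[F v]subr0; apply: bernstein_dist; first exact: sine_scale01.
    rewrite -[leRHS](bernstein_cst (sine_scale c (v l)) m).
    by apply: bernstein_le => [|j]; [exact: sine_scale01|rewrite subr0 gB].
  have CF : C F.
    apply: (Cbern c l m (fun j v => g (coordinate_update v l (x j)))) => j.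
      exact: bounded_lipschitz_update.
    apply: IH; [exact: ltnW|exact: bounded_lipschitz_update|].
    move=> v v' vv'; apply: gdep => i; rewrite ltnS leq_eqVlt => /predU1P[ik|ik].
      by rewrite /coordinate_update (_ : i == l)//; apply/eqP/val_inj.
    by rewrite /coordinate_update; case: ifP => // _; exact: vv'.
  have bge : bounded_lipschitz (fun v => g v * e_ a b v) by exact: bounded_lipschitzM.
  have bFe : bounded_lipschitz (fun v => F v * e_ a b v) by exact: bounded_lipschitzM.
  (* the error, above its bound on the cube *)
  pose h v := Num.max 0 (`|g v - F v| - e1) / (2 * B + 1).
  have bnorm f : bounded_lipschitz f -> bounded_lipschitz (fun v => `|f v|).
    by apply: bounded_lipschitz_comp => z z'; exact: ler_dist_dist.
  have bh : bounded_lipschitz h.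
    rewrite /h; under eq_fun do rewrite mulrC.
    apply: bounded_lipschitzZ; apply: (bounded_lipschitz_comp (h := Num.max 0)).
      exact: max0_dist_le.
    apply: bounded_lipschitzB; last exact: bounded_lipschitz_cst.
    by apply: bnorm; exact: bounded_lipschitzB.
  have h01 v : 0 <= h v <= 1.
    rewrite /h divr_ge0 ?le_max ?lexx// ?addr_ge0 ?mulr_ge0//=.
    rewrite ler_pdivrMr ?mul1r ?ltr_wpDl ?mulr_ge0// ge_max addr_ge0 ?mulr_ge0//=.
    have : `|g v - F v| <= 2 * B by rewrite (le_trans (ler_normB _ _))// mulr_natl mulr2n lerD.
    by move=> ?; lra.
  have hK v : `|v l| <= K -> h v = 0.
    move=> vK; rewrite /h (_ : Num.max _ _ = 0) ?mul0r//; apply: max_l.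
    by rewrite subr_le0 distrC; exact: FP.
  have [h_n h_] := KP l h bh h01 hK.
  have step M' : lipschitz_mean M' -> M' h <= e1 / (2 * B + 1) ->
      `|M' (fun v => g v * e_ a b v) - M' (fun v => F v * e_ a b v)| <= e1 + e1.
    move=> MM' M'h; apply: lipschitz_mean_dist => //.
      by apply: bnorm; exact: bounded_lipschitzB.
    have [MD MZ Mle M1] := MM'.
    apply: (@le_trans _ _ (M' (fun v => e1 * 1 + (2 * B + 1) * h v))).
      apply: Mle; first by apply: bnorm; exact: bounded_lipschitzB.
        apply: bounded_lipschitzD; first exact: bounded_lipschitz_cst.
        exact: bounded_lipschitzZ.
      move=> v; rewrite -mulrBl normrM mulr1 /h (mulrC _ (_ / _)) divfK; last first.
        by rewrite gt_eqF// ltr_wpDl// mulr_ge0.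
      apply: (@le_trans _ _ `|g v - F v|); first by rewrite ler_piMr// cos_max.
      by rewrite -lerBlDl le_max lexx orbT.
    rewrite MD ?MZ ?M1 ?mulr1 ?lerD//; first last.
    - exact: bounded_lipschitzZ.
    - exact: bounded_lipschitz_cst.
    - exact: bounded_lipschitz_cst.
    by rewrite mulrC -ler_pdivlMr// ltr_wpDl// mulr_ge0.
  have /cvgrPdist_le /(_ _ e10) Fcvg := CF a b.
  near=> n.
  have s1 := step _ MM h_.
  have s2 : `|M_ n (fun v => g v * e_ a b v) - M_ n (fun v => F v * e_ a b v)| <= e1 + e1.
    by apply: step => //; near: n.
  have s3 : `|M (fun v => F v * e_ a b v) - M_ n (fun v => F v * e_ a b v)| <= e1 by near: n.
  set A := M _ in s1 s3 *; set A' := M _ in s1 s3.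
  set D := M_ n _ in s2 s3 *; set D' := M_ n _ in s2 s3.
  rewrite (_ : A - D = (A - A') + (A' - D') - (D - D')); last by ring.
  rewrite (le_trans (ler_normB _ _))//.
  have := ler_normD (A - A') (A' - D'); rewrite /e1 in s1 s2 s3; lra.
move=> g bg.
have gdep (v v' : V) : (forall i : 'I_N, (i < N)%N -> v i = v' i) -> g v = g v'.
  by move=> vv'; congr g; apply/funext => i; exact: vv'.
have := Cdep N (leqnn N) g bg gdep (fun=> 0) 0.
have -> : (fun v => g v * e_ (fun=> 0) 0 v) = g; last by [].
apply/funext => v; rewrite /e_ big1 ?addr0 ?cos0 ?mulr1// => i _.
by rewrite mul0r.
Unshelve. all: by end_near. Qed.

End convergence_of_means.

(** * Radon measures on complete normed spaces *)

Section countable_unions.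
Context {R : realType} {d : measure_display} {T : measurableType d}.
Variable P : probability T R.
Implicit Types (A B : set T) (F : nat -> set T).

Lemma pr_bigcup_cvg F : (forall n, measurable (F n)) ->
  (forall n, F n `<=` F n.+1) -> pr P (F n) @[n --> \oo] --> pr P (\bigcup_n F n).
Proof.
move=> mF F_nd; have mU : measurable (\bigcup_n F n) by exact: bigcupT_measurable.
have : (P \o F) n @[n --> \oo] --> P (\bigcup_n F n).
  apply: nondecreasing_cvg_mu => // n m nm; apply/subsetPset.
  elim: m nm => [|m IH]; first by rewrite leqn0 => /eqP->.
  by rewrite leq_eqVlt => /predU1P[->//|]; rewrite ltnS => /IH /subset_trans; apply.
by move=> h; apply: fine_cvg; rewrite -prE.
Qed.

Lemma pr_bigcup_le F (e : R) : (forall n, measurable (F n)) ->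
  (forall n, \sum_(i < n) pr P (F i) <= e) -> pr P (\bigcup_n F n) <= e.
Proof.
move=> mF Fe; pose G n := \big[setU/set0]_(i < n) F i.
have mG n : measurable (G n) by apply: measurable_bigsetU_seq.
have -> : \bigcup_n F n = \bigcup_n G n.
  apply/seteqP; split => [x [n _ Fx]|x [n _]].
    by exists n.+1 => //; rewrite /G big_ord_recr/=; right.
  by rewrite /G -bigcup_mkord => -[i _ Fx]; exists i.
have cG : pr P (G n) @[n --> \oo] --> pr P (\bigcup_n G n).
  by apply: pr_bigcup_cvg => // n; rewrite /G big_ord_recr/= => x; left.
apply: (closed_cvg (fun x => x <= e) _ _ _ cG); first exact: closed_le.
by apply: nearW => n; rewrite (le_trans (pr_bigU_le P _ _))//.
Qed.

Lemma pr_setD_le A B : measurable A -> measurable B -> pr P A <= pr P B + pr P (A `\` B).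
Proof.
move=> mA mB; have mD : measurable (A `\` B) by exact: measurableD.
apply: le_trans (prU_le P mB mD); apply: pr_le => //; first exact: measurableU.
by move=> x Ax; have [Bx|nBx] := pselect (B x); [left|right].
Qed.

Lemma pr_setDE A B : measurable A -> measurable B -> B `<=` A ->
  pr P (A `\` B) = pr P A - pr P B.
Proof.
move=> mA mB BA; rewrite /pr measureD//; last first.
  by rewrite -ge0_fin_numE// fin_num_measure.
by rewrite setIidr// fineB// fin_num_measure.
Qed.

(** The geometric weights by which a given mass is distributed over countably
    many errors. *)
Lemma sum_half_powers_le (e : R) n : 0 <= e -> \sum_(i < n) e / 2 ^+ i.+1 <= e.
Proof.
move=> e0; suff -> : \sum_(i < n) e / 2 ^+ i.+1 = e - e / 2 ^+ n.
  by rewrite gerBl divr_ge0// exprn_ge0.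
elim: n => [|n IH]; first by rewrite big_ord0 expr0 divr1 subrr.
rewrite big_ord_recr/= IH exprS; field.
by rewrite expf_neq0//.
Qed.

End countable_unions.

Section radon_measures.
Context {R : realType} {V : normedModType R}.
Hypothesis V_complete : forall F : set_system V, ProperFilter F -> cauchy F -> cvg F.
Variable mu : probability (borelType V) R.
Implicit Types (A B C : set (borelType V)).

Lemma borel_open A : open (A : set V) -> measurable A.
Proof. by move=> oA; exact: sub_sigma_algebra. Qed.

Lemma borel_closed A : closed (A : set V) -> measurable A.
Proof.
move=> cA; rewrite -[A]setCK; apply: measurableC; apply: borel_open.
by rewrite openC.
Qed.

Lemma closed_dist_ge (c : V) (r : R) : closed [set z : V | r <= `|z - c|].
Proof.
apply: (@preimage_closed _ _ (fun z : V => `|z - c|) [set x | r <= x]); last exact: closed_ge.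
move=> z _; apply: cvg_norm; apply: cvgB; [exact: cvg_id|exact: cvg_cst].
Qed.

Lemma closed_dist_le (c : V) (r : R) : closed [set z : V | `|z - c| <= r].
Proof.
apply: (@preimage_closed _ _ (fun z : V => `|z - c|) [set x | x <= r]); last exact: closed_le.
move=> z _; apply: cvg_norm; apply: cvgB; [exact: cvg_id|exact: cvg_cst].
Qed.

(** Inner regularity by closed sets. The sets that have it together with their
    complement form a sigma-algebra, which contains the open sets. *)
Definition closed_approximable A := measurable A /\
  forall e : R, 0 < e -> exists C : set (borelType V),
    [/\ closed (C : set V), C `<=` A & pr mu (A `\` C) <= e].

Lemma closed_approximable_closed C : closed (C : set V) -> closed_approximable C.
Proof.
move=> cC; split; first exact: borel_closed.
by move=> e e0; exists C; split => //; rewrite setDv /pr measure0 ltW.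
Qed.

(** A finite union, which is closed, already exhausts most of the mass. *)
Lemma closed_approximable_bigcup (A : nat -> set (borelType V)) :
  (forall n, closed_approximable (A n)) -> closed_approximable (\bigcup_n A n).
Proof.
move=> apA; have mA n : measurable (A n) := (apA n).1.
have mU : measurable (\bigcup_n A n) by exact: bigcupT_measurable.
split=> // e e0; have e20 : 0 < e / 2 by rewrite divr_gt0.
have ei i : 0 < e / 2 / 2 ^+ i.+1 by rewrite divr_gt0// exprn_gt0.
have [C CP] := choice (fun i => (apA i).2 _ (ei i)).
have cC i : closed (C i : set V) by have [] := CP i.
have mC i : measurable (C i) by exact: borel_closed.
pose G n := \big[setU/set0]_(i < n) A i.
have mG n : measurable (G n) by apply: measurable_bigsetU_seq.
have UG : \bigcup_n A n = \bigcup_n G n.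
  apply/seteqP; split => [x [n _ Fx]|x [n _]].
    by exists n.+1 => //; rewrite /G big_ord_recr/=; right.
  by rewrite /G -bigcup_mkord => -[i _ Fx]; exists i.
have cG : pr mu (G n) @[n --> \oo] --> pr mu (\bigcup_n A n).
  by rewrite UG; apply: pr_bigcup_cvg => // n; rewrite /G big_ord_recr/= => x; left.
have /cvgrPdist_le /(_ _ e20) [n _ /(_ n (leqnn n))/= hn] := cG.
exists (\big[setU/set0]_(i < n) C i); split.
- rewrite -bigcup_mkord; apply: closed_bigcup => // i _; exact: cC.
- rewrite -bigcup_mkord => x [i _ Cx]; exists i => //.
  by have [_ + _] := CP i; apply.
have mCn : measurable (\big[setU/set0]_(i < n) C i) by apply: measurable_bigsetU_seq.
have GU : G n `<=` \bigcup_n A n by rewrite UG => x Gx; exists n.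
have m1 : measurable (\bigcup_n A n `\` G n) by exact: measurableD.
have m2 : measurable (\big[setU/set0]_(i < n) (A i `\` C i)).
  by apply: measurable_bigsetU_seq => i _; exact: measurableD.
apply: (@le_trans _ _ (pr mu ((\bigcup_n A n `\` G n) `|` \big[setU/set0]_(i < n) (A i `\` C i)))).
  apply: pr_le; [exact: measurableD|exact: measurableU|].
  move=> x [Ax nCx]; have [Gx|nGx] := pselect (G n x); last by left.
  right; move: Gx; rewrite /G -bigcup_mkord => -[i iN Aix].
  rewrite -(bigcup_mkord n (fun k => A k `\` C k)).
  exists i => //; split => // Cix.
  by apply: nCx; rewrite -bigcup_mkord; exists i.
rewrite (le_trans (prU_le _ m1 m2))// [leRHS](splitr e) lerD//.
  rewrite pr_setDE//; apply: le_trans hn; exact: ler_norm.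
apply: (le_trans (pr_bigU_le _ _ _)) => [i _|]; first exact: measurableD.
apply: le_trans (sum_half_powers_le n (ltW e20)); apply: ler_sum => i _.
by have [] := CP i.
Qed.

Lemma closed_approximable_bigcap (A : nat -> set (borelType V)) :
  (forall n, closed_approximable (A n)) -> closed_approximable (\bigcap_n A n).
Proof.
move=> apA; have mA n : measurable (A n) := (apA n).1.
have mI : measurable (\bigcap_n A n) by exact: bigcapT_measurable.
split=> // e e0.
have ei i : 0 < e / 2 ^+ i.+1 by rewrite divr_gt0// exprn_gt0.
have [C CP] := choice (fun i => (apA i).2 _ (ei i)).
have cC i : closed (C i : set V) by have [] := CP i.
have mC i : measurable (C i) by exact: borel_closed.
exists (\bigcap_n C n); split.
- exact: closed_bigI.
- by move=> x Cx n _; have [_ + _] := CP n; apply; exact: Cx.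
apply: (@le_trans _ _ (pr mu (\bigcup_n (A n `\` C n)))).
  apply: pr_le.
  - by apply: measurableD => //; exact: bigcapT_measurable.
  - by apply: bigcupT_measurable => n; exact: measurableD.
  - move=> x [Ax nCx]; apply: contrapT => h; apply: nCx => n _; apply: contrapT => nCx.
    by apply: h; exists n => //; split => //; exact: Ax.
apply: pr_bigcup_le => n; first exact: measurableD.
apply: le_trans (sum_half_powers_le n (ltW e0)); apply: ler_sum => i _.
by have [] := CP i.
Qed.

(** An open set is the union of the closed sets of its points at distance at
    least [1 / (n + 1)] from the complement. *)
Lemma open_closed_approximable A : open (A : set V) -> closed_approximable A.
Proof.
move=> oA.
pose C n : set (borelType V) := \bigcap_(y in ~` A) [set z : V | n.+1%:R^-1 <= `|z - y|].
have -> : A = \bigcup_n C n.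
  apply/seteqP; split => [x Ax|x [n _ Cx]]; last first.
    apply: contrapT => nAx; have := Cx x nAx.
    by rewrite /= subrr normr0 leNgt invr_gt0 ltr0n.
  have : nbhs (x : V) (A : set V) by exact: open_nbhs_nbhs.
  move=> /nbhs_ballP[e /= e0 eA].
  exists (Num.truncn e^-1) => // y nAy /=; rewrite leNgt; apply/negP => h.
  apply: nAy; apply: eA; rewrite -ball_normE/=; apply: (lt_trans h).
  rewrite -[ltRHS]invrK ltf_pV2 ?posrE ?invr_gt0//.
  exact: Num.Theory.truncnS_gt.
apply: closed_approximable_bigcup => n; apply: closed_approximable_closed.
by apply: closed_bigI => y _; exact: closed_dist_ge.
Qed.

Lemma measurable_closed_approximable A : measurable A -> closed_approximable A.
Proof.
move=> mA; suff : closed_approximable A /\ closed_approximable (~` A) by case.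
move: A mA; apply: smallest_sub => [|A oA]; last first.
  split; first exact: open_closed_approximable.
  by apply: closed_approximable_closed; rewrite closedC.
split.
- rewrite setC0; split; apply: closed_approximable_closed; [exact: closed0|exact: closedT].
- by move=> A [apA apCA]; rewrite setTD setCK.
- move=> A apA; split; first by apply: closed_approximable_bigcup => n; have [] := apA n.
  by rewrite setC_bigcup; apply: closed_approximable_bigcap => n; have [] := apA n.
Qed.

(** An ultrafilter on [K] contains one of the finitely many balls of each
    radius, hence is Cauchy. *)
Lemma totally_bounded_compact (K : set V) : closed K ->
  (forall e : R, 0 < e -> exists (n : nat) (c : 'I_n -> V),
     K `<=` [set z | exists i, `|z - c i| < e]) -> compact K.
Proof.
move=> cK Kb; rewrite compact_ultra => F UF FK.
have PF : ProperFilter F by exact: ultra_proper.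
have Fcauchy : cauchy F.
  apply: cauchy_exP => e /= e0.
  have [n [c Kc]] := Kb e e0.
  have : F [set z | exists i, `|z - c i| < e] by apply: filterS FK.
  move=> Fc; apply: contrapT => nF.
  have Fi (i : 'I_n) : F (~` ball (c i) e).
    by have [Fb|//] := in_ultra_setVsetC (ball (c i) e) UF; exfalso; apply: nF; exists (c i).
  have Fall : \forall z \near F, forall i, (~` ball (c i) e) z by exact: filter_forall.
  have [z [[i zi] /(_ i)]] := @filter_ex _ F PF _ (filterI Fc Fall); apply.
  by rewrite -ball_normE/= distrC.
have Fl := V_complete PF Fcauchy.
exists (lim F); split => //.
by apply: (closed_cvg K cK FK) => //; exact: Fl.
Qed.

(** Ulam's theorem: finitely many of the balls of radius [1 / (m + 1)] around
    the [d j] carry all the mass but [e / 2^(m+1)], and the intersection over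
    [m] of these finite unions is totally bounded. *)
Lemma tight (d : nat -> V) : (forall e : R, 0 < e -> pr mu (\bigcup_j [set z : V | `|z - d j| < e]) = 1) ->
  forall e : R, 0 < e -> exists K : set V, compact K /\ pr mu (~` (K : set (borelType V))) <= e.
Proof.
move=> dense e e0.
pose B m j : set (borelType V) := [set z : V | `|z - d j| <= m.+1%:R^-1].
have cB m j : closed (B m j : set V) by exact: closed_dist_le.
pose G m n := \big[setU/set0]_(j < n) B m j.
have cG m n : closed (G m n : set V).
  by rewrite /G -bigcup_mkord; apply: closed_bigcup.
have mG m n : measurable (G m n) by exact: borel_closed.
have HJ m : exists n, pr mu (~` G m n) <= e / 2 ^+ m.+1.
  have cvgG : pr mu (G m n) @[n --> \oo] --> (1 : R).
    have mU : measurable (\bigcup_n G m n) by exact: bigcupT_measurable.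
    have -> : 1 = pr mu (\bigcup_n G m n).
      apply/esym/eqP; rewrite eq_le pr_le1//=.
      have m0 : 0 < m.+1%:R^-1 :> R by rewrite invr_gt0.
      rewrite -(dense _ m0); apply: pr_le.
      - apply: bigcupT_measurable => j; rewrite -[X in measurable X]setCK; apply: measurableC.
        apply: borel_closed; rewrite [X in closed X](_ : _ = [set z : V | m.+1%:R^-1 <= `|z - d j|]).
          exact: closed_dist_ge.
        by apply/seteqP; split => z /=; rewrite leNgt => /negP.
      - exact: mU.
      - by move=> z [j _ /= zj]; exists j.+1 => //; rewrite /G big_ord_recr/=; right; exact: ltW.
    by apply: pr_bigcup_cvg => // n; rewrite /G big_ord_recr/= => x; left.
  have em : 0 < e / 2 ^+ m.+1 by rewrite divr_gt0// exprn_gt0.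
  have /cvgrPdist_le /(_ _ em) [n _ /(_ n (leqnn n))/= hn] := cvgG.
  by exists n; rewrite pr_setC//; apply: le_trans hn; exact: ler_norm.
have [J JP] := choice HJ.
pose K := \bigcap_m G m (J m).
exists K; split; last first.
  rewrite setC_bigcap; apply: pr_bigcup_le => n; first exact: measurableC.
  apply: le_trans (sum_half_powers_le n (ltW e0)); apply: ler_sum => i _; exact: JP.
apply: totally_bounded_compact; first by apply: closed_bigI.
move=> r r0; pose m := Num.truncn r^-1.
exists (J m), (fun j : 'I_(J m) => d j) => z /(_ m I).
rewrite /G -bigcup_mkord => -[j /= jJ zj]; exists (Ordinal jJ) => /=.
apply: (le_lt_trans zj); rewrite -[ltRHS]invrK ltf_pV2 ?posrE ?invr_gt0//.
exact: Num.Theory.truncnS_gt.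
Qed.

(** Inside a measurable set there is a closed set of almost the same mass, and
    its intersection with a compact set of almost full mass is compact. *)
Lemma radon_of_separable_support (d : nat -> V) :
  (forall e : R, 0 < e -> pr mu (\bigcup_j [set z : V | `|z - d j| < e]) = 1) -> radon mu.
Proof.
move=> dense A mA; apply/eqP; rewrite eq_le; apply/andP; split; last first.
  apply: ge_ereal_sup => _ [K [cK KA] <-]; apply: le_measure; rewrite ?inE//.
  by apply: borel_closed; apply: compact_closed => //; exact: norm_hausdorff.
rewrite [X in (X <= _)%E](_ : _ = (pr mu A)%:E); last exact: prE.
apply/lee_addgt0Pr => e e0.
have e20 : 0 < e / 2 by rewrite divr_gt0.
have [_ /(_ _ e20) [C [cC CA hC]]] := measurable_closed_approximable mA.
have [K [cK hK]] := tight dense e20.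
have clK : closed K by apply: compact_closed => //; exact: norm_hausdorff.
have mK : measurable (K : set (borelType V)) by exact: borel_closed.
have mC : measurable C by exact: borel_closed.
pose K' : set V := K `&` C.
have cK' : compact K' by apply: (subclosed_compact _ cK); [exact: closedI|exact: subIsetl].
have mK' : measurable (K' : set (borelType V)) by exact: measurableI.
apply: (@le_trans _ _ (mu K' + e%:E)%E); last first.
  rewrite leeD2r//; apply: ereal_sup_ubound; exists K' => //; split => //.
  by move=> z [_ /CA].
rewrite (prE mu mK') -EFinD lee_fin.
have mU : measurable ((A `\` C) `|` ~` (K : set (borelType V))).
  by apply: measurableU; [exact: measurableD|exact: measurableC].
rewrite (le_trans (pr_setD_le mu mA mK'))// lerD2l.
apply: (@le_trans _ _ (pr mu ((A `\` C) `|` ~` (K : set (borelType V))))).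
  apply: pr_le => //; first exact: measurableD.
  move=> x [Ax nKx]; have [Cx|nCx] := pselect (C x); last by left.
  by right => Kx; apply: nKx.
rewrite (le_trans (prU_le mu _ _))//; [exact: measurableD|exact: measurableC|].
by rewrite [leRHS](splitr e) lerD.
Qed.

Lemma continuous_borel_measurable (G : V -> R) : continuous G ->
  measurable_fun setT (G : borelType V -> R).
Proof.
move=> cG; apply: (measurability _ (RGenOpens.measurableE R)) => _ [_ [a [b ->] <-]].
rewrite setTI; apply: borel_open.
by apply: (open_comp (f := G)) => //; exact: interval_open.
Qed.

(** As [c] approximates all the values of [W], a value lies in an open set
    exactly when it lies in one of the balls of radius [1 / (m + 1)] around the
    [c j] which the open set contains; there are countably many of them.
    Without separability the Borel sets of a normed space are out of reach of
    distances to points. *)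
Lemma measurable_to_borel (d : measure_display) (T : measurableType d) (W : T -> V)
    (c : nat -> V) :
  (forall w (e : R), 0 < e -> exists j, `|W w - c j| < e) ->
  (forall j, measurable_fun setT (fun w => `|W w - c j|)) ->
  measurable_fun setT (W : T -> borelType V).
Proof.
move=> dense mW; apply: (@measurability _ _ _ _ setT (W : T -> borelType V) (@open V)) => // _ [U oU <-]; rewrite setTI.
pose Q j m : set V := [set z | `|z - c j| < m.+1%:R^-1].
have -> : W @^-1` U = \bigcup_j \bigcup_(m in [set m | Q j m `<=` U]) (W @^-1` Q j m).
  apply/seteqP; split => [w /= Uw|w [j _ [m /= QU]]]; last by move/QU.
  have : nbhs (W w) U by exact: open_nbhs_nbhs.
  move=> /nbhs_ballP[e /= e0 eU].
  pose m := Num.truncn (2 / e).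
  have me : 2 * m.+1%:R^-1 < e.
    rewrite ltr_pdivrMr ?ltr0n// mulrC -ltr_pdivrMr//.
    exact: Num.Theory.truncnS_gt.
  have m0 : 0 < m.+1%:R^-1 :> R by rewrite invr_gt0.
  have [j Wj] := dense w _ m0.
  exists j => //; exists m => //= z zj; apply: eU; rewrite -ball_normE/=.
  apply: le_lt_trans (ler_distD (c j) _ _) _; rewrite (distrC (c j)).
  by apply: lt_trans me; rewrite mulr_natl mulr2n ltrD.
apply: bigcupT_measurable => j; apply: bigcup_measurable => m _.
rewrite [X in measurable X](_ : _ = (fun w => `|W w - c j|) @^-1` `]-oo, m.+1%:R^-1[).
  by rewrite -[X in measurable X]setTI; exact: mW.
by apply/seteqP; split => w /=; rewrite in_itv.
Qed.

End radon_measures.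

(** * Completeness of the space of bounded functions *)

Section linf_complete.
Context {I : Type} {R : realType}.

Lemma linf_dist_coord (f g : linf I R) i : `|\val f i - \val g i| <= `|f - g|.
Proof. exact: (linf_norm_ub (f - g) i). Qed.

Lemma linf_dist_le (f g : linf I R) (M : R) : 0 <= M ->
  (forall i, `|\val f i - \val g i| <= M) -> `|f - g| <= M.
Proof. by move=> M0 fg; apply: linf_norm_le. Qed.

(** The pointwise limit is also the uniform limit, since closed balls are
    closed under pointwise convergence. *)
Lemma linf_complete (F : set_system (linf I R)) : ProperFilter F -> cauchy F -> cvg F.
Proof.
move=> PF /cauchyP Fc.
have Fi i : exists l : R, \val f i @[f --> F] --> l.
  have : cauchy (\val f i @[f --> F]).
    apply: cauchy_exP => e e0; have [f Ff] := Fc e e0.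
    exists (\val f i); suff : F [set g | ball (\val f i) e (\val g i)] by [].
    apply: filterS Ff => g; rewrite -!ball_normE/=.
    by apply: le_lt_trans; exact: linf_dist_coord.
  by move=> /cauchy_cvg; exists (lim (\val f i @[f --> F])).
have [l lP] := choice Fi.
have near_l (e : R) : 0 < e -> exists f, F (ball f e) /\ forall i, `|\val f i - l i| <= e.
  move=> e0; have [f Ff] := Fc e e0; exists f; split => // i.
  apply: (closed_cvg (fun x => `|\val f i - x| <= e) _ _ _ (lP i)).
    apply: (@preimage_closed _ _ (fun x : R => `|\val f i - x|) [set x | x <= e]); last exact: closed_le.
    by move=> z _; apply: cvg_norm; apply: cvgB; [exact: cvg_cst|exact: cvg_id].
  apply: filterS Ff => g; rewrite -ball_normE/= => /ltW; apply: le_trans.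
  exact: linf_dist_coord.
have lb : l \in bounded_functions.
  have [f [_ fl]] := near_l 1 ltr01; apply/bounded_functionsP.
  exists (`|f| + 1) => i; rewrite -[l i](subrK (\val f i)) addrC.
  rewrite (le_trans (ler_normD _ _))// lerD//; last by rewrite distrC.
  exact: linf_norm_ub.
pose g : linf I R := SigSub lb.
apply/cvg_ex; exists g; apply/cvgrPdist_lt => e e0.
have e20 : 0 < e / 2 by rewrite divr_gt0.
have [f [Ff fl]] := near_l _ e20.
apply: filterS Ff => h; rewrite -ball_normE/= => fh.
rewrite (splitr e); apply: le_lt_trans (ler_distD f _ _) _.
apply: ler_ltD => //; rewrite distrC; apply: linf_dist_le; first exact: ltW.
exact: fl.
Qed.

End linf_complete.

(** * Lipschitz tests of random vectors *)

Section measurability_of_tests.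
Context {R : realType} {d : measure_display} {T : measurableType d}.

Lemma measurable_fun_lt (f : T -> R) : (forall a, measurable [set w | f w < a]) ->
  measurable_fun setT f.
Proof.
move=> fa; apply: (measurability _ (RGenInftyO.measurableE R)) => _ [_ [a ->] <-].
by rewrite setTI; rewrite [X in measurable X](_ : _ = [set w | f w < a]).
Qed.

Lemma measurable_lt_cst (f : T -> R) (a : R) : measurable_fun setT f ->
  measurable [set w | f w < a].
Proof.
move=> mf; rewrite [X in measurable X](_ : _ = f @^-1` `]-oo, a[).
  by rewrite -[X in measurable X]setTI; exact: mf.
by apply/seteqP; split => w /=; rewrite in_itv.
Qed.

Lemma measurable_gt_norm (f : T -> R) (a : R) : measurable_fun setT f ->
  measurable [set w | a < `|f w|].
Proof.
move=> mf; rewrite [X in measurable X](_ : _ = (fun w => `|f w|) @^-1` `]a, +oo[).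
  by rewrite -[X in measurable X]setTI; apply: measurableT_comp.
by apply/seteqP; split => w /=; rewrite in_itv/= andbT.
Qed.

Lemma l1_dist_rat {N : nat} (v : 'I_N -> R) (e : R) : 0 < e ->
  exists q : {ffun 'I_N -> rat}, l1_dist v (fun l => ratr (q l)) < e.
Proof.
move=> e0; have e' : 0 < e / N.+1%:R by rewrite divr_gt0.
have hq l : exists q : rat, `|v l - ratr q| <= e / N.+1%:R.
  have : v l - e / N.+1%:R < v l by rewrite gtrBl.
  move=> /rat_in_itvoo[q]; rewrite in_itv/= => /andP[q1 q2]; exists q.
  rewrite ger0_norm; last by rewrite subr_ge0 ltW.
  by rewrite lerBlDl -lerBlDr ltW.
have [q qP] := choice hq; exists [ffun l => q l].
apply: (@le_lt_trans _ _ (\sum_(l < N) e / N.+1%:R)).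
  by apply: ler_sum => l _; rewrite ffunE.
by rewrite sumr_const card_ord -[_ *+ N]mulr_natr mulrAC ltr_pdivrMr// ltr_pM2l// ltr_nat.
Qed.

(** A Lipschitz function of finitely many measurable functions is measurable:
    its strict sublevel sets are countable unions over rational points. *)
Lemma bounded_lipschitz_measurable {N : nat} (X : 'I_N -> T -> R) (h : ('I_N -> R) -> R) :
  (forall l, measurable_fun setT (X l)) -> bounded_lipschitz h ->
  bounded_measurable (fun w => h (fun l => X l w)).
Proof.
move=> mX /bounded_lipschitzP[B [L [B0 L0 hB hL]]]; split; last by exists B.
apply: measurable_fun_lt => a.
pose Q (q : {ffun 'I_N -> rat}) : 'I_N -> R := fun l => ratr (q l).
pose D (j : nat) (m : nat) : set T := if unpickle j is Some q then
  (if h (Q q) + m.+1%:R^-1 <= a then [set w | L * l1_dist (fun l => X l w) (Q q) < m.+1%:R^-1] else set0)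
  else set0.
have -> : [set w | h (fun l => X l w) < a] = \bigcup_j \bigcup_m D j m.
  apply/seteqP; split => [w /= hw|w [j _ [m _]]]; last first.
    rewrite /D; case: (unpickle j) => //= q; case: ifP => // qa /= wq.
    have := hL (fun l => X l w) (Q q); rewrite ler_norml => /andP[_ h1].
    by rewrite (lt_le_trans _ qa)// -ltrBlDl (le_lt_trans h1).
  pose e := a - h (fun l => X l w); have e0 : 0 < e by rewrite subr_gt0.
  pose m := Num.truncn (2 / e).
  have me : 2 * m.+1%:R^-1 < e.
    rewrite ltr_pdivrMr ?ltr0n// mulrC -ltr_pdivrMr//.
    exact: Num.Theory.truncnS_gt.
  have m0 : 0 < m.+1%:R^-1 :> R by rewrite invr_gt0.
  have eL : 0 < m.+1%:R^-1 / (L + 1) by rewrite divr_gt0// ltr_wpDl.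
  have [q qP] := l1_dist_rat (fun l => X l w) eL.
  have Lq : L * l1_dist (fun l => X l w) (Q q) < m.+1%:R^-1.
    apply: (@le_lt_trans _ _ ((L + 1) * l1_dist (fun l => X l w) (Q q))).
      by rewrite ler_wpM2r ?l1_dist_ge0// lerDl.
    by rewrite mulrC -ltr_pdivlMr// ltr_wpDl.
  exists (pickle q) => //; exists m => //; rewrite /D pickleK ifT//.
  have := hL (fun l => X l w) (Q q); rewrite ler_norml => /andP[h1 _].
  by rewrite /e in me; set u := m.+1%:R^-1 in me m0 Lq *; lra.
apply: bigcupT_measurable => j; apply: bigcupT_measurable => m; rewrite /D.
case: (unpickle j) => // q; case: ifP => // _.
apply: measurable_lt_cst; apply: measurable_funM => //; apply: measurable_sum => l.
by apply: measurableT_comp => //; apply: measurable_funB.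
Qed.

End measurability_of_tests.

Section random_vectors.
Context {R : realType} {d : measure_display} {T : measurableType d}.
Variable P : probability T R.

Lemma lipschitz_mean_vector {N : nat} (X : 'I_N -> T -> R) :
  (forall l, measurable_fun setT (X l)) ->
  lipschitz_mean (fun h : ('I_N -> R) -> R => mean P (fun w => h (fun l => X l w))).
Proof.
move=> mX; split.
- by move=> f g bf bg; rewrite meanD//; exact: bounded_lipschitz_measurable.
- by move=> c f bf; rewrite meanZ//; exact: bounded_lipschitz_measurable.
- by move=> f g bf bg fg; apply: mean_le => // ; exact: bounded_lipschitz_measurable.
- exact: mean_cst.
Qed.

(** Puts a tail bound of one coordinate in the form of the tightness hypothesis
    of [levy_continuity]. *)
Lemma vector_tail_mean {N : nat} (X : 'I_N -> T -> R) l (f : ('I_N -> R) -> R) (K : R) :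
  (forall l, measurable_fun setT (X l)) -> bounded_lipschitz f ->
  (forall v, 0 <= f v <= 1) -> (forall v, `|v l| <= K -> f v = 0) ->
  mean P (fun w => f (fun l => X l w)) <= pr P [set w | K < `|X l w|].
Proof.
move=> mX bf f01 fK; have mA := measurable_gt_norm K (mX l).
rewrite -mean_indic//; apply: mean_le.
- exact: bounded_lipschitz_measurable.
- exact: bounded_measurable_indic.
move=> w; have /andP[f0 f1] := f01 (fun l => X l w).
rewrite indicE; case: (boolP (w \in _)) => //.
by rewrite notin_setE/= => /negP; rewrite -leNgt => h; rewrite fK.
Qed.

Lemma real_tight (X : T -> R) (e : R) : measurable_fun setT X -> 0 < e ->
  exists2 K : R, 0 < K & pr P [set w | K < `|X w|] <= e.
Proof.
move=> mX e0; pose F (n : nat) := ~` [set w | n%:R < `|X w|].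
have mF n : measurable (F n) by apply: measurableC; exact: measurable_gt_norm.
have UF : \bigcup_n F n = setT.
  rewrite -subTset => w _; exists (Num.truncn `|X w|).+1 => //=; apply/negP.
  by rewrite -leNgt ltW// Num.Theory.truncnS_gt.
have cF : pr P (F n) @[n --> \oo] --> (1 : R).
  rewrite -(pr_setT P) -UF; apply: pr_bigcup_cvg => // n w /= /negP; rewrite -leNgt => h.
  by apply/negP; rewrite -leNgt (le_trans h)// ler_nat.
have /cvgrPdist_le /(_ _ e0) [n _ /(_ n.+1 (leqnSn n))/= hn] := cF.
exists n.+1%:R => //; have mA := measurable_gt_norm n.+1%:R mX.
move: hn; rewrite /F pr_setC// opprB addrCA subrr addr0; apply: le_trans.
exact: ler_norm.
Qed.

End random_vectors.

(** * Laws on the real line *)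

Section laws_on_the_line.
Context {R : realType}.
Implicit Types mu nu : probability (measurableTypeR R) R.

Lemma law_unique_rays mu nu : (forall x : R, pr mu `]-oo, x[ = pr nu `]-oo, x[) ->
  forall B, measurable B -> mu B = nu B.
Proof.
move=> E; apply: (@measure_unique _ R (measurableTypeR R) (RGenInftyO.G (R := R))
  (fun n => `]-oo, n%:R[%classic) _ _ _ _ mu nu).
- exact: RGenInftyO.measurableE.
- move=> _ _ [x ->] [y ->]; exists (Num.min x y); apply/seteqP; split => z /=.
    by rewrite !in_itv/= lt_min => -[-> ->].
  by rewrite !in_itv/= lt_min => /andP[].
- by move=> i; exists i%:R.
- rewrite -subTset => z _; exists (Num.truncn z).+1 => //=.
  by rewrite in_itv/= Num.Theory.truncnS_gt.
- move=> _ [x ->]; have mx : measurable (`]-oo, x[%classic : set (measurableTypeR R)) by exact: measurable_itv.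
  by transitivity (pr mu `]-oo, x[)%:E; [exact: prE|rewrite E; apply/esym; exact: prE].
- by move=> k; rewrite (le_lt_trans (probability_le1 _ _))// ltry.
Qed.

(** The sequence constantly equal to [nu] converges to [mu] by the continuity
    theorem, so that both give the same mean to Lipschitz functions; indicators
    of rays are limits of these. *)
Lemma law_unique_cos mu nu :
  (forall b t : R, mean mu (fun x : measurableTypeR R => cos (b + t * x)) =
                   mean nu (fun x : measurableTypeR R => cos (b + t * x))) ->
  forall B, measurable B -> mu B = nu B.
Proof.
move=> E; apply: law_unique_rays => a.
pose X (l : 'I_1) (x : measurableTypeR R) : R := x.
have mX l : measurable_fun setT (X l) by exact: measurable_id.
have munu h : bounded_lipschitz h -> mean mu (fun x => h (fun l => X l x)) =
    mean nu (fun x => h (fun l => X l x)).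
  move=> bh; apply/esym; apply: (@cvg_unique _ _ ((fun=> mean nu (fun x => h (fun l => X l x))) @ \oo)) => //.
    exact: cvg_cst.
  apply: (levy_continuity (fun n => lipschitz_mean_vector nu mX) (lipschitz_mean_vector mu mX)) => //.
    move=> e e0.
    have [K1 K10 h1] := real_tight mu (mX ord0) e0.
    have [K2 K20 h2] := real_tight nu (mX ord0) e0.
    exists (Num.max K1 K2); first by rewrite lt_max K10.
    move=> l f bf f01 fK; rewrite (ord1 l) in fK; split; first apply: nearW => _.
      apply: le_trans h2; apply: (vector_tail_mean nu (l := ord0)) => // v vK.
      by apply: fK; rewrite le_max vK orbT.
    apply: le_trans h1; apply: (vector_tail_mean mu (l := ord0)) => // v vK.
    by apply: fK; rewrite le_max vK.
  move=> a' b; rewrite (_ : (fun n => _) = fun=> mean mu (fun x => cos (b + \sum_(i < 1) a' i * X i x))).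
    exact: cvg_cst.
  apply/funext => n; transitivity (mean nu (fun x : measurableTypeR R => cos (b + a' ord0 * x))).
    by apply: eq_mean => x; rewrite big_ord1.
  by rewrite -E; apply: eq_mean => x; rewrite big_ord1.
pose h (m : nat) (v : 'I_1 -> R) : R := Num.min 1 (Num.max 0 (m%:R * (a - v ord0))).
have h01 m v : 0 <= h m v <= 1.
  by rewrite /h le_min ler01 le_max lexx/= ge_min lexx.
have min1_dist_le (z z' : R) : `|Num.min 1 z - Num.min 1 z'| <= `|z - z'|.
  have minE x : Num.min 1 x = 1 - Num.max 0 (1 - x) :> R.
    by case: (leP x 1) => x1; [rewrite max_r ?subr_ge0//; lra|rewrite max_l ?subr0// subr_le0 ltW].
  rewrite !minE (_ : _ - _ = Num.max 0 (1 - z') - Num.max 0 (1 - z)); last by ring.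
  rewrite (le_trans (max0_dist_le _ _))// (_ : _ - _ = z - z')//; by ring.
have bh m : bounded_lipschitz (h m).
  split; first by exists 1 => v; have /andP[h0 h1] := h01 m v; rewrite ger0_norm.
  exists m%:R => v v'; rewrite (le_trans (min1_dist_le _ _))// (le_trans (max0_dist_le _ _))//.
  rewrite -mulrBr (_ : _ - _ - _ = v' ord0 - v ord0); last by ring.
  rewrite normrM normr_nat ler_wpM2l// distrC.
  exact: l1_dist_coord.
have ch (mu' : probability (measurableTypeR R) R) :
    mean mu' (fun x => h m (fun l => X l x)) @[m --> \oo] --> pr mu' `]-oo, a[.
  have mray : measurable (`]-oo, a[%classic : set (measurableTypeR R)) by exact: measurable_itv.
  rewrite -mean_indic//; apply: (@mean_dominated _ _ _ mu' _ _ 1).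
  - by move=> m; have [] := bounded_lipschitz_measurable mX (bh m).
  - exact: measurable_indic.
  - by move=> m x; have /andP[h0 h1] := h01 m (fun l => X l x); rewrite ger0_norm.
  apply/aeW => x; apply: cvg_near_cst; rewrite indicE /h /X.
  case: (boolP (x \in _)); [rewrite inE|rewrite notin_setE]; rewrite /= in_itv/= => xa.
    have ax : 0 < a - x by rewrite subr_gt0.
    near=> m; have h1 : 1 <= m%:R * (a - x).
      by rewrite -ler_pdivrMr//; near: m; exact: nbhs_infty_ger.
    by rewrite max_r ?(le_trans _ h1)// min_l.
  have xa' : a - x <= 0 by rewrite subr_le0 leNgt; apply/negP.
  apply: nearW => m; rewrite max_l ?min_r//; exact: mulr_ge0_le0.
have cmu := ch mu.
rewrite (_ : (fun m => _) = fun m => mean nu (fun x => h m (fun l => X l x))) in cmu; last first.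
  by apply/funext => m; exact: munu.
exact: (cvg_unique _ cmu (ch nu)).
Unshelve. all: by end_near. Qed.

End laws_on_the_line.

(** * Orthonormalization *)

Section gram_schmidt.
Context {R : realType} {d : measure_display} {S : measurableType d}.
Variables (P : probability S R) (f : nat -> S -> R).
Hypothesis bf : forall j, bounded_measurable (f j).
Local Notation dot g h := (mean P (fun s => g s * h s)).

Lemma dotC g h : dot g h = dot h g.
Proof. by apply: eq_mean => s; rewrite mulrC. Qed.

Lemma dot_suml (J : Type) (s : seq J) (c : J -> R) (g : J -> S -> R) h :
  (forall j, bounded_measurable (g j)) -> bounded_measurable h ->
  dot (fun x => \sum_(j <- s) c j * g j x) h = \sum_(j <- s) c j * dot (g j) h.
Proof.
move=> bg bh; under eq_mean do rewrite mulr_suml.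
rewrite mean_sum; last by move=> j; apply: bounded_measurableM => //; exact: bounded_measurableZ.
apply: eq_bigr => j _; rewrite -meanZ; last exact: bounded_measurableM.
by apply: eq_mean => x; rewrite mulrA.
Qed.

(** A null residual is replaced by the zero function, since the inverse of [0]
    is [0]. *)
Fixpoint gram_schmidt n : nat -> S -> R :=
  if n is n'.+1 then
    let e := gram_schmidt n' in
    let r := fun s => f n' s - \sum_(m < n') dot (f n') (e m) * e m s in
    fun m => if (m < n')%N then e m else if m == n' then
      (fun s => (Num.sqrt (dot r r))^-1 * r s) else (fun=> 0)
  else fun _ _ => 0.

Definition orthonormalized m := gram_schmidt m.+1 m.

Lemma gram_schmidtE n m : (m < n)%N -> gram_schmidt n m = orthonormalized m.
Proof.
elim: n => //= n IH; rewrite ltnS leq_eqVlt => /predU1P[->|mn]; last by rewrite mn IH.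
by rewrite ltnn eqxx /orthonormalized/= ltnn eqxx.
Qed.

Let residual n s := f n s - \sum_(m < n) dot (f n) (orthonormalized m) * orthonormalized m s.

Lemma orthonormalizedE n :
  orthonormalized n = fun s => (Num.sqrt (dot (residual n) (residual n)))^-1 * residual n s.
Proof.
have E s : f n s - \sum_(m < n) dot (f n) (gram_schmidt n m) * gram_schmidt n m s = residual n s.
  by congr (_ - _); apply: eq_bigr => m _; rewrite gram_schmidtE.
rewrite {1}/orthonormalized/= ltnn eqxx; apply/funext => s; rewrite E.
by congr ((Num.sqrt _)^-1 * _); apply: eq_mean => s'; rewrite E.
Qed.

Lemma bounded_measurable_orthonormalized n : bounded_measurable (orthonormalized n).
Proof.
elim/ltn_ind: n => n IH; rewrite orthonormalizedE; apply: bounded_measurableZ.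
apply: bounded_measurableB => //.
rewrite (_ : (fun s => _) = (fun s => \sum_(0 <= m < n)
  (if (m < n)%N then dot (f n) (orthonormalized m) * orthonormalized m s else 0))).
  apply: bounded_measurable_sum => m; case: (ltnP m n) => mn; last exact: bounded_measurable_cst.
  by apply: bounded_measurableZ; exact: IH.
apply/funext => s; rewrite big_mkord.
by apply: eq_bigr => m _; rewrite ltn_ord.
Qed.

Let be := bounded_measurable_orthonormalized.

Let bres n : bounded_measurable (residual n).
Proof.
apply: bounded_measurableB => //; apply: bounded_measurable_sum => m.
exact: bounded_measurableZ.
Qed.

Let dot_residual n h : bounded_measurable h ->
  dot (residual n) h = dot (f n) h - \sum_(m < n) dot (f n) (orthonormalized m) * dot (orthonormalized m) h.
Proof.
move=> bh; rewrite /residual; under eq_mean do rewrite mulrBl.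
rewrite meanB; [|exact: bounded_measurableM|]; last first.
  apply: bounded_measurableM => //; apply: bounded_measurable_sum => m.
  exact: bounded_measurableZ.
by rewrite dot_suml// => m; exact: be.
Qed.

(** The properties of an orthonormal sequence that matter when some of its
    elements may vanish: orthogonality, and [|e|^2 e = e] in the weak sense. *)
Let orthonormal_step n : (forall i j, (i < j)%N -> (j < n)%N -> dot (orthonormalized i) (orthonormalized j) = 0) ->
  (forall i h, bounded_measurable h -> (i < n)%N ->
     dot (orthonormalized i) (orthonormalized i) * dot (orthonormalized i) h = dot (orthonormalized i) h) ->
  forall i, (i < n)%N -> dot (residual n) (orthonormalized i) = 0.
Proof.
move=> orth unit i i_n; rewrite dot_residual//.
rewrite (bigD1 (Ordinal i_n))//= big1 ?addr0.
  rewrite (dotC (f n)) (mulrC (dot _ _)) unit// subrr//.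
move=> j ji; have [jlti|iltj|jE] := ltngtP j i.
- by rewrite orth ?mulr0.
- by rewrite (dotC (orthonormalized j)) orth ?mulr0.
- by move: ji; rewrite -(inj_eq val_inj)/= jE eqxx.
Qed.

(** Cauchy-Schwarz for a null vector: [0 <= 2 t a + |h|^2] for all [t] forces
    [a = 0]. *)
Let sqrt_residual_null n h : bounded_measurable h -> dot (residual n) (residual n) = 0 ->
  dot (residual n) h = 0.
Proof.
move=> bh r0; set a := dot (residual n) h.
have ge0 (t : R) : 0 <= 2 * t * a + dot h h.
  have : 0 <= mean P (fun s => (t * residual n s + h s) * (t * residual n s + h s)).
    by apply: mean_ge0 => s; rewrite -expr2 sqr_ge0.
  rewrite (_ : (fun s => _) = (fun s => t ^+ 2 * (residual n s * residual n s) +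
      (2 * t * (residual n s * h s) + h s * h s))); last by apply/funext => s; ring.
  have b1 := bounded_measurableM (bres n) (bres n).
  have b2 := bounded_measurableM (bres n) bh.
  have b3 := bounded_measurableM bh bh.
  rewrite meanD; [|exact: bounded_measurableZ|by apply: bounded_measurableD => //; exact: bounded_measurableZ].
  by rewrite meanD//; [rewrite !meanZ// r0 mulr0 add0r|exact: bounded_measurableZ].
apply/eqP; apply: contrapT => /negP a0.
have := ge0 (- (dot h h + 1) / (2 * a)).
rewrite (_ : 2 * _ * a = - (dot h h + 1)); last by field.
by lra.
Qed.

Let orthonormal n : (forall i j, (i < j)%N -> (j < n)%N -> dot (orthonormalized i) (orthonormalized j) = 0) /\
  (forall i h, bounded_measurable h -> (i < n)%N ->
     dot (orthonormalized i) (orthonormalized i) * dot (orthonormalized i) h = dot (orthonormalized i) h).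
Proof.
elim: n => [|n [orth unit]]; first by [].
have rn := orthonormal_step orth unit.
pose q := dot (residual n) (residual n).
have q0 : 0 <= q by apply: mean_ge0 => s; rewrite -expr2 sqr_ge0.
have dotE h : bounded_measurable h -> dot (orthonormalized n) h = (Num.sqrt q)^-1 * dot (residual n) h.
  move=> bh; rewrite orthonormalizedE -meanZ; last exact: bounded_measurableM.
  by apply: eq_mean => s; rewrite mulrA.
split=> [i j ij|i h bh]; rewrite ltnS leq_eqVlt.
  move=> /predU1P[jn|jn]; last exact: orth.
  by rewrite jn dotC dotE// rn ?mulr0// -jn.
move=> /predU1P[->|i_n]; last exact: unit.
rewrite (dotE h bh); have [E|qn0] := eqVneq q 0.
  by rewrite (sqrt_residual_null bh E) !mulr0.
rewrite dotE// dotC dotE// -/q.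
have : (Num.sqrt q)^-1 * ((Num.sqrt q)^-1 * q) = 1.
  rewrite -{3}(sqr_sqrtr q0) expr2; field.
  by rewrite sqrtr_eq0 -ltNge lt_def qn0.
by move=> ->; rewrite mul1r.
Qed.

(** Expresses that [f n] is in the span of the first [n + 1] elements, so that
    its expansion is a finite sum. *)
Lemma dot_orthonormalized_gt m n : (n < m)%N -> dot (f n) (orthonormalized m) = 0.
Proof.
move=> nm; have [orth unit] := orthonormal m.+1.
have rm i : (i < m)%N -> dot (orthonormalized i) (orthonormalized m) = 0 by move=> im; exact: orth.
have [orthn unitn] := orthonormal n.
pose q := dot (residual n) (residual n).
have E0 : dot (residual n) (orthonormalized m) = 0.
  have q0 : 0 <= q by apply: mean_ge0 => s; rewrite -expr2 sqr_ge0.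
  have [qE|qn0] := eqVneq q 0; first exact: sqrt_residual_null.
  have := rm _ nm; rewrite orthonormalizedE -/q.
  rewrite (_ : (fun s => _) = (fun s => (Num.sqrt q)^-1 * (residual n s * orthonormalized m s))).
    rewrite meanZ; last exact: bounded_measurableM.
    by move=> /eqP; rewrite mulf_eq0 invr_eq0 sqrtr_eq0 leNgt lt_def qn0 q0/= => /eqP.
  by apply/funext => s; rewrite mulrA.
have := dot_residual n (be m); rewrite E0 => /esym/eqP; rewrite subr_eq0 => /eqP ->.
by apply: big1 => i _; rewrite rm ?mulr0// (ltn_trans (ltn_ord i)).
Qed.

(** All the covariances of [f] are recovered from its coordinates; this is what
    makes them the coefficients of a Gaussian copy of [f]. *)
Lemma gram_schmidt_parseval M (c : 'I_M -> R) :
  mean P (fun s => (\sum_(j < M) c j * f j s) ^+ 2) =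
  \sum_(m < M) (\sum_(j < M) c j * dot (f j) (orthonormalized m)) ^+ 2.
Proof.
have [orth unit] := orthonormal M.
pose F s := \sum_(j < M) c j * f j s.
have bF : bounded_measurable F.
  by apply: bounded_measurable_sum => j; exact: bounded_measurableZ.
pose a m := dot F (orthonormalized m).
have aE m : a m = \sum_(j < M) c j * dot (f j) (orthonormalized m) by rewrite /a dot_suml.
(* f j is its expansion, against any test function *)
have expand (j : 'I_M) h : bounded_measurable h ->
    dot (f j) h = \sum_(m < M) dot (f j) (orthonormalized m) * dot (orthonormalized m) h.
  move=> bh.
  have -> : \sum_(m < M) dot (f j) (orthonormalized m) * dot (orthonormalized m) h =
      \sum_(m < j.+1) dot (f j) (orthonormalized m) * dot (orthonormalized m) h.
    pose G m := dot (f j) (orthonormalized m) * dot (orthonormalized m) h.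
    rewrite -(big_mkord xpredT G) -(big_mkord xpredT G) (big_cat_nat (n := j.+1))//=.
    rewrite [X in _ + X]big_nat_cond [X in _ + X]big1 ?addr0// => m /andP[/andP[jm _] _].
    by rewrite /G dot_orthonormalized_gt ?mul0r.
  rewrite big_ord_recr/=; have := dot_residual j bh => /eqP.
  rewrite eq_sym subr_eq addrC => /eqP ->; congr +%R.
  pose q := dot (residual j) (residual j).
  have q0 : 0 <= q by apply: mean_ge0 => s; rewrite -expr2 sqr_ge0.
  have dotE g : bounded_measurable g -> dot (orthonormalized j) g = (Num.sqrt q)^-1 * dot (residual j) g.
    move=> bg; rewrite orthonormalizedE -meanZ; last exact: bounded_measurableM.
    by apply: eq_mean => s; rewrite mulrA.
  have [E|qn0] := eqVneq q 0.
    by rewrite dotE// (sqrt_residual_null bh E) !mulr0.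
  have [orthj unitj] := orthonormal j.
  have fr : dot (f j) (residual j) = q.
    have := dot_residual j (bres j); rewrite -/q big1 ?subr0// => m _.
    by rewrite (dotC (orthonormalized m)) (orthonormal_step orthj unitj)// mulr0.
  rewrite (dotC (f j)) !dotE// (dotC _ (f j)) fr.
  have : (Num.sqrt q)^-1 * q * (Num.sqrt q)^-1 = 1.
    rewrite -{2}(sqr_sqrtr q0) expr2; field.
    by rewrite sqrtr_eq0 -ltNge lt_def qn0.
  by move=> h1; rewrite mulrA h1 mul1r.
rewrite -[LHS]/(mean P (fun s => F s ^+ 2)).
under eq_mean do rewrite expr2.
have -> : dot F F = \sum_(j < M) c j * dot (f j) F by rewrite [LHS]dot_suml.
under eq_bigr => j _ do rewrite expand//.
under eq_bigr => j _ do rewrite mulr_sumr.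
rewrite exchange_big/=; apply: eq_bigr => m _.
rewrite -aE expr2 {1}/a.
rewrite (dotC F) -/(a m) [in RHS]dotC -/(a m) aE mulr_suml.
by apply: eq_bigr => j _; rewrite -mulrA (dotC (orthonormalized m) F) -/(a m) aE.
Qed.

End gram_schmidt.

(** * Tails of the empirical process *)

Section empirical_measure.
Context {R : realType} {d : measure_display} {S : measurableType d}.
Variables (P : probability S R) (PN : probability (sequence_space S) R).
Hypothesis PN_product : is_infinite_product P PN.
Implicit Types (A B : set S) (n : nat) (w : sequence_space S).

Definition centered_indic A (s : S) : R := \1_A s - pr P A.

Definition empirical n A w : R := normalized_sum n (centered_indic A) w.

Lemma bounded_measurable_centered_indic A : measurable A ->
  bounded_measurable (centered_indic A).
Proof.
move=> mA; apply: bounded_measurableB; first exact: bounded_measurable_indic.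
exact: bounded_measurable_cst.
Qed.

Lemma mean_centered_indic A : measurable A -> mean P (centered_indic A) = 0.
Proof.
move=> mA; rewrite /centered_indic meanB ?mean_indic ?mean_cst ?subrr//.
  exact: bounded_measurable_indic.
exact: bounded_measurable_cst.
Qed.

Lemma centered_indic_le1 A s : measurable A -> `|centered_indic A s| <= 1.
Proof.
move=> mA; have p1 := pr_le1 P mA; have p0 := pr_ge0 P A.
rewrite /centered_indic indicE; case: (_ \in _) => /=.
  by rewrite ger0_norm; lra.
by rewrite sub0r normrN ger0_norm.
Qed.

Lemma empirical_set0 n w : empirical n set0 w = 0.
Proof.
rewrite /empirical /normalized_sum big1 ?mulr0// => j _.
by rewrite /centered_indic indic0 /pr measure0 subrr.
Qed.

Lemma empiricalB n A B w : empirical n A w - empirical n B w =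
  normalized_sum n (fun s => centered_indic A s - centered_indic B s) w.
Proof. by rewrite /empirical /normalized_sum -mulrBr -sumrB. Qed.

Lemma measurable_empirical n A : measurable A -> measurable_fun setT (empirical n A).
Proof.
by move=> mA; apply: measurable_normalized_sum; case: (bounded_measurable_centered_indic mA).
Qed.

(** A variance is at most the second moment, here the mean of the indicator of
    the symmetric difference. *)
Lemma centered_indic_dist_sqr_mean A B : measurable A -> measurable B ->
  mean P (fun s => (centered_indic A s - centered_indic B s) ^+ 2) <= pr P (A `+` B).
Proof.
move=> mA mB; have mD : measurable (A `+` B) by apply: measurableU; exact: measurableD.
have bA := bounded_measurable_indic (R := R) mA; have bB := bounded_measurable_indic (R := R) mB.
pose m : R := pr P A - pr P B.
have bD := bounded_measurableB bA bB.
have -> : mean P (fun s => (centered_indic A s - centered_indic B s) ^+ 2) =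
    pr P (A `+` B) - m ^+ 2.
  transitivity (mean P (fun s => \1_(A `+` B) s - 2 * m * (\1_A s - \1_B s) + m ^+ 2)).
    apply: eq_mean => s; rewrite (_ : _ - _ = (\1_A s - \1_B s) - m); last by rewrite /centered_indic /m; ring.
    have -> : \1_(A `+` B) s = (\1_A s - \1_B s) ^+ 2 :> R.
      rewrite !indicE /setY in_setU !in_setD.
      by case: (s \in A); case: (s \in B) => /=; rewrite ?subrr ?subr0 ?sub0r ?sqrrN ?expr1n ?expr0n.
    ring.
  rewrite meanD; [|apply: bounded_measurableB; [exact: bounded_measurable_indic|exact: bounded_measurableZ]|exact: bounded_measurable_cst].
  rewrite meanB; [|exact: bounded_measurable_indic|exact: bounded_measurableZ].
  rewrite meanZ// meanB// !mean_indic// mean_cst -/m; ring.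
by rewrite gerBl sqr_ge0.
Qed.

Lemma empirical_dist_tail n A B (v l t : R) : (0 < n)%N -> measurable A -> measurable B ->
  pr P (A `+` B) <= v -> 0 <= l -> 4 * l <= Num.sqrt n%:R ->
  pr PN [set w | t < `|empirical n A w - empirical n B w|] <= 2 * expR (2 * l ^+ 2 * v - l * t).
Proof.
move=> n0 mA mB ABv l0 ln.
have bA := bounded_measurable_centered_indic mA; have bB := bounded_measurable_centered_indic mB.
have -> : [set w | t < `|empirical n A w - empirical n B w|] =
    [set w | t < `|normalized_sum n (fun s => centered_indic A s - centered_indic B s) w|].
  by apply/seteqP; split => w /=; rewrite empiricalB.
apply: le_trans (normalized_sum_tail (K := 2) PN_product t n0 (bounded_measurableB bA bB) _ _ l0 _) _.
- by rewrite meanB// !mean_centered_indic// subrr.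
- move=> s; rewrite (le_trans (ler_normB _ _))//.
  by have := centered_indic_le1 s mA; have := centered_indic_le1 s mB; lra.
- by rewrite ler_pdivlMr//; lra.
rewrite ler_wpM2l// ler_expR lerD2r ler_wpM2l ?mulr_ge0 ?sqr_ge0//.
exact: le_trans (centered_indic_dist_sqr_mean mA mB) ABv.
Qed.

(** Monotonicity in the set, lost by centering, costs [sqrt n] times the mass
    of the larger set. *)
Lemma empirical_subset_le n A B w : measurable A -> measurable B -> A `<=` B ->
  `|empirical n A w| <= `|empirical n B w| + 2 * (Num.sqrt n%:R * pr P B).
Proof.
move=> mA mB AB; have pAB := pr_le P mA mB AB; have pA0 := pr_ge0 P A.
set x : R := (Num.sqrt n%:R)^-1; have x0 : 0 <= x by rewrite invr_ge0 sqrtr_ge0.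
have nE : x * n%:R = Num.sqrt n%:R.
  have [->|n0] := posnP n; first by rewrite mulr0 sqrtr0.
  have s0 : 0 < Num.sqrt n%:R :> R by rewrite sqrtr_gt0 ltr0n.
  by rewrite /x -{2}(sqr_sqrtr (ler0n R n)) expr2 mulKf ?gt_eqF.
have E D : empirical n D w = x * (\sum_(j < n) \1_D (w j)) - Num.sqrt n%:R * pr P D.
  rewrite /empirical /normalized_sum /centered_indic sumrB sumr_const card_ord.
  by rewrite mulrBr -[pr P D *+ n]mulr_natr mulrA (mulrAC x) nE.
have sAB : x * (\sum_(j < n) \1_A (w j)) <= x * (\sum_(j < n) \1_B (w j)).
  rewrite ler_wpM2l// ler_sum// => j _; rewrite !indicE ler_nat.
  case: (boolP (w j \in A)) => // ; rewrite inE => /AB wB.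
  by rewrite mem_set.
have sA0 : 0 <= x * (\sum_(j < n) \1_A (w j)).
  by rewrite mulr_ge0// sumr_ge0// => j _; rewrite indicE ler0n.
have q0 := sqrtr_ge0 (n%:R : R).
have qA : Num.sqrt n%:R * pr P A <= Num.sqrt n%:R * pr P B by rewrite ler_wpM2l.
have qA0 : 0 <= Num.sqrt n%:R * pr P A by rewrite mulr_ge0.
rewrite !E; move: sAB sA0 qA qA0.
move: (x * _) (x * _) (Num.sqrt _ * _) (Num.sqrt _ * _) => a b u v h1 h2 h3 h4.
have h5 := ler_norm (b - v); have h6 := ler_norm (a - u).
by rewrite ler_norml; apply/andP; split; lra.
Qed.

End empirical_measure.

(** * Bracketing and chaining *)

Section chaining.
Context {R : realType} {d : measure_display} {S : measurableType d}.
Variables (P : probability S R) (PN : probability (sequence_space S) R).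
Hypothesis PN_product : is_infinite_product P PN.
Context {I : Type}.
Variables (C : I -> set S) (L U : nat -> nat -> set S) (p : nat -> I -> nat).
Variables (N : nat -> nat) (D A Q : R).

(** The cell of [i] at level [k] is [p k i], and its bracket is [(L k (p k i),
    U k (p k i))]. The base [16] of the sizes is the fourth power of that of
    the thresholds [2^-k] used below: increments of variance [16^-k] exceed
    [2^-k] with a probability doubly exponentially small in [k]. *)
Definition bracketing := [/\ forall i, measurable (C i),
  (forall k c, measurable (L k c)) /\ (forall k c, measurable (U k c)),
  forall k i, (p k i < N k)%N /\ L k (p k i) `<=` C i /\ C i `<=` U k (p k i),
  [/\ 0 <= D, 1 <= A & 0 <= Q] &
  (forall k c, pr P (U k c `\` L k c) <= D / 16 ^+ k) /\
  (forall k, (N k)%:R <= Q * A ^+ k)].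

Hypothesis brackets : bracketing.

Let mC i : measurable (C i). Proof. by have [] := brackets. Qed.
Let mL k c : measurable (L k c). Proof. by have [_ []] := brackets. Qed.
Let mU k c : measurable (U k c). Proof. by have [_ []] := brackets. Qed.
Let pN k i : (p k i < N k)%N. Proof. by have [_ _ h _ _] := brackets; have [] := h k i. Qed.
Let LC k i : L k (p k i) `<=` C i. Proof. by have [_ _ h _ _] := brackets; have [_ []] := h k i. Qed.
Let CU k i : C i `<=` U k (p k i). Proof. by have [_ _ h _ _] := brackets; have [_ []] := h k i. Qed.
Let D0 : 0 <= D. Proof. by have [_ _ _ []] := brackets. Qed.
Let A1 : 1 <= A. Proof. by have [_ _ _ []] := brackets. Qed.
Let Q0 : 0 <= Q. Proof. by have [_ _ _ []] := brackets. Qed.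
Let small k c : pr P (U k c `\` L k c) <= D / 16 ^+ k.
Proof. by have [_ _ _ _ []] := brackets. Qed.
Let Nle k : (N k)%:R <= Q * A ^+ k. Proof. by have [_ _ _ _ []] := brackets. Qed.

Local Notation emp := (empirical P).

Definition linked k c c' : bool := `[< exists i, p k i = c /\ p k.+1 i = c' >].

(** The tail bound at level [k], obtained with the exponent [l = 4^k / 4] for a
    variance [2 D / 16^k] and a threshold [2^-k]. *)
Definition link_bound k : R := 2 * expR (D / 4 - 2 ^+ k / 4).

(** Both lower brackets lie inside a set [C i] which exceeds each of them by at
    most the size of its bracket. *)
Lemma linked_dist k c c' : linked k c c' -> pr P (L k.+1 c' `+` L k c) <= 2 * D / 16 ^+ k.
Proof.
move=> /asboolP[i [<- <-]].
have m1 : measurable (L k.+1 (p k.+1 i) `\` L k (p k i)) by exact: measurableD.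
have m2 : measurable (L k (p k i) `\` L k.+1 (p k.+1 i)) by exact: measurableD.
rewrite (le_trans (prU_le P m1 m2))// -mulrA [leRHS]mulr_natl mulr2n lerD//.
  apply: le_trans (small k (p k i)); apply: pr_le => //; first exact: measurableD.
  by move=> s [Ls nLs]; split => //; apply: CU; exact: (LC Ls).
apply: (@le_trans _ _ (D / 16 ^+ k.+1)); last first.
  rewrite ler_wpM2l// lef_pV2 ?posrE ?exprn_gt0// ler_weXn2l//.
  by rewrite (_ : 1 = 1%:R)// ler_nat.
apply: le_trans (small k.+1 (p k.+1 i)); apply: pr_le => //; first exact: measurableD.
by move=> s [Ls nLs]; split => //; apply: CU; exact: (LC Ls).
Qed.

(** The exponent [4^k / 4] is admissible for sums of [n] terms as soon as [16^k
    <= n]; this is what stops the chaining. *)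
Let level_rate k n : (16 ^ k <= n)%N -> 4 * (4 ^+ k / 4) <= Num.sqrt n%:R :> R.
Proof.
move=> kn; rewrite mulrC divfK//.
rewrite -[leLHS]ger0_norm ?exprn_ge0// -sqrtr_sqr ler_sqrt ?ler0n//.
by rewrite -exprM mulnC exprM -!natrX ler_nat.
Qed.

Let level_exponent k (v : R) : v <= 2 * D / 16 ^+ k ->
  2 * (4 ^+ k / 4) ^+ 2 * v - 4 ^+ k / 4 * (2 ^+ k)^-1 <= D / 4 - 2 ^+ k / 4.
Proof.
move=> vD; have p2 : 0 < 2 ^+ k :> R by rewrite exprn_gt0.
have E4 : 4 ^+ k = 2 ^+ k * 2 ^+ k :> R by rewrite -exprMn; congr (_ ^+ k); rewrite -natrM.
have E16 : 16 ^+ k = 4 ^+ k * 4 ^+ k :> R by rewrite -exprMn; congr (_ ^+ k); rewrite -natrM.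
rewrite (_ : 4 ^+ k / 4 * (2 ^+ k)^-1 = 2 ^+ k / 4); last by rewrite E4; field; rewrite gt_eqF.
rewrite lerD2r.
apply: (@le_trans _ _ (2 * (4 ^+ k / 4) ^+ 2 * (2 * D / 16 ^+ k))).
  by rewrite ler_wpM2l// mulr_ge0// sqr_ge0.
rewrite E16 le_eqVlt; apply/orP; left; apply/eqP; field.
by rewrite expf_neq0.
Qed.

Lemma linked_tail k n c c' : (16 ^ k <= n)%N -> linked k c c' ->
  pr PN [set w | (2 ^+ k)^-1 < `|emp n (L k.+1 c') w - emp n (L k c) w|] <= link_bound k.
Proof.
move=> kn cc'; have n0 : (0 < n)%N by rewrite (leq_trans _ kn)// expn_gt0.
have l0 : 0 <= 4 ^+ k / 4 :> R by rewrite divr_ge0// exprn_ge0.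
apply: (le_trans (empirical_dist_tail PN_product _ n0 (mL _ _) (mL _ _) (linked_dist cc') l0 (level_rate kn))).
by rewrite ler_wpM2l// ler_expR level_exponent.
Qed.

Lemma bracket_tail k n c : (16 ^ k <= n)%N ->
  pr PN [set w | (2 ^+ k)^-1 < `|emp n (U k c `\` L k c) w|] <= link_bound k.
Proof.
move=> kn; have n0 : (0 < n)%N by rewrite (leq_trans _ kn)// expn_gt0.
have l0 : 0 <= 4 ^+ k / 4 :> R by rewrite divr_ge0// exprn_ge0.
have mB : measurable (U k c `\` L k c) by exact: measurableD.
have hv : pr P ((U k c `\` L k c) `+` set0) <= 2 * D / 16 ^+ k.
  rewrite setY0 (le_trans (small k c))// -mulrA ler_peMl ?divr_ge0 ?exprn_ge0//.
  by rewrite ler1n.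
have -> : [set w | (2 ^+ k)^-1 < `|emp n (U k c `\` L k c) w|] =
    [set w | (2 ^+ k)^-1 < `|emp n (U k c `\` L k c) w - emp n set0 w|].
  by apply/seteqP; split => w /=; rewrite empirical_set0 subr0.
apply: (le_trans (empirical_dist_tail PN_product _ n0 mB measurable0 hv l0 (level_rate kn))).
by rewrite ler_wpM2l// ler_expR level_exponent.
Qed.

(** Geometrically many links against doubly exponential tails: [exp (- 2^k /
    4)] is bounded by any power of [2^-k], and the power [m + 1] absorbs the
    growth [(A^2)^k <= (2^m)^k] with a factor [2^-k] to spare. *)
Lemma link_bound_summable : exists2 B : R, 0 <= B & forall k,
  (N k * N k.+1 + N k)%:R * link_bound k <= B / 2 ^+ k.
Proof.
pose m := (Num.truncn (A ^+ 2)).+1.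
have A0 : 0 < A by rewrite (lt_le_trans _ A1).
have Am : A ^+ 2 <= 2 ^+ m.
  apply: (@le_trans _ _ m%:R); first exact: ltW (Num.Theory.truncnS_gt _).
  by rewrite -natrX ler_nat ltnW// ltn_expl.
pose F : R := m.+1`!%:R * 4 ^+ m.+1.
have F0 : 0 <= F by rewrite mulr_ge0// exprn_ge0.
pose B := (Q * (Q * A) + Q) * (2 * expR (D / 4) * F).
have B10 : 0 <= Q * (Q * A) + Q by rewrite addr_ge0// !mulr_ge0// ltW.
have B20 : 0 <= 2 * expR (D / 4) * F by exact: mulr_ge0 (mulr_ge0 (ler0n R 2) (expR_ge0 _)) F0.
exists B => [|k]; first exact: mulr_ge0.
have p2 : 0 < 2 ^+ k :> R by rewrite exprn_gt0.
have Ak1 : 1 <= A ^+ k by rewrite exprn_ege1.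
have Nk : (N k * N k.+1 + N k)%:R <= (Q * (Q * A) + Q) * (A ^+ 2) ^+ k.
  rewrite natrD natrM mulrDl lerD//.
    apply: (@le_trans _ _ ((Q * A ^+ k) * (Q * A ^+ k.+1))); first exact: ler_pM.
    by rewrite exprS -exprM mulnC exprM le_eqVlt; apply/orP; left; apply/eqP; ring.
  rewrite (le_trans (Nle k))// ler_wpM2l// -exprM mulnC exprM expr2 ler_peMr//.
  by rewrite exprn_ge0// ltW.
have ex : expR (- (2 ^+ k / 4)) <= F / (2 ^+ k) ^+ m.+1.
  have y0 : 0 <= 2 ^+ k / 4 :> R by rewrite divr_ge0// ltW.
  have h := expR_ge1Dxn m y0.
  have : (2 ^+ k / 4 : R) ^+ m.+1 / m.+1`!%:R <= expR (2 ^+ k / 4).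
    by apply: le_trans h; rewrite lerDr.
  have z0 : 0 < (2 ^+ k / 4 : R) ^+ m.+1 / m.+1`!%:R.
    by rewrite divr_gt0 ?exprn_gt0 ?divr_gt0// ltr0n fact_gt0.
  rewrite -lef_pV2 ?posrE ?expR_gt0// -expRN.
  move=> /le_trans; apply.
  by rewrite /F invf_div expr_div_n invf_div mulrA.
have lb : link_bound k <= 2 * expR (D / 4) * F / (2 ^+ k) ^+ m.+1.
  rewrite /link_bound expRD mulrA -[leRHS]mulrA ler_wpM2l// mulr_ge0// expR_ge0.
apply: (@le_trans _ _ ((Q * (Q * A) + Q) * (A ^+ 2) ^+ k * (2 * expR (D / 4) * F / (2 ^+ k) ^+ m.+1))).
  by apply: ler_pM => //; rewrite mulr_ge0// expR_ge0.
rewrite (_ : _ * _ = B * ((A ^+ 2) ^+ k / (2 ^+ k) ^+ m.+1)); last by rewrite /B; ring.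
rewrite ler_wpM2l//; first exact: mulr_ge0.
rewrite ler_pdivrMr ?exprn_gt0// [in leRHS]exprS mulKf ?gt_eqF//.
rewrite [leRHS]exprAC lerXn2r// ?nnegrE ?exprn_ge0//.
exact: ltW.
Qed.

Let level_event k n : set (sequence_space S) :=
  (\big[setU/set0]_(c < N k) \big[setU/set0]_(c' < N k.+1 | linked k c c')
     [set w | (2 ^+ k)^-1 < `|emp n (L k.+1 c') w - emp n (L k c) w|]) `|`
  (\big[setU/set0]_(c < N k) [set w | (2 ^+ k)^-1 < `|emp n (U k c `\` L k c) w|]).

Let measurable_link_event k n c c' :
  measurable [set w | (2 ^+ k)^-1 < `|emp n (L k.+1 c') w - emp n (L k c) w|].
Proof.
by apply: measurable_gt_norm; apply: measurable_funB; exact: measurable_empirical.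
Qed.

Let measurable_bracket_event k n c :
  measurable [set w | (2 ^+ k)^-1 < `|emp n (U k c `\` L k c) w|].
Proof. by apply: measurable_gt_norm; apply: measurable_empirical; exact: measurableD. Qed.

Let measurable_links k n : measurable (\big[setU/set0]_(c < N k) \big[setU/set0]_(c' < N k.+1 | linked k c c')
     [set w | (2 ^+ k)^-1 < `|emp n (L k.+1 c') w - emp n (L k c) w|]).
Proof.
by apply: measurable_bigsetU_seq => c _; apply: measurable_bigsetU_seq => c' _.
Qed.

Let measurable_level_event k n : measurable (level_event k n).
Proof. by apply: measurableU => //; apply: measurable_bigsetU_seq => c _. Qed.

Let level_event_pr k n : (16 ^ k <= n)%N ->
  pr PN (level_event k n) <= (N k * N k.+1 + N k)%:R * link_bound k.
Proof.
move=> kn.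
have lb0 : 0 <= link_bound k by rewrite mulr_ge0// expR_ge0.
rewrite (le_trans (prU_le _ _ _))//; first by apply: measurable_bigsetU_seq.
rewrite natrD mulrDl lerD//.
  apply: le_trans (pr_bigU_le _ _ _) _ => [c _|]; first exact: measurable_bigsetU_seq.
  apply: (@le_trans _ _ (\sum_(c < N k) (N k.+1)%:R * link_bound k)).
    apply: ler_sum => c _; apply: le_trans (pr_bigU_le _ _ _) _ => //.
    rewrite big_mkcond/=; apply: (@le_trans _ _ (\sum_(c' < N k.+1) link_bound k)).
      by apply: ler_sum => c' _; case: ifP => // cc'; exact: linked_tail.
    by rewrite sumr_const card_ord -[_ *+ _]mulr_natl.
  by rewrite sumr_const card_ord -[_ *+ _]mulr_natl mulrA -natrM.
apply: le_trans (pr_bigU_le _ _ _) _ => //.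
apply: (@le_trans _ _ (\sum_(c < N k) link_bound k)).
  by apply: ler_sum => c _; exact: bracket_tail.
by rewrite sumr_const card_ord -[_ *+ _]mulr_natl.
Qed.

(** Telescoping along the cells of [i], from level [k0] to level [k0 + j]. *)
Let chain_le n k0 j w i : (forall k, (k0 <= k < k0 + j)%N -> ~ level_event k n w) ->
  `|emp n (L (k0 + j) (p (k0 + j) i)) w - emp n (L k0 (p k0 i)) w| <= 2 / 2 ^+ k0 - 2 / 2 ^+ (k0 + j).
Proof.
elim: j => [|j IH] h; first by rewrite addn0 !subrr normr0.
have hj : ~ level_event (k0 + j) n w by apply: h; rewrite leq_addr ltn_add2l ltnSn.
have lt : `|emp n (L (k0 + j).+1 (p (k0 + j).+1 i)) w - emp n (L (k0 + j) (p (k0 + j) i)) w| <= (2 ^+ (k0 + j))^-1.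
  rewrite leNgt; apply/negP => hlt; apply: hj; left.
  rewrite -(bigcup_mkord (N (k0 + j)) (fun c => \big[setU/set0]_(c' < N (k0 + j).+1 | linked (k0 + j) c c')
     [set w | (2 ^+ (k0 + j))^-1 < `|emp n (L (k0 + j).+1 c') w - emp n (L (k0 + j) c) w|])).
  exists (p (k0 + j) i); first exact: pN.
  rewrite (bigD1 (Ordinal (pN (k0 + j).+1 i)))/=; last by apply/asboolP; exists i.
  by left.
have IH' := IH (fun k hk => h k _).
have {IH'} : `|emp n (L (k0 + j) (p (k0 + j) i)) w - emp n (L k0 (p k0 i)) w| <= 2 / 2 ^+ k0 - 2 / 2 ^+ (k0 + j).
  apply: IH => k /andP[k1 k2]; apply: h; rewrite k1/= (leq_trans k2)// leq_add2l//.
rewrite addnS; move: lt; set a := emp n _ w; set b := emp n _ w; set c := emp n _ w => lt IH'.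
have E : 2 / 2 ^+ (k0 + j).+1 = (2 ^+ (k0 + j))^-1 :> R.
  by rewrite exprS invfM mulrA divff// mul1r.
rewrite E; apply: (le_trans (ler_distD b _ _)).
have E2 : 2 / 2 ^+ (k0 + j) = (2 ^+ (k0 + j))^-1 + (2 ^+ (k0 + j))^-1 :> R by rewrite mulr_natl mulr2n.
by rewrite E2 in IH'; lra.
Qed.

(** Chaining from level [k0] to the level [q] with [16^q <= n < 16^(q+1)].
    There the difference between [C i] and its lower bracket lies in a bracket
    of mass [O(16^-q)], and [sqrt n * 16^-q = O(4^-q)]. *)
Lemma asymptotic_equicontinuity : exists2 B : R, 0 <= B & forall k0 n, (16 ^ k0 <= n)%N ->
  exists E : set (sequence_space S), [/\ measurable E, pr PN E <= B / 2 ^+ k0 &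
    forall w, ~ E w -> forall i,
      `|emp n (C i) w - emp n (L k0 (p k0 i)) w| <= (3 + 8 * D) / 2 ^+ k0].
Proof.
have [B B0 hB] := link_bound_summable.
exists (2 * B) => [|k0 n kn]; first by rewrite mulr_ge0.
have n0 : (0 < n)%N by rewrite (leq_trans _ kn)// expn_gt0.
pose q := trunc_log 16 n.
have qn : (16 ^ q <= n)%N by exact: trunc_logP.
have nq : (n < 16 ^ q.+1)%N by exact: trunc_log_ltn.
have k0q : (k0 <= q)%N by rewrite /q trunc_log_max.
pose j := (q - k0)%N; have qE : q = (k0 + j)%N by rewrite /j subnKC.
exists (\big[setU/set0]_(m < j.+1) level_event (k0 + m) n); split.
- exact: measurable_bigsetU_seq.
- apply: le_trans (pr_bigU_le _ _ _) _ => //.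
  apply: (@le_trans _ _ (\sum_(m < j.+1) (2 * B / 2 ^+ k0) / 2 ^+ m.+1)).
    apply: ler_sum => m _; apply: (@le_trans _ _ (B / 2 ^+ (k0 + m))).
      apply: le_trans (hB _); apply: level_event_pr; apply: leq_trans qn.
      by rewrite leq_exp2l// qE leq_add2l -ltnS.
    rewrite exprD exprS le_eqVlt; apply/orP; left; apply/eqP; field.
    by rewrite !expf_neq0.
  by apply: sum_half_powers_le; rewrite divr_ge0 ?exprn_ge0// mulr_ge0.
move=> w nE i.
have nl k : (k0 <= k <= k0 + j)%N -> ~ level_event k n w.
  move=> /andP[k1 k2] h; apply: nE; rewrite -(bigcup_mkord j.+1 (fun m => level_event (k0 + m) n)).
  exists (k - k0)%N; last by rewrite subnKC.
  by rewrite /= ltnS leq_subLR.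
have h1 := chain_le (n := n) (k0 := k0) (j := j) (w := w) i _.
have {}h1 : `|emp n (L q (p q i)) w - emp n (L k0 (p k0 i)) w| <= 2 / 2 ^+ k0.
  rewrite qE; apply: (le_trans (h1 _)).
    by move=> k /andP[k1 k2]; apply: nl; rewrite k1 ltnW.
  by rewrite gerBl divr_ge0// exprn_ge0.
have mUL : measurable (U q (p q i) `\` L q (p q i)) by exact: measurableD.
have mCL : measurable (C i `\` L q (p q i)) by exact: measurableD.
have h2 : `|emp n (U q (p q i) `\` L q (p q i)) w| <= (2 ^+ q)^-1.
  rewrite leNgt; apply/negP => hlt; apply: (nl q); first by rewrite k0q qE leqnn.
  right; rewrite -(bigcup_mkord (N q) (fun c => [set w | (2 ^+ q)^-1 < `|emp n (U q c `\` L q c) w|])).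
  by exists (p q i) => //; exact: pN.
have h3 : emp n (C i) w - emp n (L q (p q i)) w = emp n (C i `\` L q (p q i)) w.
  have pE : pr P (C i `\` L q (p q i)) = pr P (C i) - pr P (L q (p q i)) by apply: pr_setDE.
  rewrite empiricalB /empirical /normalized_sum; congr (_ * _); apply: eq_bigr => m _.
  rewrite /centered_indic pE.
  have -> : \1_(C i `\` L q (p q i)) (w m) = \1_(C i) (w m) - \1_(L q (p q i)) (w m) :> R.
    rewrite !indicE in_setD; case: (boolP (w m \in L q (p q i))) => [|_]; rewrite ?andbT ?subr0//.
    by rewrite inE andbF => /LC wC; rewrite mem_set// subrr.
  by ring.
have h4 := @empirical_subset_le R d S P n (C i `\` L q (p q i)) (U q (p q i) `\` L q (p q i)) w mCL mUL.
have {}h4 : `|emp n (C i `\` L q (p q i)) w| <= (2 ^+ q)^-1 + 2 * (Num.sqrt n%:R * (D / 16 ^+ q)).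
  apply: (le_trans (h4 _)); first by move=> s [Cs nLs]; split => //; exact: CU.
  by rewrite lerD// ler_wpM2l// ler_wpM2l ?sqrtr_ge0.
have h5 : Num.sqrt n%:R <= 4 * 4 ^+ q :> R.
  rewrite -exprS -[leRHS]ger0_norm ?exprn_ge0// -sqrtr_sqr ler_sqrt ?exprn_ge0//.
  by rewrite -exprM mulnC exprM -!natrX ler_nat ltnW.
have q2 : (2 ^+ q)^-1 <= (2 ^+ k0)^-1 :> R.
  by rewrite lef_pV2 ?posrE ?exprn_gt0// ler_weXn2l// ler1n.
have h6 : Num.sqrt n%:R * (D / 16 ^+ q) <= 4 * D / 2 ^+ k0.
  apply: (@le_trans _ _ (4 * 4 ^+ q * (D / 16 ^+ q))).
    by rewrite ler_wpM2r// divr_ge0// exprn_ge0.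
  have E16 : 16 ^+ q = 4 ^+ q * 4 ^+ q :> R by rewrite -exprMn; congr (_ ^+ q); rewrite -natrM.
  have p4 : 0 < 4 ^+ q :> R by rewrite exprn_gt0.
  rewrite (_ : _ * _ = 4 * D / 4 ^+ q); last by rewrite E16; field; rewrite gt_eqF.
  rewrite ler_wpM2l ?mulr_ge0// (le_trans _ q2)// lef_pV2 ?posrE ?exprn_gt0//.
  by rewrite lerXn2r// ?nnegrE// ler_nat.
apply: (le_trans (ler_distD (emp n (L q (p q i)) w) _ _)); rewrite h3.
have E : (3 + 8 * D) / 2 ^+ k0 = (2 ^+ k0)^-1 + 2 * (4 * D / 2 ^+ k0) + 2 / 2 ^+ k0 by ring.
rewrite E; lra.
Qed.

End chaining.

(** * Gaussian sequences with a prescribed covariance *)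

Section gaussian_sequence.
Context {R : realType} {d : measure_display} {S : measurableType d}.
Variables (P : probability S R) (PN : probability (sequence_space S) R).
Hypothesis PN_product : is_infinite_product P PN.
Variable g : {mfun S >-> measurableTypeR R}.
Hypothesis g_normal : forall B, measurable B -> distribution P g B = normal_prob 0 1 B.

Lemma mean_cos_normal (b t : R) : mean P (fun s => cos (b + t * g s)) = cos b * expR (- (t ^+ 2 / 2)).
Proof.
have bc : @bounded_measurable R _ (measurableTypeR R) (fun x => cos (b + t * x)).
  by apply: bounded_measurable_cos; apply: measurable_funD.
rewrite -(mean_distribution P g bc).
rewrite (_ : mean _ _ = mean (normal_prob 0 1) (fun x : measurableTypeR R => cos (b + t * x))).
  by rewrite normal_prob_cos// expr1n mulr1.
rewrite /mean /Rintegral; congr fine.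
by apply: eq_measure_integral => B mB _; exact: g_normal.
Qed.

Lemma mean_cos_sum_normal n (a : nat -> R) (b : R) :
  mean PN (fun w => cos (b + \sum_(j < n) a j * g (w j))) =
  cos b * expR (- ((\sum_(j < n) a j ^+ 2) / 2)).
Proof.
have mg (t : R) : measurable_fun setT (fun s => t * g s).
  by apply: measurable_funM => //; exact: (@measurable_funPT _ _ _ _ g).
have bcos t : bounded_measurable (fun s => cos (t * g s)) by exact: bounded_measurable_cos.
have bsin t : bounded_measurable (fun s => sin (t * g s)).
  apply: (bounded_measurable_comp (h := sin)) => //; first exact: continuous_sin.
  by exists 1 => x; exact: sin_max.
have sinE x : sin x = cos (x - pi / 2) :> R by rewrite cosB cos_pihalf sin_pihalf mulr0 mulr1 add0r.
elim: n b => [|n IH] b.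
  rewrite big_ord0 mul0r oppr0 expR0 mulr1.
  by under eq_mean do rewrite big_ord0 addr0; rewrite mean_cst.
under eq_mean do rewrite big_ord_recr/= addrA cosD.
have pc b' := past_cos_sum PN_product n b' (fun j => mg (a j)).
have ps : past P PN n (fun w => sin (b + \sum_(j < n) a j * g (w j))).
  by under eq_fun do rewrite sinE addrAC; exact: pc.
rewrite meanB; last 2 first.
- have [bF _] := past_mul (pc b) (bcos (a n)); exact: bF.
- have [bF _] := past_mul ps (bsin (a n)); exact: bF.
rewrite (past_mean_mul (pc b) (bcos (a n))) (past_mean_mul ps (bsin (a n))) IH.
have -> : mean P (fun s => cos (a n * g s)) = expR (- (a n ^+ 2 / 2)).
  have := mean_cos_normal 0 (a n); rewrite cos0 mul1r => <-.
  by apply: eq_mean => s; rewrite add0r.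
have -> : mean P (fun s => sin (a n * g s)) = 0.
  have := mean_cos_normal (- (pi / 2)) (a n); rewrite cosN cos_pihalf mul0r => <-.
  by apply: eq_mean => s; rewrite sinE addrC.
by rewrite mulr0 subr0 -mulrA -expRD big_ord_recr/= mulrDl opprD.
Qed.

Variable f : nat -> S -> R.
Hypothesis bf : forall j, bounded_measurable (f j).

(** A Gaussian sequence with the covariance of [f] under [P]: independent normal
    variables, one for each coordinate of the sequence space, are combined with
    the Gram-Schmidt coefficients of [f]. *)
Definition gaussian_copy j (w : sequence_space S) : R :=
  \sum_(m < j.+1) mean P (fun s => f j s * orthonormalized P f m s) * g (w m).

Lemma measurable_gaussian_copy j : measurable_fun setT (gaussian_copy j).
Proof.
apply: measurable_sum => m; apply: measurable_funM => //.
apply: (measurableT_comp (f := g)) => //; exact: measurable_coordinate.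
Qed.

(** By [gram_schmidt_parseval] the variance of the combination is that of the
    combination of the [f j]. *)
Lemma gaussian_copy_cos M (idx : 'I_M -> nat) (a : 'I_M -> R) (b : R) :
  mean PN (fun w => cos (b + \sum_(l < M) a l * gaussian_copy (idx l) w)) =
  cos b * expR (- (mean P (fun s => (\sum_(l < M) a l * f (idx l) s) ^+ 2) / 2)).
Proof.
pose K := (\max_(l < M) idx l).+1.
have idxK l : (idx l < K)%N by rewrite ltnS leq_bigmax.
pose c (j : 'I_K) : R := \sum_(l < M | idx l == j) a l.
have collect (X : nat -> R) : \sum_(l < M) a l * X (idx l) = \sum_(j < K) c j * X j.
  rewrite (partition_big (fun l => Ordinal (idxK l)) predT)//=.
  apply: eq_bigr => j _; rewrite /c mulr_suml; apply: eq_big => [l|l /eqP <-//].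
  by rewrite -val_eqE.
have -> : mean P (fun s => (\sum_(l < M) a l * f (idx l) s) ^+ 2) =
    mean P (fun s => (\sum_(j < K) c j * f j s) ^+ 2).
  by apply: eq_mean => s; rewrite (collect (f ^~ s)).
rewrite gram_schmidt_parseval//.
pose al m := \sum_(j < K) c j * mean P (fun s => f j s * orthonormalized P f m s).
rewrite -(mean_cos_sum_normal K al b); apply: eq_mean => w; congr (cos (_ + _)).
rewrite (collect (gaussian_copy ^~ w)).
under eq_bigr => j _.
  rewrite /gaussian_copy (_ : \sum_(m < j.+1) _ =
      \sum_(m < K) mean P (fun s => f j s * orthonormalized P f m s) * g (w m)); last first.
    rewrite (big_ord_widen K (fun m => mean P (fun s => f j s * orthonormalized P f m s) * g (w m)))//.
    rewrite big_mkcond/=; apply: eq_bigr => m _; case: ifPn => //.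
    by rewrite -leqNgt => jm; rewrite dot_orthonormalized_gt// mul0r.
  rewrite mulr_sumr; over.
rewrite exchange_big/=; apply: eq_bigr => m _; rewrite /al mulr_suml.
by apply: eq_bigr => j _; rewrite mulrA.
Qed.

Hypothesis f0 : forall j, mean P (f j) = 0.
Hypothesis f1 : forall j s, `|f j s| <= 1.

(** The continuity theorem: the cosines converge by [clt_cos] applied to linear
    combinations, and the exponential tails of normalized sums give tightness
    uniformly in [n >= 4]. *)
Lemma finite_dimensional_clt M (idx : 'I_M -> nat) (h : ('I_M -> R) -> R) : bounded_lipschitz h ->
  mean PN (fun w => h (fun l => normalized_sum n (f (idx l)) w)) @[n --> \oo] -->
  mean PN (fun w => h (fun l => gaussian_copy (idx l) w)).
Proof.
move=> bh.
have mn n l : measurable_fun setT (normalized_sum n (f (idx l))).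
  by apply: measurable_normalized_sum; case: (bf (idx l)).
have mg l : measurable_fun setT (gaussian_copy (idx l)) by exact: measurable_gaussian_copy.
apply: (levy_continuity (M_ := fun n h => mean PN (fun w => h (fun l => normalized_sum n (f (idx l)) w)))
  (M := fun h => mean PN (fun w => h (fun l => gaussian_copy (idx l) w)))) bh => [n|||].
- exact: lipschitz_mean_vector.
- exact: lipschitz_mean_vector.
- move=> e e0.
  (* the tail bound of normalized sums, with exponent 1 and second moment at
     most 1 *)
  have [K1 K10 K1e] : exists2 K : R, 0 < K & 2 * expR (2 - K) <= e.
    exists (Num.max 1 (2 - ln (e / 2))); first by rewrite lt_max ltr01.
    have : expR (2 - Num.max 1 (2 - ln (e / 2))) <= e / 2.
      rewrite -[leRHS]lnK ?posrE ?divr_gt0// ler_expR lerBlDl -lerBlDr le_max.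
      by rewrite lexx orbT.
    by move=> h1; lra.
  have /choice[K2 hK2] : forall l, exists K : R, 0 < K /\ pr PN [set w | K < `|gaussian_copy (idx l) w|] <= e.
    by move=> l; have [K K0 hK] := real_tight PN (mg l) e0; exists K.
  pose K := K1 + \sum_(l < M) K2 l.
  have sK0 : 0 <= \sum_(l < M) K2 l by apply: sumr_ge0 => l _; apply: ltW; case: (hK2 l).
  have K1K : K1 <= K by rewrite lerDl.
  have K2K l : K2 l <= K.
    rewrite /K (bigD1 l)//= addrCA lerDl addr_ge0 ?(ltW K10)// sumr_ge0// => l' _.
    by apply: ltW; case: (hK2 l').
  exists K => [|l u bu u01 uK]; first exact: lt_le_trans K1K.
  split.
    exists 4%N => // n /= n4; have n0 : (0 < n)%N by exact: leq_trans n4.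
    apply: (le_trans (vector_tail_mean (X := fun l => normalized_sum n (f (idx l))) PN (mn n) bu u01 uK)).
    have s2 : 1 * 1 <= Num.sqrt n%:R / 2 :> R.
      rewrite mulr1 ler_pdivlMr// mul1r -[leLHS]ger0_norm// -sqrtr_sqr ler_sqrt// -natrX ler_nat.
      exact: n4.
    apply: (le_trans (normalized_sum_tail (l := 1) PN_product K n0 (bf _) (f0 _) (f1 _) _ s2)) => //.
    apply: le_trans K1e; rewrite ler_wpM2l// ler_expR expr1n mulr1 mul1r lerB//.
    have m1 : mean P (fun s => f (idx l) s ^+ 2) <= 1.
      rewrite -[leRHS](mean_cst P); apply: mean_le; last 1 first.
      - by move=> s; rewrite -real_normK ?num_real// expr_le1.
      - exact: (bounded_measurableM (bf (idx l)) (bf (idx l))).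
      - exact: bounded_measurable_cst.
    by rewrite -[leRHS]mulr1 ler_wpM2l.
  apply: (le_trans (vector_tail_mean (X := fun l => gaussian_copy (idx l)) PN mg bu u01 uK)).
  have [_ h2] := hK2 l; apply: le_trans h2; apply: pr_le.
  - exact: measurable_gt_norm.
  - exact: measurable_gt_norm.
  - by move=> w /=; apply: le_lt_trans.
- move=> a b; rewrite gaussian_copy_cos.
  have bF : bounded_measurable (fun s => \sum_(l < M) a l * f (idx l) s).
    by apply: bounded_measurable_sum => l; exact: bounded_measurableZ.
  have F0 : mean P (fun s => \sum_(l < M) a l * f (idx l) s) = 0.
    rewrite mean_sum => [|l]; last exact: bounded_measurableZ.
    by rewrite big1// => l _; rewrite meanZ// f0 mulr0.
  have := clt_cos (b := b) PN_product bF F0.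
  apply: cvg_trans; apply: near_eq_cvg; near=> n; apply: eq_mean => w.
  congr (cos (_ + _)); rewrite /normalized_sum; under [in RHS]eq_bigr do rewrite mulrCA mulr_sumr.
  by rewrite -mulr_sumr exchange_big.
Unshelve. all: by end_near. Qed.

(** Two-point tail bounds pass from the normalized sums to their Gaussian limit,
    at the price of doubling the threshold, which makes room for a Lipschitz test. *)
Lemma gaussian_copy_tail i j (t q : R) : 0 < t ->
  (\forall n \near \oo, pr PN [set w | t < `|normalized_sum n (f i) w - normalized_sum n (f j) w|] <= q) ->
  pr PN [set w | 2 * t < `|gaussian_copy i w - gaussian_copy j w|] <= q.
Proof.
move=> t0 hq.
pose idx (l : 'I_2) := if l == ord0 then i else j.
pose dd (v : 'I_2 -> R) := `|v ord0 - v ord_max|.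
pose clip (x : R) : R := 1 - Num.max 0 (1 - Num.max 0 x).
have clip01 x : 0 <= clip x <= 1.
  by rewrite subr_ge0 gerBl le_max lexx andbT ge_max ler01 gerBl le_max lexx.
have clip_lip x y : `|clip x - clip y| <= `|x - y|.
  rewrite /clip opprB addrC subrKA; apply: (le_trans (max0_dist_le _ _)).
  by rewrite (_ : _ - _ = Num.max 0 x - Num.max 0 y); [exact: max0_dist_le|ring].
pose h (v : 'I_2 -> R) := clip (t^-1 * (dd v - t)).
have dd_lip v v' : `|dd v - dd v'| <= l1_dist v v'.
  rewrite /dd /l1_dist !big_ord_recl big_ord0 addr0.
  apply: (le_trans (ler_dist_dist _ _)).
  rewrite (_ : _ - _ = (v ord0 - v' ord0) - (v ord_max - v' ord_max)); last by ring.
  rewrite (_ : lift ord0 ord0 = ord_max); last exact: val_inj.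
  by rewrite (le_trans (ler_normB _ _)).
have bh : bounded_lipschitz h.
  split; first by exists 1 => v; have /andP[h0 h1] := clip01 (t^-1 * (dd v - t)); rewrite ger0_norm.
  exists t^-1 => v v'; apply: (le_trans (clip_lip _ _)).
  rewrite -mulrBr normrM gtr0_norm ?invr_gt0// ler_wpM2l ?invr_ge0 ?(ltW t0)//.
  by rewrite (_ : _ - _ = dd v - dd v'); [exact: dd_lip|ring].
have cv := finite_dimensional_clt (idx := idx) bh.
have mn n : measurable [set w | t < `|normalized_sum n (f i) w - normalized_sum n (f j) w|].
  apply: measurable_gt_norm; apply: measurable_funB; apply: measurable_normalized_sum.
    by case: (bf i).
  by case: (bf j).
have mgg : measurable [set w | 2 * t < `|gaussian_copy i w - gaussian_copy j w|].
  by apply: measurable_gt_norm; apply: measurable_funB; exact: measurable_gaussian_copy.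
apply: (@le_trans _ _ (mean PN (fun w => h (fun l => gaussian_copy (idx l) w)))).
  rewrite -mean_indic//; apply: mean_le.
  - exact: bounded_measurable_indic.
  - by apply: bounded_lipschitz_measurable => // l; exact: measurable_gaussian_copy.
  - move=> w; rewrite indicE; case: (boolP (w \in _)) => [|_]; last by case/andP: (clip01 (t^-1 * (dd (fun l => gaussian_copy (idx l) w) - t))).
    rewrite inE/= => hw; rewrite /h /clip (_ : Num.max 0 (1 - _) = 0) ?subr0//.
    apply/max_idPl; rewrite subr_le0 le_max; apply/orP; right.
    by rewrite ler_pdivlMl// mulr1 /dd/= lerBrDl -mulr2n -mulr_natl ltW.
apply: (cvgr_to_le cv); near=> n.
apply: (@le_trans _ _ (pr PN [set w | t < `|normalized_sum n (f i) w - normalized_sum n (f j) w|])); last first.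
  by near: n.
rewrite -mean_indic//; apply: mean_le.
- by apply: bounded_lipschitz_measurable => // l; apply: measurable_normalized_sum; case: (bf (idx l)).
- exact: bounded_measurable_indic.
- move=> w; rewrite indicE; case: (boolP (w \in _)) => [_|].
    by case/andP: (clip01 (t^-1 * (dd (fun l => normalized_sum n (f (idx l)) w) - t))).
  rewrite notin_setE/= => /negP; rewrite -leNgt => hw; rewrite /h /clip.
  have -> : Num.max 0 (t^-1 * (dd (fun l => normalized_sum n (f (idx l)) w) - t)) = 0.
    by apply/max_idPl; rewrite pmulr_rle0 ?invr_gt0// subr_le0.
  by rewrite subr0 (_ : Num.max 0 1 = 1) ?subrr//; apply/max_idPr.
Unshelve. all: by end_near. Qed.

End gaussian_sequence.

Section measurability_by_lower_sets.
Context {R : realType} {d : measure_display} {T : measurableType d}.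

Lemma measurable_fun_le (f : T -> R) : (forall a, measurable [set w | f w <= a]) ->
  measurable_fun setT f.
Proof.
move=> h; apply: measurable_fun_lt => a.
rewrite (_ : [set w | _] = \bigcup_m [set w | f w <= a - m.+1%:R^-1]).
  exact: bigcupT_measurable.
apply/seteqP; split => [w /= fa|w [m _ /=] fa]; last first.
  by apply: (le_lt_trans fa); rewrite ltrBlDr ltrDl invr_gt0.
have h0 : 0 < a - f w by rewrite subr_gt0.
exists (Num.truncn (a - f w)^-1) => //=; rewrite lerBrDl -lerBrDr.
by rewrite invf_ple ?posrE//; exact: ltW (Num.Theory.truncnS_gt _).
Qed.

End measurability_by_lower_sets.

(** * Construction of the limit process *)

Section step_functions.
Context {R : realType} {I : Type}.
Variables (p : nat -> I -> nat) (N : nat -> nat).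

Definition step_fun k (v : nat -> R) (i : I) : R := if (p k i < N k)%N then v (p k i) else 0.

Lemma step_subproof k v : step_fun k v \in bounded_functions.
Proof.
apply/bounded_functionsP; exists (\sum_(c < N k) `|v c|) => i; rewrite /step_fun.
case: ifPn => [pk|_]; last by rewrite normr0 sumr_ge0.
by rewrite (bigD1 (Ordinal pk))//= lerDl sumr_ge0.
Qed.

(** The value [0] outside the first [N k] cells makes these functions bounded
    for every [v]. *)
Definition step k v : linf I R := SigSub (step_subproof k v).

Lemma stepE k v i : (p k i < N k)%N -> \val (step k v) i = v (p k i).
Proof. by move=> h; rewrite /= /step_fun h. Qed.

Lemma step_dist_le k v v' : `|step k v - step k v'| <= \sum_(c < N k) `|v c - v' c|.
Proof.
apply: linf_dist_le => [|i]; first exact: sumr_ge0.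
rewrite /= /step_fun; case: ifPn => [pk|_]; last by rewrite subrr normr0 sumr_ge0.
by rewrite (bigD1 (Ordinal pk))//= lerDl sumr_ge0.
Qed.

Lemma step_sum k v : step k v = \sum_(c < N k) v c *: step k (fun c' => (c' == c)%:R).
Proof.
apply/val_inj/funext => i.
have valS (F : 'I_(N k) -> linf I R) : \val (\sum_(c < N k) F c) i = \sum_(c < N k) \val (F c) i.
  by elim/big_rec2: _ => // c x y _ <-.
rewrite valS /= /step_fun.
transitivity (\sum_(c < N k) v c * (if (p k i < N k)%N then (p k i == c)%:R else 0)); last by [].
case: ifPn => [pk|_]; last by rewrite big1// => c _; rewrite mulr0.
rewrite (bigD1 (Ordinal pk))//= eqxx mulr1 big1 ?addr0// => c ck.
by rewrite eq_sym -val_eqE/= in ck; rewrite (negbTE ck) mulr0.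
Qed.

End step_functions.

Section limit_process.
Context {R : realType} {d : measure_display} {S : measurableType d}.
Variables (P : probability S R) (PN : probability (sequence_space S) R).
Hypothesis PN_product : is_infinite_product P PN.
Context {I : Type}.
Variables (C : I -> set S) (L U : nat -> nat -> set S) (p : nat -> I -> nat).
Variables (N : nat -> nat) (D A Q : R).
Hypothesis brackets : bracketing P C L U p N D A Q.
Variable g : {mfun S >-> measurableTypeR R}.
Hypothesis g_normal : forall B, measurable B -> distribution P g B = normal_prob 0 1 B.

Let mL k c : measurable (L k c). Proof. by have [_ []] := brackets. Qed.
Let pN k i : (p k i < N k)%N. Proof. by have [_ _ h _ _] := brackets; have [] := h k i. Qed.

(** The countably many lower brackets are orthonormalized as one sequence, so
    that the Gaussian values of all levels are jointly Gaussian. *)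
Definition bracket_seq j : set S := oapp (fun kc : nat * nat => L kc.1 kc.2) set0 (unpickle j).

Definition bracket_indic j : S -> R := centered_indic P (bracket_seq j).

Lemma bracket_indicE k c : bracket_indic (pickle (k, c)) = centered_indic P (L k c).
Proof. by rewrite /bracket_indic /bracket_seq pickleK. Qed.

Let measurable_bracket_seq j : measurable (bracket_seq j).
Proof. by rewrite /bracket_seq; case: unpickle => [[k c]|]//=. Qed.

Lemma bounded_measurable_bracket_indic j : bounded_measurable (bracket_indic j).
Proof. exact: bounded_measurable_centered_indic. Qed.

Let bi := bounded_measurable_bracket_indic.

Lemma bracket_indic_mean j : mean P (bracket_indic j) = 0.
Proof. exact: mean_centered_indic. Qed.

Lemma bracket_indic_le1 j s : `|bracket_indic j s| <= 1.
Proof. exact: centered_indic_le1. Qed.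

Definition gaussian_value (k c : nat) (w : sequence_space S) : R := gaussian_copy P g bracket_indic (pickle (k, c)) w.

Lemma measurable_gaussian_value k c : measurable_fun setT (gaussian_value k c).
Proof. exact: measurable_gaussian_copy. Qed.

Let mgv := measurable_gaussian_value.

(** The tail bounds of the empirical process pass to the limit [n = oo], where
    no restriction [16^k <= n] remains: chaining never stops. *)
Lemma gaussian_value_tail k c c' : linked p k c c' ->
  pr PN [set w | 2 * (2 ^+ k)^-1 < `|gaussian_value k.+1 c' w - gaussian_value k c w|] <= link_bound D k.
Proof.
move=> cc'; apply: (gaussian_copy_tail PN_product g_normal bi bracket_indic_mean bracket_indic_le1).
  by rewrite invr_gt0 exprn_gt0.
exists (16 ^ k)%N => // n /= kn; rewrite !bracket_indicE.
exact: (linked_tail PN_product brackets).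
Qed.

Definition link_failure k : set (sequence_space S) :=
  \big[setU/set0]_(c < N k) \big[setU/set0]_(c' < N k.+1 | linked p k c c')
     [set w | 2 * (2 ^+ k)^-1 < `|gaussian_value k.+1 c' w - gaussian_value k c w|].

Let measurable_link_failure k : measurable (link_failure k).
Proof.
apply: measurable_bigsetU_seq => c _; apply: measurable_bigsetU_seq => c' _.
by apply: measurable_gt_norm; exact: measurable_funB.
Qed.

Definition late_failure K : set (sequence_space S) := \bigcup_j link_failure (K + j).

Lemma measurable_late_failure K : measurable (late_failure K).
Proof. exact: bigcup_measurable. Qed.

Lemma late_failure_pr : exists2 B : R, 0 <= B & forall K, pr PN (late_failure K) <= B / 2 ^+ K.
Proof.
have [B B0 hB] := link_bound_summable brackets.
exists (2 * B) => [|K]; first exact: mulr_ge0.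
apply: pr_bigcup_le => // n.
apply: (@le_trans _ _ (\sum_(j < n) (2 * B / 2 ^+ K) / 2 ^+ j.+1)); last first.
  by apply: sum_half_powers_le; rewrite divr_ge0 ?exprn_ge0// mulr_ge0.
apply: ler_sum => j _; apply: (@le_trans _ _ (B / 2 ^+ (K + j))); last first.
  rewrite exprD exprS le_eqVlt; apply/orP; left; apply/eqP; field.
  by rewrite !expf_neq0.
move: (K + j)%N => k; apply: le_trans (hB _).
have lb0 : 0 <= link_bound D k by rewrite mulr_ge0// expR_ge0.
apply: (@le_trans _ _ (\sum_(c < N k) (N k.+1)%:R * link_bound D k)).
  apply: le_trans (pr_bigU_le _ _ _) _ => [c _|].
    apply: measurable_bigsetU_seq => c' _.
    by apply: measurable_gt_norm; exact: measurable_funB.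
  apply: ler_sum => c _; apply: le_trans (pr_bigU_le _ _ _) _ => [c' _|].
    by apply: measurable_gt_norm; exact: measurable_funB.
  rewrite big_mkcond/=; apply: (@le_trans _ _ (\sum_(c' < N k.+1) link_bound D k)).
    by apply: ler_sum => c' _; case: ifP => // cc'; exact: gaussian_value_tail.
  by rewrite sumr_const card_ord -[_ *+ _]mulr_natl.
rewrite sumr_const card_ord -[_ *+ _]mulr_natl mulrA -natrM ler_wpM2r// ler_nat.
exact: leq_addr.
Qed.

Definition divergence : set (sequence_space S) := \bigcap_K late_failure K.

Lemma measurable_divergence : measurable divergence.
Proof. apply: bigcap_measurable => // k _; exact: measurable_late_failure. Qed.

Lemma divergence_pr : pr PN divergence = 0.
Proof.
have [B B0 hB] := late_failure_pr.
apply/eqP; rewrite eq_le pr_ge0 andbT; apply/ler_addgt0Pr => e e0; rewrite add0r.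
pose K := (Num.truncn (B / e)).+1.
apply: (@le_trans _ _ (B / 2 ^+ K)).
  apply: le_trans (hB K); apply: pr_le.
  - exact: measurable_divergence.
  - exact: measurable_late_failure.
  - by move=> w; apply.
rewrite ler_pdivrMr ?exprn_gt0// mulrC -ler_pdivrMr//.
apply: (@le_trans _ _ K%:R); first exact: ltW (Num.Theory.truncnS_gt _).
by rewrite -natrX ler_nat ltnW// ltn_expl.
Qed.

(** On the null event of divergence the step functions are set to [0], so that
    they converge everywhere; their limit is then measurable without completing
    the sigma-algebra. *)
Definition gaussian_step k w : linf I R :=
  step p N k (fun c => \1_(~` divergence) w * gaussian_value k c w).

Definition gaussian_limit w : linf I R := lim (gaussian_step k w @[k --> \oo]).

Let link_step k w : ~ link_failure k w ->
  `|gaussian_step k.+1 w - gaussian_step k w| <= 2 / 2 ^+ k.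
Proof.
move=> nf; apply: linf_dist_le => [|i]; first by rewrite divr_ge0// exprn_ge0.
rewrite !stepE// -mulrBr normrM.
have i1 : `|\1_(~` divergence) w| <= 1 :> R.
  by rewrite indicE; case: (_ \in _); rewrite ?normr1// normr0.
apply: (@le_trans _ _ (1 * `|gaussian_value k.+1 (p k.+1 i) w - gaussian_value k (p k i) w|)).
  exact: ler_wpM2r.
rewrite mul1r leNgt; apply/negP => h; apply: nf.
rewrite /link_failure (bigD1 (Ordinal (pN k i)))//=; left.
rewrite (bigD1 (Ordinal (pN k.+1 i)))/=; last by apply/asboolP; exists i.
by left.
Qed.

Let late_step K k j w : ~ late_failure K w -> (K <= k)%N ->
  `|gaussian_step (k + j) w - gaussian_step k w| <= 4 / 2 ^+ k - 4 / 2 ^+ (k + j).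
Proof.
move=> nK Kk; elim: j => [|j IH]; first by rewrite addn0 !subrr normr0.
have h : `|gaussian_step (k + j).+1 w - gaussian_step (k + j) w| <= 2 / 2 ^+ (k + j).
  apply: link_step => hf; apply: nK; exists (k + j - K)%N => //.
  by rewrite subnKC// (leq_trans Kk)// leq_addr.
rewrite addnS; apply: (le_trans (ler_distD (gaussian_step (k + j) w) _ _)).
have E : 4 / 2 ^+ (k + j).+1 = 2 / 2 ^+ (k + j) :> R.
  by rewrite exprS; field; rewrite expf_neq0.
have E2 : 4 / 2 ^+ (k + j) = 2 / 2 ^+ (k + j) + 2 / 2 ^+ (k + j) :> R by rewrite -mulrDl -natrD.
by rewrite E; rewrite E2 in IH; lra.
Qed.

Let late_step_le K k j w : ~ late_failure K w -> (K <= k)%N ->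
  `|gaussian_step (k + j) w - gaussian_step k w| <= 4 / 2 ^+ k.
Proof.
by move=> h1 h2; apply: (le_trans (late_step j h1 h2)); rewrite gerBl divr_ge0// exprn_ge0.
Qed.

Let gaussian_step_null w : divergence w -> forall k, gaussian_step k w = 0.
Proof.
move=> dw k; apply/val_inj/funext => i; rewrite stepE//= indicE memNset ?mul0r//.
Qed.

Lemma cvg_gaussian_step w : gaussian_step k w @[k --> \oo] --> gaussian_limit w.
Proof.
suff h : cvg (gaussian_step k w @[k --> \oo]) by exact: h.
have [dw|] := pselect (divergence w).
  under eq_fun do rewrite gaussian_step_null//; exact: is_cvg_cst.
move=> /existsNP[K /not_implyP[_ nK]].
apply: linf_complete; apply: cauchy_exP => e e0.
pose m := (K + (Num.truncn (4 / e)).+1)%N.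
exists (gaussian_step m w); exists m => // k /= mk; rewrite -ball_normE/= distrC -(subnKC mk).
apply: (le_lt_trans (late_step_le _ nK (leq_addr _ _))).
rewrite ltr_pdivrMr ?exprn_gt0// mulrC -ltr_pdivrMr//.
apply: (lt_le_trans (Num.Theory.truncnS_gt _)).
by rewrite -natrX ler_nat (leq_trans (leq_addl K _))// ltnW// ltn_expl.
Qed.

Lemma gaussian_limit_dist K k w : ~ late_failure K w -> (K <= k)%N ->
  `|gaussian_limit w - gaussian_step k w| <= 4 / 2 ^+ k.
Proof.
move=> nK Kk.
have cl : closed [set z : linf I R | `|z - gaussian_step k w| <= 4 / 2 ^+ k].
  exact: closed_dist_le.
apply: (closed_cvg _ cl _ (gaussian_limit w) (@cvg_gaussian_step w)).
by exists k => // j /= kj; rewrite -(subnKC kj); exact: late_step_le nK Kk.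
Qed.

(** The uniform distance of two step functions is a supremum over the countably
    many pairs of cells that share an index, whatever the size of the index
    set. *)
Let measurable_step_dist k k' (v v' : nat -> sequence_space S -> R) :
  (forall c, measurable_fun setT (v c)) -> (forall c, measurable_fun setT (v' c)) ->
  measurable_fun setT (fun w => `|step p N k (v ^~ w) - step p N k' (v' ^~ w)|).
Proof.
move=> mv mv'; apply: measurable_fun_le => a.
have [a0|a0] := ltP a 0.
  rewrite [X in measurable X](_ : _ = set0)//; apply/seteqP; split => // w /= h.
  by have := le_lt_trans h a0; rewrite normr_lt0.
pose compat c c' := exists i, p k i = c /\ p k' i = c'.
have -> : [set w | `|step p N k (v ^~ w) - step p N k' (v' ^~ w)| <= a] =
    \bigcap_c \bigcap_c' [set w | compat c c' -> `|v c w - v' c' w| <= a].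
  apply/seteqP; split => [w /= h c _ c' _ /= [i [<- <-]]|w h /=].
    have := linf_dist_coord (step p N k (v ^~ w)) (step p N k' (v' ^~ w)) i.
    by rewrite !stepE// => /le_trans; apply.
  apply: linf_dist_le => // i; rewrite !stepE//; apply: (h _ Logic.I _ Logic.I); by exists i.
apply: bigcapT_measurable => c; apply: bigcapT_measurable => c'.
have [cc|cc] := pselect (compat c c'); last first.
  by rewrite [X in measurable X](_ : _ = setT)//; apply/seteqP; split => // w _ /= /cc.
rewrite [X in measurable X](_ : _ = ~` [set w | a < `|v c w - v' c' w|]); last first.
  by apply/seteqP; split => w /=; [move/(_ cc) => h /(le_lt_trans h); rewrite ltxx|move/negP; rewrite -leNgt].
by apply: measurableC; apply: measurable_gt_norm; exact: measurable_funB.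
Qed.

(** A countable family whose closure contains all the values of the limit
    process: the whole space of bounded functions is not separable. *)
Definition rational_step j : linf I R :=
  let kq := odflt (0%N, [::]) (unpickle j) : nat * seq rat in
  step p N kq.1 (fun c => ratr (nth 0 kq.2 c)).

Lemma rational_step_dense w (e : R) : 0 < e -> exists j, `|gaussian_limit w - rational_step j| < e.
Proof.
move=> e0; have e2 : 0 < e / 2 by rewrite divr_gt0.
have /cvgrPdist_lt/(_ _ e2)[k _ /(_ k (leqnn k)) /= hk] := @cvg_gaussian_step w.
set v := fun c => \1_(~` divergence) w * gaussian_value k c w.
have [q hq] := l1_dist_rat (fun c : 'I_(N k) => v c) e2.
pose s := mkseq (fun c => oapp q 0 (insub c)) (N k).
exists (pickle (k, s)); rewrite /rational_step pickleK/=.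
rewrite [e]splitr; apply: (le_lt_trans (ler_distD (gaussian_step k w) _ _)); apply: ltrD => //.
apply: (le_lt_trans _ hq); apply: (le_trans (step_dist_le _ _ _ _ _)).
by apply: ler_sum => c _; rewrite /s nth_mkseq// valK.
Qed.

Lemma measurable_gaussian_limit :
  measurable_fun setT (gaussian_limit : sequence_space S -> borelType (linf I R)).
Proof.
apply: (measurable_to_borel (c := rational_step)) => [|j]; first exact: rational_step_dense.
apply: (measurable_fun_cvg (h := fun k w => `|gaussian_step k w - rational_step j|)) => [k|w _].
  apply: (measurable_step_dist _ _ (v := fun c w => \1_(~` divergence) w * gaussian_value k c w)
    (v' := fun c w => _)) => c //.
  apply: measurable_funM => //; apply: measurable_indic; apply: measurableC; exact: measurable_divergence.
apply: cvg_norm; apply: cvgB; [exact: cvg_gaussian_step|exact: cvg_cst].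
Qed.

End limit_process.

(** * Gaussian laws as limits *)

Section measurable_functions_as_random_variables.
Context {d d' : measure_display} {T : measurableType d} {U : measurableType d'}.

(** The function itself, under a name to which the measurability proof is
    attached. *)
Definition mfun_of (f : T -> U) (mf : measurable_fun setT f) : T -> U := f.

HB.instance Definition _ (f : T -> U) (mf : measurable_fun setT f) :=
  isMeasurableFun.Build _ _ _ _ (mfun_of mf) mf.

End measurable_functions_as_random_variables.

Section gaussian_limits.
Context {R : realType} {d : measure_display} {T : measurableType d}.
Variable P : probability T R.

Lemma mean_dist_off (F G : T -> R) (E : set T) (K e : R) :
  bounded_measurable F -> bounded_measurable G -> measurable E -> 0 <= e ->
  (forall w, `|F w| <= K) -> (forall w, `|G w| <= K) ->
  (forall w, ~ E w -> `|F w - G w| <= e) ->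
  `|mean P F - mean P G| <= e + 2 * K * pr P E.
Proof.
move=> bF bG mE e0 FK GK FG.
have bE := bounded_measurable_indic (R := R) mE.
have bH : bounded_measurable (fun w => e + 2 * K * \1_E w).
  apply: bounded_measurableD; first exact: bounded_measurable_cst.
  exact: bounded_measurableZ.
have mH : mean P (fun w => e + 2 * K * \1_E w) = e + 2 * K * pr P E.
  rewrite meanD ?mean_cst ?meanZ ?mean_indic//; first exact: bounded_measurable_cst.
  exact: bounded_measurableZ.
have h w : `|F w - G w| <= e + 2 * K * \1_E w.
  rewrite indicE; case: (boolP (w \in E)) => [_|].
    rewrite mulr1 (le_trans (ler_normB _ _))//.
    by rewrite mulr_natl mulr2n -[leLHS]add0r lerD// lerD.
  by rewrite notin_setE => /FG; rewrite mulr0 addr0.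
rewrite -mH -meanB// ler_norml; apply/andP; split.
  rewrite -[leLHS]mulN1r -meanZ//; apply: mean_le => [||w]; [exact: bounded_measurableZ|exact: bounded_measurableB|].
  by rewrite mulN1r; have := h w; rewrite ler_norml => /andP[].
apply: mean_le => [||w]; [exact: bounded_measurableB|by []|].
by have := h w; rewrite ler_norml => /andP[].
Qed.

(** Limits of centered Gaussian variables are centered Gaussian: the variances
    converge because the characteristic function of the limit does not vanish
    near the origin. *)
Lemma centered_gaussian_law_cvg (X : nat -> T -> R) (Y : T -> R) (v : nat -> R) :
  (forall k, measurable_fun setT (X k)) -> measurable_fun setT Y ->
  (forall w, X k w @[k --> \oo] --> Y w) -> (forall k, 0 <= v k) ->
  (forall k b t, mean P (fun w => cos (b + t * X k w)) = cos b * expR (- (t ^+ 2 * v k / 2))) ->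
  centered_gaussian_law (fun B => P (Y @^-1` B)).
Proof.
move=> mX mY XY v0 cX.
have mlin (Z : T -> R) (b t : R) : measurable_fun setT Z -> measurable_fun setT (fun w => b + t * Z w).
  by move=> mZ; apply: measurable_funD => //; apply: measurable_funM.
have mcos (Z : T -> R) (b t : R) : measurable_fun setT Z -> measurable_fun setT (fun w => cos (b + t * Z w)).
  by move=> mZ; case: (bounded_measurable_cos (mlin Z b t mZ)).
have cos1 (x : R) : `|cos x| <= 1 by exact: cos_max.
have cvX b t : cos b * expR (- (t ^+ 2 * v k / 2)) @[k --> \oo] --> mean P (fun w => cos (b + t * Y w)).
  under eq_fun do rewrite -cX.
  apply: (mean_dominated (M := 1)) => [k||//|]; [exact: mcos|exact: mcos|].
  apply: aeW => w /=; apply: (continuous_cvg _ (h := cos) (f := fun n => b + t * X n w)); first exact: continuous_cos.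
  by apply: cvgD; [exact: cvg_cst|apply: cvgMr; exact: XY].
have [m hm] : exists m : nat, 1 / 2 <= mean P (fun w => cos (0 + m.+1%:R^-1 * Y w)).
  have c1 : mean P (fun w => cos (0 + m.+1%:R^-1 * Y w)) @[m --> \oo] --> (1 : R).
    rewrite -[X in _ --> X](mean_cst P).
    apply: (mean_dominated (M := 1)) => [k||//|]; [exact: mcos|exact: measurable_cst|].
    apply: aeW => w; rewrite -[X in _ --> X]cos0; apply: (continuous_cvg _ (h := cos) (f := fun m => 0 + m.+1%:R^-1 * Y w)); first exact: continuous_cos.
    rewrite -[X in _ --> X](addr0 0); apply: cvgD; first exact: cvg_cst.
    by rewrite -(mul0r (Y w)); apply: cvgMl; exact: cvg_harmonic.
  have h2 : (1 / 2 : R) < 1 by lra.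
  have [m _ /(_ m (leqnn m)) /= hm] := cvgr_gt _ c1 _ h2.
  by exists m; exact: ltW.
set t0 : R := m.+1%:R^-1 in hm; have t00 : 0 < t0 by rewrite invr_gt0.
set l := mean P _ in hm; have l0 : 0 < l by lra.
pose v' : R := - (2 / t0 ^+ 2) * ln l.
have vE k : v k = - (2 / t0 ^+ 2) * ln (cos 0 * expR (- (t0 ^+ 2 * v k / 2))).
  rewrite cos0 mul1r expRK; field; exact: lt0r_neq0.
have vv' : v k @[k --> \oo] --> v'.
  under eq_fun do rewrite vE; apply: cvgMr.
  apply: (@continuous_cvg _ _ _ _ _ (fun k => cos 0 * expR (- (t0 ^+ 2 * v k / 2))) (@ln R) l); first exact: continuous_ln.
  exact: cvX.
have v'0 : 0 <= v' by apply: (cvgr_to_ge vv'); near=> k; exact: v0.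
have cY b t : mean P (fun w => cos (b + t * Y w)) = cos b * expR (- (t ^+ 2 * v' / 2)).
  apply: (cvg_unique _ (cvX b t)) => //; apply: cvgMr.
  apply: (continuous_cvg _ (h := expR) (f := fun k => - (t ^+ 2 * v k / 2))); first exact: continuous_expR.
  by apply: cvgN; apply: cvgMl; apply: cvgMr.
pose Ym : {mfun T >-> measurableTypeR R} := mfun_of (mY : measurable_fun setT (Y : T -> measurableTypeR R)).
have bcos (b t : R) : @bounded_measurable R _ (measurableTypeR R) (fun x => cos (b + t * x)).
  by apply: bounded_measurable_cos; apply: measurable_funD.
have law b t : mean (distribution P Ym) (fun x : measurableTypeR R => cos (b + t * x)) =
    cos b * expR (- (t ^+ 2 * v' / 2)).
  by rewrite mean_distribution.
exists (Num.sqrt v') => [|B mB]; first exact: sqrtr_ge0.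
case: ifPn => [s0|s0].
  have v'00 : v' = 0 by apply/eqP; rewrite eq_le v'0 andbT -sqrtr_eq0.
  apply: (law_unique_cos (mu := distribution P Ym) (nu := \d_(0 : measurableTypeR R))) => // b t.
  rewrite law v'00 mulr0 mul0r oppr0 expR0 mulr1 /mean /Rintegral integral_dirac//.
    by rewrite diracT mul1e/= mulr0 addr0.
  by apply/measurable_EFinP; case: (bcos b t).
apply: (law_unique_cos (mu := distribution P Ym) (nu := normal_prob 0 (Num.sqrt v'))) => // b t.
by rewrite law normal_prob_cos// sqr_sqrtr.
Unshelve. all: by end_near. Qed.

End gaussian_limits.

Section gaussian_limit_law.
Context {R : realType} {d : measure_display} {S : measurableType d}.
Variables (P : probability S R) (PN : probability (sequence_space S) R).
Hypothesis PN_product : is_infinite_product P PN.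
Context {I : Type}.
Variables (C : I -> set S) (L U : nat -> nat -> set S) (p : nat -> I -> nat).
Variables (N : nat -> nat) (D A Q : R).
Hypothesis brackets : bracketing P C L U p N D A Q.
Variable g : {mfun S >-> measurableTypeR R}.
Hypothesis g_normal : forall B, measurable B -> distribution P g B = normal_prob 0 1 B.

Local Notation glim := (gaussian_limit P L p N g).
Local Notation gstep := (gaussian_step P L p N g).
Local Notation gval := (gaussian_value P L g).

Let bi : forall j, bounded_measurable (bracket_indic P L j).
Proof. by move=> j; exact: (bounded_measurable_bracket_indic brackets). Qed.

Let mgval k c : measurable_fun setT (gval k c).
Proof. exact: measurable_gaussian_value. Qed.

Let measurable_off : measurable_fun setT (\1_(~` divergence P L p N g) : _ -> R).
Proof. by apply: measurable_indic; apply: measurableC; exact: measurable_divergence. Qed.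

Lemma measurable_continuous_glim (F : linf I R -> R) : continuous F ->
  measurable_fun setT (fun w => F (glim w)).
Proof.
move=> cF; apply: (measurableT_comp (f := (F : borelType (linf I R) -> R)) (g := glim)).
  exact: continuous_borel_measurable.
exact: (measurable_gaussian_limit brackets).
Qed.

(** A linear functional of a step function is a linear combination of finitely
    many jointly Gaussian values. *)
Lemma gaussian_limit_linear (F : {linear linf I R -> R^o}) : continuous F ->
  centered_gaussian_law (fun B => PN ((fun w => F (glim w)) @^-1` B)).
Proof.
move=> cF.
pose a k (c : 'I_(N k)) : R := F (step p N k (fun c' => (c' == c)%:R)).
pose idx k (c : 'I_(N k)) : nat := pickle (k, c : nat).
have XE k w : F (gstep k w) = \1_(~` divergence P L p N g) w * \sum_(c < N k) a k c * gval k c w.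
  rewrite /gaussian_step step_sum linear_sum mulr_sumr; apply: eq_bigr => c _.
  by rewrite linearZ/= /a -[_ *: _]/(_ * _); ring.
have mS k : measurable_fun setT (fun w => \sum_(c < N k) a k c * gval k c w).
  by apply: measurable_sum => c; apply: measurable_funM.
have mX k : measurable_fun setT (fun w => F (gstep k w)).
  by rewrite (funext (XE k)); exact: measurable_funM.
apply: (centered_gaussian_law_cvg (X := fun k w => F (gstep k w)) (v := fun k =>
    mean P (fun s => (\sum_(c < N k) a k c * bracket_indic P L (idx k c) s) ^+ 2))) => //.
- exact: measurable_continuous_glim.
- move=> w; apply: (continuous_cvg _ (h := F) (f := fun k => gstep k w)); first exact: cF.
  exact: (cvg_gaussian_step brackets).
- by move=> k; apply: mean_ge0 => s; exact: sqr_ge0.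
move=> k b t.
have cl (Z : sequence_space S -> R) : measurable_fun setT Z -> bounded_measurable (fun w => cos (b + t * Z w)).
  by move=> mZ; apply: bounded_measurable_cos; apply: measurable_funD => //; apply: measurable_funM.
transitivity (mean PN (fun w => cos (b + t * \sum_(c < N k) a k c * gval k c w))).
  apply/eqP; rewrite -subr_eq0 -normr_le0.
  have mD : measurable (divergence P L p N g) by exact: measurable_divergence.
  have c1 (x : R) : `|cos x| <= 1 by exact: cos_max.
  apply: (le_trans (@mean_dist_off _ _ _ PN _ _ _ 1 0 (cl _ (mX k)) (cl _ (mS k)) mD _ _ _ _)) => //.
    move=> w nd; rewrite XE indicE mem_set// mul1r subrr normr0//.
  by rewrite (divergence_pr PN_product brackets g_normal) mulr0 addr0.
under eq_mean do rewrite mulr_sumr.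
under eq_mean do under eq_bigr do rewrite mulrA.
rewrite (gaussian_copy_cos PN_product g_normal bi (idx k) (fun c => t * a k c) b).
congr (_ * expR (- (_ / 2))).
have bs : bounded_measurable (fun s => \sum_(c < N k) a k c * bracket_indic P L (idx k c) s).
  by apply: bounded_measurable_sum => c; exact: bounded_measurableZ.
rewrite -meanZ; last exact: (bounded_measurableM bs bs).
apply: eq_mean => s; rewrite -exprMn mulr_sumr; congr (_ ^+ 2).
by apply: eq_bigr => c _; rewrite mulrA.
Qed.

End gaussian_limit_law.

(** * Upper expectations and Lipschitz minorants *)

Section upper_expectations.
Context {R : realType} {d : measure_display} {T : measurableType d}.
Variable P : probability T R.
Implicit Types phi psi : T -> R.

Lemma upper_expectation_le phi psi : bounded_measurable psi -> (forall w, phi w <= psi w) ->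
  (upper_expectation P phi <= (mean P psi)%:E)%E.
Proof.
move=> bp h; apply: ereal_inf_lbound; exists (EFin \o psi); last exact: integral_mean.
split=> [|w]; first exact: bounded_measurable_integrable.
by rewrite lee_fin.
Qed.

Lemma upper_expectation_ge phi psi : bounded_measurable psi -> (forall w, psi w <= phi w) ->
  ((mean P psi)%:E <= upper_expectation P phi)%E.
Proof.
move=> bp h; apply: le_ereal_inf_tmp => _ [q [iq phiq] <-].
rewrite -integral_mean//; apply: le_integral => //; first exact: bounded_measurable_integrable.
by move=> w _; apply: (le_trans _ (phiq w)); rewrite lee_fin.
Qed.

Lemma upper_expectation_mono phi psi : (forall w, phi w <= psi w) ->
  (upper_expectation P phi <= upper_expectation P psi)%E.
Proof.
move=> h; apply: ereal_inf_le_tmp => _ [q [iq psiq] <-]; exists q => //; split => // w.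
by apply: (le_trans _ (psiq w)); rewrite lee_fin.
Qed.

End upper_expectations.

Section lipschitz_regularization.
Lemma lipschitz_continuous {R : realType} {V : normedModType R} (F : V -> R) (m : R) : 0 <= m ->
  (forall z z', `|F z - F z'| <= m * `|z - z'|) -> continuous F.
Proof.
move=> m0 FL z; apply/cvgrPdist_le => r r0.
apply/nbhs_ballP; exists (r / (m + 1)); first by rewrite /= divr_gt0// ltr_wpDl.
move=> y; rewrite -ball_normE/= => zy; apply: (le_trans (FL _ _)).
have : `|z - y| * (m + 1) <= r by rewrite -ler_pdivlMr ?ltr_wpDl// ltW.
have : 0 <= `|z - y| by [].
by rewrite mulrDr mulr1 mulrC; lra.
Qed.

Context {R : realType} {V : normedModType R}.
Variables (G : V -> R) (K : R).
Hypothesis GK : forall z, `|G z| <= K.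

(** The largest [m]-Lipschitz minorant of [G]. *)
Definition lipschitz_minorant (m : nat) (z : V) : R := inf (range (fun y => G y + m%:R * `|z - y|)).

Let lb m z : lbound (range (fun y => G y + m%:R * `|z - y|)) (- K).
Proof.
move=> _ [y _ <-]; rewrite -[leLHS]addr0 lerD ?mulr_ge0//.
by have := GK y; rewrite ler_norml => /andP[].
Qed.

Lemma lipschitz_minorant_le m z y : lipschitz_minorant m z <= G y + m%:R * `|z - y|.
Proof. by apply: ge_inf; [exists (- K); exact: lb|exists y]. Qed.

Lemma le_lipschitz_minorant m z (x : R) : (forall y, x <= G y + m%:R * `|z - y|) ->
  x <= lipschitz_minorant m z.
Proof. by move=> h; apply: lb_le_inf; [exists (G z + m%:R * `|z - z|), z|move=> _ [y _ <-]]. Qed.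

Lemma lipschitz_minorant_minorant m z : lipschitz_minorant m z <= G z.
Proof. by have := lipschitz_minorant_le m z z; rewrite subrr normr0 mulr0 addr0. Qed.

Lemma lipschitz_minorant_bounded m z : `|lipschitz_minorant m z| <= K.
Proof.
rewrite ler_norml; apply/andP; split.
  by apply: le_lipschitz_minorant => y; apply: lb; exists y.
apply: (le_trans (lipschitz_minorant_minorant m z)).
by have := GK z; rewrite ler_norml => /andP[].
Qed.

Lemma lipschitz_minorant_lipschitz m z z' :
  `|lipschitz_minorant m z - lipschitz_minorant m z'| <= m%:R * `|z - z'|.
Proof.
have h x x' : lipschitz_minorant m x - m%:R * `|x - x'| <= lipschitz_minorant m x'.
  apply: le_lipschitz_minorant => y; rewrite lerBlDr -addrA -mulrDr.
  apply: (le_trans (lipschitz_minorant_le m x y)); rewrite lerD2l ler_wpM2l//.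
  by rewrite [leRHS]addrC; exact: ler_distD.
have h1 := h z z'; have h2 := h z' z; rewrite distrC in h2.
by rewrite ler_norml; apply/andP; split; lra.
Qed.

Lemma lipschitz_minorant_continuous m : continuous (lipschitz_minorant m).
Proof. exact: (lipschitz_continuous (ler0n R m) (lipschitz_minorant_lipschitz m)). Qed.

(** Points within the modulus of continuity of [z] change [G] by little; the
    penalty of the other ones exceeds the range of [G] for large [m]. *)
Lemma lipschitz_minorant_cvg z : {for z, continuous G} ->
  lipschitz_minorant m z @[m --> \oo] --> G z.
Proof.
move=> cG; apply/cvgrPdist_le => e e0.
have /cvgrPdist_le/(_ e e0)/nbhs_ballP[r /= r0 hr] := cG.
have K0 : 0 <= K by apply: le_trans (GK z).
exists (Num.truncn (2 * K / r)).+1 => // m /= hm.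
rewrite ger0_norm ?subr_ge0 ?lipschitz_minorant_minorant// lerBlDr -lerBlDl.
apply: le_lipschitz_minorant => y; have [zy|zy] := ltP `|z - y| r.
  have := hr y; rewrite -ball_normE/= => /(_ zy); rewrite ler_norml => /andP[_ h].
  have : 0 <= m%:R * `|z - y| by rewrite mulr_ge0.
  by lra.
have mr : 2 * K <= m%:R * r.
  rewrite -ler_pdivrMr//; apply: ltW; apply: (lt_le_trans (Num.Theory.truncnS_gt _)).
  by rewrite ler_nat.
have mz : m%:R * r <= m%:R * `|z - y| by rewrite ler_wpM2l.
have := GK y; have := GK z; rewrite !ler_norml => /andP[_ h1] /andP[h2 _].
by lra.
Qed.

End lipschitz_regularization.

(** * The central limit theorem under bracketing *)

Section bracketing_clt.
Context {R : realType} {d : measure_display} {S : measurableType d}.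
Variables (P : probability S R) (PN : probability (sequence_space S) R).
Hypothesis PN_product : is_infinite_product P PN.
Context {I : Type}.
Variables (C : I -> set S) (L U : nat -> nat -> set S) (p : nat -> I -> nat).
Variables (N : nat -> nat) (D A Q : R).
Hypothesis brackets : bracketing P C L U p N D A Q.
Variable g : {mfun S >-> measurableTypeR R}.
Hypothesis g_normal : forall B, measurable B -> distribution P g B = normal_prob 0 1 B.
Hypothesis mC : forall i, measurable (C i).

Local Notation glim := (gaussian_limit P L p N g).
Local Notation gstep := (gaussian_step P L p N g).
Local Notation gval := (gaussian_value P L g).
Local Notation emp := (empirical_process mC P).

Let pN k i : (p k i < N k)%N. Proof. by have [_ _ h _ _] := brackets; have [] := h k i. Qed.
Let D0 : 0 <= D. Proof. by have [_ _ _ []] := brackets. Qed.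
Let bi : forall j, bounded_measurable (bracket_indic P L j).
Proof. by move=> j; exact: (bounded_measurable_bracket_indic brackets). Qed.

Lemma step_ext k v v' : (forall c, (c < N k)%N -> v c = v' c) -> step p N k v = step p N k v' :> linf I R.
Proof. by move=> h; apply/val_inj/funext => i; rewrite !stepE// h. Qed.

(** The level [k] is chosen first, so that both processes are close to their
    step functions of level [k]; then [n] tends to infinity in the resulting
    finite-dimensional problem. The empirical process need not be measurable,
    but its step functions are, and [F] of them is within [m (3 + 8 D) / 2^k]
    of [F] of the process off a measurable event. *)
Lemma lipschitz_clt (F : linf I R -> R) (K m e : R) : (forall z, `|F z| <= K) -> 0 <= m ->
  (forall z z', `|F z - F z'| <= m * `|z - z'|) -> 0 < e ->
  \forall n \near \oo,
    ((mean PN (fun w => F (glim w)) - e)%:E <= upper_expectation PN (fun w => F (emp n w)))%E /\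
    (upper_expectation PN (fun w => F (emp n w)) <= (mean PN (fun w => F (glim w)) + e)%:E)%E.
Proof.
move=> FK m0 FL e0.
have K0 : 0 <= K by apply: le_trans (FK 0).
have [B1 B10 hE] := asymptotic_equicontinuity PN_product brackets.
have [B2 B20 hB2] := late_failure_pr PN_product brackets g_normal.
(* approximation errors at level k, times 2 ^ k, for the empirical and the
   limit process *)
pose c1 := m * (3 + 8 * D) + 2 * K * B1; pose c2 := m * 4 + 2 * K * B2.
have c10 : 0 <= c1 by rewrite addr_ge0// mulr_ge0// ?addr_ge0// mulr_ge0.
have c20 : 0 <= c2 by rewrite addr_ge0// !mulr_ge0.
pose k := (Num.truncn ((c1 + c2) / (e / 2))).+1.
have hk : (c1 + c2) / 2 ^+ k <= e / 2.
  rewrite ler_pdivrMr ?exprn_gt0// mulrC -ler_pdivrMr ?divr_gt0//.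
  apply: (@le_trans _ _ k%:R); first exact: ltW (Num.Theory.truncnS_gt _).
  by rewrite -natrX ler_nat ltnW// ltn_expl.
pose ext (v : 'I_(N k) -> R) (c : nat) : R := oapp v 0 (insub c).
have extE (v : nat -> R) : step p N k (ext (fun l => v l)) = step p N k v :> linf I R.
  by apply: step_ext => c ck; rewrite /ext insubT.
pose h v := F (step p N k (ext v)).
have bh : bounded_lipschitz h.
  split; first by exists K => v; exact: FK.
  exists m => v v'; apply: (le_trans (FL _ _)); rewrite ler_wpM2l//.
  apply: (le_trans (step_dist_le _ _ _ _ _)); rewrite /l1_dist; apply: ler_sum => c _.
  by rewrite /ext valK.
pose idx (l : 'I_(N k)) : nat := pickle (k, l : nat).
have cv := finite_dimensional_clt PN_product g_normal bi (bracket_indic_mean brackets) (bracket_indic_le1 brackets) (idx := idx) bh.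
have mW l : measurable_fun setT (gaussian_copy P g (bracket_indic P L) (idx l)).
  exact: measurable_gaussian_copy.
have cF : continuous F by exact: (lipschitz_continuous m0 FL).
have bFg : bounded_measurable (fun w => F (glim w)).
  by split; [exact: (measurable_continuous_glim brackets)|exists K => w; exact: FK].
have d2 : `|mean PN (fun w => h (fun l => gaussian_copy P g (bracket_indic P L) (idx l) w)) -
    mean PN (fun w => F (glim w))| <= c2 / 2 ^+ k.
  have mB : measurable (late_failure P L p N g k) by exact: measurable_late_failure.
  apply: (le_trans (@mean_dist_off _ _ _ PN _ _ _ K (m * (4 / 2 ^+ k)) (bounded_lipschitz_measurable mW bh) bFg mB _ _ _ _)).
  - by rewrite mulr_ge0// divr_ge0// exprn_ge0.
  - by move=> w; exact: FK.
  - by move=> w; exact: FK.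
  - move=> w nf; rewrite /h (extE (fun c => gval k c w)).
    have -> : step p N k (gval k ^~ w) = gstep k w.
      apply: step_ext => c ck; rewrite indicE mem_set ?mul1r// => dv.
      by apply: nf; exact: dv.
    apply: (le_trans (FL _ _)); rewrite ler_wpM2l// distrC.
    exact: (gaussian_limit_dist brackets nf (leqnn k)).
  - rewrite (_ : c2 / 2 ^+ k = m * (4 / 2 ^+ k) + 2 * K * (B2 / 2 ^+ k)); last by rewrite /c2; ring.
    by rewrite lerD2l ler_wpM2l// mulr_ge0.
have e4 : 0 < e / 2 by rewrite divr_gt0.
have /cvgrPdist_le/(_ _ e4) cv' := cv.
near=> n.
have kn : (16 ^ k <= n)%N by near: n; exists (16 ^ k)%N.
have cvn : `|mean PN (fun w => h (fun l => gaussian_copy P g (bracket_indic P L) (idx l) w)) -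
   mean PN (fun w => h (fun l => normalized_sum n (bracket_indic P L (idx l)) w))| <= e / 2.
  by near: n.
have [E [mE pE hEw]] := hE k n kn.
pose psi w := h (fun l => normalized_sum n (bracket_indic P L (idx l)) w).
have bpsi : bounded_measurable psi.
  by apply: bounded_lipschitz_measurable => // l; apply: measurable_normalized_sum; case: (bi (idx l)).
have mEi := bounded_measurable_indic (R := R) mE.
pose a := m * ((3 + 8 * D) / 2 ^+ k).
have a0 : 0 <= a by rewrite mulr_ge0// divr_ge0 ?exprn_ge0// addr_ge0// mulr_ge0.
have bound w : `|F (emp n w) - psi w| <= a + 2 * K * \1_E w.
  rewrite indicE; case: (boolP (w \in E)) => [_|].
    rewrite mulr1 (le_trans (ler_normB _ _))// mulr_natl mulr2n -[leLHS]add0r lerD//.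
    by rewrite lerD// ?FK.
  rewrite notin_setE => nE; rewrite mulr0 addr0 (le_trans (FL _ _))// ler_wpM2l//.
  have -> : step p N k (ext (fun l => normalized_sum n (bracket_indic P L (idx l)) w)) =
      step p N k (fun c => empirical P n (L k c) w).
    rewrite -(extE (fun c => empirical P n (L k c) w)); congr (step p N k (ext _)).
    by apply/funext => l; rewrite /idx bracket_indicE.
  apply: linf_dist_le => [|i]; first by rewrite divr_ge0 ?exprn_ge0// addr_ge0// mulr_ge0.
  by rewrite stepE//; exact: hEw.
pose mpsi := mean PN psi.
have mpE : 2 * K * pr PN E <= 2 * K * (B1 / 2 ^+ k) by rewrite ler_wpM2l// mulr_ge0.
have bEe : bounded_measurable (fun w => a + 2 * K * \1_E w).
  apply: bounded_measurableD; first exact: bounded_measurable_cst.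
  exact: bounded_measurableZ.
have mEe : mean PN (fun w => a + 2 * K * \1_E w) = a + 2 * K * pr PN E.
  rewrite meanD ?mean_cst ?meanZ ?mean_indic//; first exact: bounded_measurable_cst.
  exact: bounded_measurableZ.
have tot : a + 2 * K * (B1 / 2 ^+ k) + c2 / 2 ^+ k <= e / 2.
  by apply: le_trans hk; rewrite /c1 /a le_eqVlt; apply/orP; left; apply/eqP; ring.
have [ar1 ar2] : mean PN (fun w => F (glim w)) - e <= mpsi - (a + 2 * K * pr PN E) /\
    mpsi + (a + 2 * K * pr PN E) <= mean PN (fun w => F (glim w)) + e.
  move: cvn d2; rewrite !ler_norml -/mpsi => /andP[cvn1 cvn2] /andP[d21 d22].
  by clear -mpE tot cvn1 cvn2 d21 d22; split; lra.
split.
  apply: (@le_trans _ _ (mean PN (fun w => psi w - (a + 2 * K * \1_E w)))%:E).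
    by rewrite lee_fin meanB// mEe.
  apply: upper_expectation_ge => [|w]; first exact: bounded_measurableB.
  by have := bound w; rewrite ler_norml => /andP[h1 h2]; clear -h1 h2; lra.
apply: (@le_trans _ _ (mean PN (fun w => psi w + (a + 2 * K * \1_E w)))%:E).
  apply: upper_expectation_le => [|w]; first exact: bounded_measurableD.
  by have := bound w; rewrite ler_norml => /andP[h1 h2]; clear -h1 h2; lra.
by rewrite lee_fin meanD// mEe.
Unshelve. all: by end_near. Qed.

Lemma lipschitz_minorant_mean (G : linf I R -> R) (K e : R) : continuous G ->
  (forall z, `|G z| <= K) -> 0 < e -> exists m : nat,
  mean PN (fun w => G (glim w)) - e <= mean PN (fun w => lipschitz_minorant G m (glim w)).
Proof.
move=> cG GK e0.
have cm m := lipschitz_minorant_continuous GK m.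
have cv : mean PN (fun w => lipschitz_minorant G m (glim w)) @[m --> \oo] --> mean PN (fun w => G (glim w)).
  apply: (mean_dominated (M := K)) => [m||m w|].
  - by apply: (measurable_continuous_glim brackets); exact: cm.
  - exact: (measurable_continuous_glim brackets).
  - exact: lipschitz_minorant_bounded.
  - by apply: aeW => w /=; apply: (lipschitz_minorant_cvg GK); exact: cG.
have /cvgrPdist_le/(_ _ e0)[m _ /(_ m (leqnn m)) /=] := cv.
by rewrite ler_norml => /andP[h1 h2]; exists m; lra.
Qed.

(** Lower bounds come from a Lipschitz minorant of [G], upper bounds from one
    of [- G]. *)
Lemma continuous_clt (G : linf I R -> R) (K e : R) : continuous G -> (forall z, `|G z| <= K) -> 0 < e ->
  \forall n \near \oo,
    ((mean PN (fun w => G (glim w)) - e)%:E <= upper_expectation PN (fun w => G (emp n w)))%E /\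
    (upper_expectation PN (fun w => G (emp n w)) <= (mean PN (fun w => G (glim w)) + e)%:E)%E.
Proof.
move=> cG GK e0; have e2 : 0 < e / 2 by rewrite divr_gt0.
pose NG (z : linf I R) : R := - G z.
have NGK z : `|NG z| <= K by rewrite normrN.
have cNG : continuous NG by move=> z; apply: continuousN; exact: cG.
have [m1 h1] := lipschitz_minorant_mean cG GK e2.
have [m2 h2] := lipschitz_minorant_mean cNG NGK e2.
have l1 := lipschitz_clt (lipschitz_minorant_bounded GK m1) (ler0n R m1) (lipschitz_minorant_lipschitz GK m1) e2.
have b2 z : `|- lipschitz_minorant NG m2 z| <= K.
  by rewrite normrN; exact: lipschitz_minorant_bounded.
have lip2 z z' : `|- lipschitz_minorant NG m2 z - - lipschitz_minorant NG m2 z'| <= m2%:R * `|z - z'|.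
  by rewrite -opprD normrN; exact: lipschitz_minorant_lipschitz.
have l2 := lipschitz_clt b2 (ler0n R m2) lip2 e2.
have bG (F : linf I R -> R) : continuous F -> (forall z, `|F z| <= K) -> bounded_measurable (fun w => F (glim w)).
  by move=> cF FK; split; [exact: (measurable_continuous_glim brackets)|exists K => w; exact: FK].
have oppE (F : sequence_space S -> R) : bounded_measurable F -> mean PN (fun w => - F w) = - mean PN F.
  move=> bF; rewrite -[RHS]mulN1r -meanZ//; apply: eq_mean => w; by rewrite mulN1r.
near=> n.
have [a1 a2] : ((mean PN (fun w => lipschitz_minorant G m1 (glim w)) - e / 2)%:E <= upper_expectation PN (fun w => lipschitz_minorant G m1 (emp n w)))%E /\
   (upper_expectation PN (fun w => lipschitz_minorant G m1 (emp n w)) <= (mean PN (fun w => lipschitz_minorant G m1 (glim w)) + e / 2)%:E)%E by near: n.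
have [b1 b3] : ((mean PN (fun w => - lipschitz_minorant NG m2 (glim w)) - e / 2)%:E <= upper_expectation PN (fun w => (- lipschitz_minorant NG m2 (emp n w))%R))%E /\
   (upper_expectation PN (fun w => (- lipschitz_minorant NG m2 (emp n w))%R) <= (mean PN (fun w => - lipschitz_minorant NG m2 (glim w)) + e / 2)%:E)%E by near: n.
split.
  apply: (@le_trans _ _ (upper_expectation PN (fun w => lipschitz_minorant G m1 (emp n w)))).
    by apply: le_trans a1; rewrite lee_fin; lra.
  by apply: upper_expectation_mono => w; exact: (lipschitz_minorant_minorant GK).
apply: (@le_trans _ _ (upper_expectation PN (fun w => (- lipschitz_minorant NG m2 (emp n w))%R))).
  by apply: upper_expectation_mono => w; rewrite lerNr; exact: (lipschitz_minorant_minorant NGK).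
apply: (le_trans b3); rewrite lee_fin.
rewrite oppE in h2; last exact: bG.
have c2 : continuous (lipschitz_minorant NG m2) by exact: (lipschitz_minorant_continuous NGK).
by rewrite oppE; [lra|apply: bG => // z; exact: lipschitz_minorant_bounded].
Unshelve. all: by end_near. Qed.

(** The standard normal function [g] on the sample space guarantees that the
    sequence space, on which the empirical process lives, is also rich enough
    to carry the limit process. *)
Theorem bracketing_clt : satisfies_clt mC P PN.
Proof.
pose W : {mfun sequence_space S >-> borelType (linf I R)} :=
  mfun_of (measurable_gaussian_limit brackets g).
exists (distribution PN W); split.
- apply: (radon_of_separable_support (@linf_complete I R) (d := rational_step p N)).
  move=> e e0; transitivity (pr PN setT); last exact: pr_setT.
  congr (fine (PN _)); apply/seteqP; split => // w _.
  by have [j hj] := rational_step_dense brackets g w e0; exists j.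
- by move=> F cF; exact: (gaussian_limit_linear PN_product brackets g_normal).
move=> G cG [M [Mr GM]].
pose K := `|M| + 1.
have GK z : `|G z| <= K.
  by apply: GM => //; rewrite /K (le_lt_trans (ler_norm M))// ltrDl.
have bG : @bounded_measurable R _ (borelType (linf I R)) G.
  by split; [exact: continuous_borel_measurable|exists K].
pose mG := mean PN (fun w => G (glim w)).
have mE : mean (distribution PN W) G = mG by rewrite mean_distribution.
rewrite integral_mean// mE.
have between (u : \bar R) (r : R) : ((mG - r)%:E <= u)%E /\ (u <= (mG + r)%:E)%E ->
    u \is a fin_num /\ `|mG - fine u| <= r.
  case: u => [u||] []//; rewrite !lee_fin/= => h1 h2; split => //.
  by rewrite ler_distlC h1 h2.
have near_mG e : 0 < e -> \forall n \near \oo, let u := upper_expectation PN (fun w => G (emp n w)) in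
    u \is a fin_num /\ `|mG - fine u| <= e.
  by move=> e0; near=> n; apply: between; near: n; exact: (continuous_clt cG GK).
apply/fine_cvgP; split.
  by apply: filterS (near_mG 1 ltr01) => n [].
by apply/cvgrPdist_le => e e0; apply: filterS (near_mG e e0) => n [].
Unshelve. all: by end_near. Qed.

End bracketing_clt.

(** * Continuous distribution functions *)

Lemma measurable_le_cst {R : realType} {d : measure_display} {T : measurableType d}
  (f : T -> R) (a : R) : measurable_fun setT f -> measurable [set w | f w <= a].
Proof.
move=> mf; rewrite [X in measurable X](_ : _ = f @^-1` `]-oo, a]).
  by rewrite -[X in measurable X]setTI; exact: mf.
by apply/seteqP; split => w /=; rewrite in_itv.
Qed.

Section cumulative_distribution.
Context {R : realType} {d : measure_display} {T : measurableType d}.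
Variables (P : probability T R) (X : T -> R) (M : R).
Hypothesis mX : measurable_fun setT X.
Hypothesis M0 : 0 <= M.

Definition cdf_of (x : R) : R := pr P [set w | X w <= x].

Hypothesis cdf_lip : forall x y, x <= y -> cdf_of y <= cdf_of x + M * (y - x).

Let mle x : measurable [set w | X w <= x]. Proof. exact: measurable_le_cst. Qed.

Lemma cdf_mono x y : x <= y -> cdf_of x <= cdf_of y.
Proof. by move=> xy; apply: pr_le => // w /= h; exact: le_trans xy. Qed.

Lemma cdf_dist_le x y : `|cdf_of x - cdf_of y| <= M * `|x - y|.
Proof.
wlog xy : x y / x <= y.
  move=> h; have [/h//|/ltW/h] := leP x y; by rewrite distrC (distrC y).
have h1 := cdf_mono xy; have h2 := cdf_lip xy.
by rewrite !ler0_norm ?subr_le0//; lra.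
Qed.

Lemma measurable_cdf_shift r : measurable_fun setT (fun w => cdf_of (X w + r)).
Proof.
have mc : measurable_fun setT cdf_of.
  apply: continuous_measurable_fun.
  exact: (@lipschitz_continuous R R^o cdf_of M M0 cdf_dist_le).
by apply: (measurableT_comp (f := cdf_of)) => //; apply: measurable_funD.
Qed.

Let mlt v : measurable [set w | cdf_of (X w) < v].
Proof.
have := measurable_lt_cst v (measurable_cdf_shift 0).
by congr measurable; apply/seteqP; split => w /=; rewrite addr0.
Qed.

(** Intermediate values between two points beyond which there is little mass
    left. *)
Lemma cdf_value v : 0 < v < 1 -> exists x, cdf_of x = v.
Proof.
move=> /andP[v0 v1]; pose e := Num.min v (1 - v).
have e0 : 0 < e by rewrite lt_min v0 subr_gt0.
have [K K0 hK] := real_tight P mX e0.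
have mK : measurable [set w | K < `|X w|] by exact: measurable_gt_norm.
have FK : v <= cdf_of K.
  apply: (@le_trans _ _ (pr P (~` [set w | K < `|X w|]))).
    rewrite pr_setC// lerBrDr -lerBrDl; apply: (le_trans hK); by rewrite ge_min lexx orbT.
  apply: pr_le => //; first exact: measurableC.
  by move=> w /= /negP; rewrite -leNgt => h; rewrite (le_trans (ler_norm _)).
have FNK : cdf_of (- (K + 1)) <= v.
  apply: (@le_trans _ _ e); last by rewrite ge_min lexx.
  apply: le_trans hK; apply: pr_le => // w /= h.
  by rewrite ler0_norm; lra.
have KK : - (K + 1) <= K by lra.
have cF : {within `[- (K + 1), K], continuous cdf_of}.
  apply: continuous_subspaceT.
  exact: (@lipschitz_continuous R R^o cdf_of M M0 cdf_dist_le).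
have [|x _ <-] := IVT (v := v) KK cF; last by exists x.
by rewrite ge_min FNK/= le_max FK orbT.
Qed.

Lemma cdf_lt_le v : 0 <= v -> pr P [set w | cdf_of (X w) < v] <= v.
Proof.
move=> v0; have [v1|v1] := leP 1 v; first by rewrite (le_trans (pr_le1 _ _)).
move: v0; rewrite le_eqVlt => /predU1P[<-|v0].
  rewrite [X in pr P X](_ : _ = set0) /pr ?measure0//.
  by apply/seteqP; split => // w /=; rewrite ltNge pr_ge0.
have [|x Fx] := @cdf_value v; first by rewrite v0.
rewrite -[leRHS]Fx; apply: pr_le => // w /=.
by rewrite -Fx => h; rewrite leNgt; apply: contraTN h => /ltW/cdf_mono; rewrite -leNgt.
Qed.

Lemma le_cdf_lt u : u <= 1 -> u <= pr P [set w | cdf_of (X w) < u].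
Proof.
move=> u1; have [u0|u0] := leP u 0; first by rewrite (le_trans u0)// pr_ge0.
apply/ler_addgt0Pr => e e0; pose e' := Num.min e (u / 2).
have e'0 : 0 < e' by rewrite lt_min e0 divr_gt0.
have e'u : e' <= u / 2 by rewrite ge_min lexx orbT.
have e'e : e' <= e by rewrite ge_min lexx.
have [|x Fx] := @cdf_value (u - e'); first by apply/andP; split; lra.
apply: (@le_trans _ _ (cdf_of x + e)); first by rewrite Fx; lra.
rewrite lerD2r; apply: pr_le => // w /= /cdf_mono; rewrite Fx => h.
by apply: (le_lt_trans h); rewrite ltrBlDr ltrDl.
Qed.

(** Probability integral transform: [cdf_of X] is uniform when it is
    continuous. *)
Lemma cdf_between u v : u <= 1 -> u <= v -> 0 <= v ->
  pr P [set w | u <= cdf_of (X w) < v] <= v - u.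
Proof.
move=> u1 uv v0.
have -> : [set w | u <= cdf_of (X w) < v] =
    [set w | cdf_of (X w) < v] `\` [set w | cdf_of (X w) < u].
  apply/seteqP; split => w /=; first by move=> /andP[h1 h2]; split => //; apply/negP; rewrite -leNgt.
  by move=> [h1 /negP]; rewrite -leNgt h1 => ->.
rewrite pr_setDE//; last by move=> w /= h; exact: lt_le_trans uv.
by rewrite lerB// ?cdf_lt_le// le_cdf_lt.
Qed.

End cumulative_distribution.

(** * Oscillation of a path within a block *)

Section path_evaluation.
Context {R : realType} {T : R}.
Hypothesis T_gt0 : 0 < T.
Local Notation E := (time_interval T).
Local Notation S := (borelType (continuous_paths T)).

Definition path_at (t : E) (z : S) : R := (\val (z : continuous_paths T) : E -> R) t.

Lemma measurable_path_at t : measurable_fun setT (path_at t).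
Proof. by apply: measurable_fun_le => a; exact: (measurable_lower_halfspace (t, a)). Qed.

Lemma path_at_cvg (z : S) (t : E) (u : nat -> E) :
  \val (u n) @[n --> \oo] --> (\val t : R) -> path_at (u n) z @[n --> \oo] --> path_at t z.
Proof.
move=> ut.
have cz : continuous ((\val (z : continuous_paths T)) : E -> R) by exact: (set_mem (valP (z : continuous_paths T))).
have hu : u n @[n --> \oo] --> t.
  move=> A; rewrite nbhsE => -[B [[V oV VB] Bt] BA]; rewrite -VB/= in Bt.
  have hV : \forall n \near \oo, V (\val (u n)) by apply: ut; exact: open_nbhs_nbhs.
  suff : \forall n \near \oo, A (u n) by [].
  by apply: filterS hV => n Vn; apply: BA; rewrite -VB.
exact: (cvg_comp _ _ hu (cz t)).
Qed.

Let clamp (x : R) : R := Num.max 0 (T - Num.max 0 (T - x)).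

Lemma time_at_subproof x : clamp x \in `[0, T]%classic.
Proof.
rewrite inE/= in_itv/= /clamp le_max lexx/= ge_max ltW//=.
by rewrite gerBl le_max lexx.
Qed.

(** Clamping keeps inside the interval the grid points of a block that goes
    beyond its right end, without increasing distances. *)
Definition time_at (x : R) : E := SigSub (time_at_subproof x).

Lemma time_atE x : 0 <= x <= T -> \val (time_at x) = x.
Proof.
move=> /andP[x0 xT]; rewrite /= /clamp (_ : Num.max 0 (T - x) = T - x).
  by rewrite subKr; apply/max_idPr.
by apply/max_idPr; rewrite subr_ge0.
Qed.

Lemma time_at_dist x y : `|\val (time_at x) - \val (time_at y)| <= `|x - y|.
Proof.
apply: (le_trans (max0_dist_le _ _)).
rewrite (_ : _ - _ = Num.max 0 (T - y) - Num.max 0 (T - x)); last by ring.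
apply: (le_trans (max0_dist_le _ _)).
by rewrite (_ : _ - _ = x - y)//; ring.
Qed.

Lemma time_ge0 (t : E) : 0 <= \val t :> R.
Proof. by have := set_mem (valP t); rewrite /= in_itv/= => /andP[]. Qed.

Lemma time_le (t : E) : \val t <= T :> R.
Proof. by have := set_mem (valP t); rewrite /= in_itv/= => /andP[]. Qed.

Section grid.
Variable b : nat.
Hypothesis b_gt1 : (1 < b)%N.

Definition mesh j : R := T / b%:R ^+ j.
Definition grid j i : E := time_at (i%:R * mesh j).
Definition grid_index j (t : E) : nat := Num.truncn (\val t / mesh j).

Let b0 : 0 < b%:R :> R. Proof. by rewrite ltr0n ltnW. Qed.

Lemma mesh_gt0 j : 0 < mesh j. Proof. by rewrite divr_gt0// exprn_gt0. Qed.

Let meshS j : mesh j = b%:R * mesh j.+1.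
Proof. by rewrite /mesh exprS; field; rewrite expf_neq0 gt_eqF. Qed.

Lemma grid_index_bounds j t : (grid_index j t)%:R * mesh j <= \val t < (grid_index j t).+1%:R * mesh j.
Proof.
have m0 := mesh_gt0 j.
rewrite -ler_pdivlMr// -ltr_pdivrMr//.
by apply: truncn_itv; rewrite divr_ge0 ?time_ge0// ltW.
Qed.

Lemma grid_index_le j t : (grid_index j t <= b ^ j)%N.
Proof.
have /andP[h _] := grid_index_bounds j t.
have := le_trans h (time_le t); rewrite /mesh mulrCA -[leRHS]mulr1 ler_pM2l//.
by rewrite ler_pdivrMr ?exprn_gt0// mul1r -natrX ler_nat.
Qed.

(** Indices of the blocks are the [b]-adic digits of the time, so that the
    block of the coarser grid is obtained by dropping a digit. *)
Lemma grid_index_div j t : (grid_index j.+1 t %/ b)%N = grid_index j t.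
Proof.
have /andP[h1 h2] := grid_index_bounds j.+1 t.
have m0 := mesh_gt0 j.+1; have bp : (0 < b)%N by exact: ltnW.
set n := grid_index j.+1 t in h1 h2 *.
apply/esym/eqP; rewrite /grid_index truncn_eq ?(divr_ge0 (time_ge0 t) (ltW (mesh_gt0 j)))//.
rewrite ler_pdivlMr ?mesh_gt0// ltr_pdivrMr ?mesh_gt0// meshS.
apply/andP; split.
  apply: le_trans h1; rewrite mulrA ler_pM2r// -natrM ler_nat; exact: leq_trunc_div.
apply: (lt_le_trans h2); rewrite [leRHS]mulrA ler_pM2r// -natrM ler_nat.
by rewrite ltn_ceil.
Qed.

Lemma grid_index_div_iter k j t : (grid_index (k + j) t %/ b ^ j)%N = grid_index k t.
Proof.
elim: j => [|j IH]; first by rewrite addn0 expn0 divn1.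
by rewrite addnS expnS divnMA grid_index_div.
Qed.

Lemma grid_dist j i : `|\val (grid j.+1 i) - \val (grid j (i %/ b)%N)| <= mesh j.
Proof.
apply: (le_trans (time_at_dist _ _)); have m0 := mesh_gt0 j.+1.
rewrite (meshS j) mulrA -mulrBl normrM (gtr0_norm m0) ler_pM2r//.
rewrite -natrM {1}(divn_eq i b) natrD addrAC subrr add0r ger0_norm// ler_nat.
by rewrite ltnW// ltn_mod ltnW.
Qed.

Lemma grid_cvg k t : \val (grid (k + j) (grid_index (k + j) t)) @[j --> \oo] --> (\val t : R).
Proof.
apply/cvgrPdist_le => e e0.
near=> j.
have hj : (Num.truncn (T / e) < j)%N by near: j; exists (Num.truncn (T / e)).+1.
have /andP[h1 h2] := grid_index_bounds (k + j) t; have m0 := mesh_gt0 (k + j).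
rewrite time_atE; last by rewrite (le_trans h1 (time_le t)) mulr_ge0// ltW.
rewrite ger0_norm ?subr_ge0//.
apply: (@le_trans _ _ (mesh (k + j))).
  by rewrite lerBlDl; apply: ltW; rewrite -natr1 mulrDl mul1r in h2.
rewrite /mesh ler_pdivrMr ?exprn_gt0// mulrC -ler_pdivrMr//.
apply: (le_trans (ltW (Num.Theory.truncnS_gt _))).
rewrite -natrX ler_nat (leq_trans hj)// (leq_trans (leq_addl k j))// ltnW// ltn_expl//.
Unshelve. all: by end_near. Qed.

Definition large_increment j i : set S :=
  [set z | (16 ^+ j)^-1 < `|path_at (grid j.+1 i) z - path_at (grid j (i %/ b)%N) z|].

(** Kolmogorov's chaining event: an increment of the path between neighbours of
    consecutive grids, inside the block [q] of level [k], is large. *)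
Definition rough_block k q : set S :=
  \bigcup_j \big[setU/set0]_(r < b ^ j.+1) large_increment (k + j) (q * b ^ j.+1 + r)%N.

Lemma measurable_large_increment j i : measurable (large_increment j i).
Proof.
by apply: measurable_gt_norm; apply: measurable_funB; exact: measurable_path_at.
Qed.

Lemma measurable_rough_block k q : measurable (rough_block k q).
Proof.
apply: bigcupT_measurable => j; apply: measurable_bigsetU_seq => r _.
exact: measurable_large_increment.
Qed.

(** The values of the path at the left ends of the nested blocks of [t]
    converge to its value at [t] by continuity, and off the rough event their
    successive differences are summable. *)
Lemma smooth_block k z t : ~ rough_block k (grid_index k t) z ->
  `|path_at t z - path_at (grid k (grid_index k t)) z| <= 2 / 16 ^+ k.
Proof.
move=> nr.
have chain j : `|path_at (grid (k + j) (grid_index (k + j) t)) z - path_at (grid k (grid_index k t)) z|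
    <= 2 / 16 ^+ k - 2 / 16 ^+ (k + j).
  elim: j => [|j IH]; first by rewrite addn0 !subrr normr0.
  have h : `|path_at (grid (k + j).+1 (grid_index (k + j).+1 t)) z -
      path_at (grid (k + j) (grid_index (k + j) t)) z| <= (16 ^+ (k + j))^-1.
    rewrite leNgt; apply/negP => hlt; apply: nr; exists j => //.
    have rb : (grid_index (k + j).+1 t %% b ^ j.+1 < b ^ j.+1)%N by rewrite ltn_mod expn_gt0 ltnW.
    rewrite (bigD1 (Ordinal rb))//=; left.
    by rewrite /large_increment /= -(grid_index_div_iter k j.+1 t) addnS -divn_eq grid_index_div.
  rewrite addnS; apply: (le_trans (ler_distD (path_at (grid (k + j) (grid_index (k + j) t)) z) _ _)).
  have y0 : 0 < (16 ^+ (k + j))^-1 :> R by rewrite invr_gt0 exprn_gt0.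
  have E1 : 2 / 16 ^+ (k + j).+1 = (16 ^+ (k + j))^-1 / 8 :> R.
    by rewrite exprS; field; rewrite expf_neq0.
  by rewrite E1; move: h IH y0; clear; move: (16 ^+ (k + j))^-1 => y; lra.
have cl : path_at (grid (k + j) (grid_index (k + j) t)) z - path_at (grid k (grid_index k t)) z @[j --> \oo]
    --> path_at t z - path_at (grid k (grid_index k t)) z.
  by apply: cvgB; [apply: path_at_cvg; exact: grid_cvg|exact: cvg_cst].
apply: (cvgr_to_le (cvg_norm cl)); near=> j.
by apply: (le_trans (chain j)); rewrite gerBl divr_ge0// exprn_ge0.
Unshelve. all: by end_near. Qed.

End grid.
End path_evaluation.

(** * Brackets for processes with small increments *)

Section fractional_brackets.
Context {R : realType} {T : R}.
Hypothesis T_gt0 : 0 < T.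
Local Notation E := (time_interval T).
Local Notation S := (borelType (continuous_paths T)).
Variables (P : probability S R) (gamma kappa M : R).
Hypotheses (gamma_gt0 : 0 < gamma) (kappa_gt0 : 0 < kappa) (M_ge0 : 0 <= M).
Hypothesis increment_tail : forall (s t : E) (r y : R), 0 < r ->
  `|\val s - \val t| <= r -> 0 <= y ->
  pr P [set z | y < `|path_at s z - path_at t z|] <= 2 * expR (2^-1 - y / (kappa * r `^ gamma)).
Hypothesis marginal_lip : forall (t : E) (x y : R), x <= y ->
  cdf_of P (path_at t) y <= cdf_of P (path_at t) x + M * (y - x).

Lemma grid_base : exists b : nat, (1 < b)%N /\ 32 <= b%:R `^ gamma :> R.
Proof.
exists (Num.truncn ((32 : R) `^ gamma^-1)).+2; split => //.
apply: (@le_trans _ _ (((32 : R) `^ gamma^-1) `^ gamma)).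
  by rewrite -powRrM mulVf ?gt_eqF// powRr1.
apply: ge0_ler_powR; rewrite ?nnegrE ?powR_ge0// ?ltW//.
by apply: (lt_trans (Num.Theory.truncnS_gt _)); rewrite ltr_nat.
Qed.

Section with_base.
Variable b : nat.
Hypothesis b_gt1 : (1 < b)%N.
Hypothesis b_large : 32 <= b%:R `^ gamma :> R.

Local Notation grid := (grid T_gt0 b).
Local Notation grid_index := (@grid_index R T b).
Local Notation rough_block := (rough_block T_gt0 b).

Let b0 : 0 < b%:R :> R. Proof. by rewrite ltr0n ltnW. Qed.

Let eta : R := (kappa * T `^ gamma)^-1.
Let eta0 : 0 < eta. Proof. by rewrite invr_gt0 mulr_gt0// powR_gt0. Qed.

(** The mesh is [T b^-j] and [b^gamma >= 32], so the threshold [16^-j] is at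
    least [eta 2^j] times the scale of the increment. *)
Lemma large_increment_pr j i : pr P (large_increment T_gt0 b j i) <= 2 * expR (2^-1 - eta * 2 ^+ j).
Proof.
apply: (le_trans (increment_tail (mesh_gt0 T_gt0 b_gt1 j) (grid_dist T_gt0 b_gt1 j i) _)).
  by rewrite invr_ge0 exprn_ge0.
rewrite ler_wpM2l// ler_expR lerD2l lerN2.
have p16 : 0 < 16 ^+ j :> R by rewrite exprn_gt0.
have Tg : 0 < T `^ gamma by exact: powR_gt0.
have bg : 0 < (b%:R `^ gamma) ^+ j :> R by rewrite exprn_gt0// powR_gt0.
have meshE : @mesh R T b j `^ gamma = T `^ gamma / (b%:R `^ gamma) ^+ j.
  have bj0 : 0 < b%:R ^+ j :> R by rewrite exprn_gt0.
  have bjE : (b%:R ^+ j) `^ gamma = (b%:R `^ gamma) ^+ j :> R.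
    by rewrite -powR_mulrn ?ltW// powRAC powR_mulrn// powR_ge0.
  apply: (mulIf (lt0r_neq0 bg)); rewrite divfK ?gt_eqF//.
  by rewrite -bjE -powRM ?(ltW (mesh_gt0 T_gt0 b_gt1 j)) ?(ltW bj0)// /mesh divfK ?gt_eqF.
rewrite meshE (_ : _ / _ = eta * ((b%:R `^ gamma) ^+ j / 16 ^+ j)); last first.
  by rewrite /eta; field; rewrite !gt_eqF//.
rewrite ler_wpM2l ?(ltW eta0)// ler_pdivlMr// -exprMn lerXn2r ?nnegrE ?powR_ge0//.
by rewrite -natrM.
Qed.

(** The number [b^(j+1)] of increments to control is geometric, while their
    probabilities decrease doubly exponentially, hence faster than [(32
    b)^-(k+j)]. *)
Lemma rough_block_pr : exists2 B : R, 0 <= B & forall k q, pr P (rough_block k q) <= B / 16 ^+ k.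
Proof.
pose m := (32 * b)%N.
have bm : 32 * b%:R <= 2 ^+ m :> R.
  by rewrite -natrM -natrX ler_nat ltnW// ltn_expl.
pose F : R := m.+1`!%:R / eta ^+ m.+1.
have F0 : 0 <= F by rewrite divr_ge0// exprn_ge0// ltW.
have hF j : expR (- (eta * 2 ^+ j)) <= F / (2 ^+ j) ^+ m.+1.
  have y0 : 0 < eta * 2 ^+ j by rewrite mulr_gt0// exprn_gt0.
  have z0 : 0 < (eta * 2 ^+ j) ^+ m.+1 / m.+1`!%:R :> R.
    by rewrite divr_gt0 ?exprn_gt0// ltr0n fact_gt0.
  have h : (eta * 2 ^+ j) ^+ m.+1 / m.+1`!%:R <= expR (eta * 2 ^+ j).
    by apply: (le_trans _ (expR_ge1Dxn m (ltW y0))); rewrite lerDr.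
  apply: (@le_trans _ _ ((eta * 2 ^+ j) ^+ m.+1 / m.+1`!%:R)^-1).
    by rewrite expRN lef_pV2 ?posrE ?expR_gt0.
  by rewrite /F invf_div exprMn invfM mulrA.
clearbody F.
have e0 : 0 <= expR 2^-1 :> R by exact: expR_ge0.
pose c := 2 * expR 2^-1 * F; pose B := b%:R * c * 2.
have c0 : 0 <= c by exact: mulr_ge0 (mulr_ge0 (ler0n R 2) e0) F0.
have B0 : 0 <= B by exact: mulr_ge0 (mulr_ge0 (ltW b0) c0) (ler0n R 2).
have inc j i : pr P (large_increment T_gt0 b j i) <= c / (32 * b%:R) ^+ j.
  apply: (le_trans (large_increment_pr j i)).
  rewrite /c expRD -!mulrA ler_wpM2l// ler_wpM2l//; apply: (le_trans (hF j)); rewrite ler_wpM2l//.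
  have b32 : 0 < 32 * b%:R :> R by rewrite mulr_gt0.
  rewrite lef_pV2 ?posrE ?exprn_gt0// exprAC.
  apply: (@le_trans _ _ ((2 ^+ m) ^+ j)).
    by rewrite lerXn2r// ?nnegrE ?exprn_ge0// ltW.
  by rewrite lerXn2r// ?nnegrE ?exprn_ge0// ler_weXn2l// ler1n.
exists B => // k q.
have k16 : 0 < 16 ^+ k :> R by rewrite exprn_gt0.
apply: pr_bigcup_le => [j|n].
  by apply: measurable_bigsetU_seq => r _; exact: measurable_large_increment.
apply: (@le_trans _ _ (\sum_(j < n) (B / 16 ^+ k) / 2 ^+ j.+1)); last first.
  by apply: sum_half_powers_le; rewrite divr_ge0// ltW.
apply: ler_sum => j _; apply: le_trans (pr_bigU_le _ _ _) _ => [r _|].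
  exact: measurable_large_increment.
apply: (@le_trans _ _ (\sum_(r < b ^ j.+1) c / (32 * b%:R) ^+ (k + j))).
  by apply: ler_sum => r _; exact: inc.
rewrite sumr_const card_ord -[_ *+ _]mulr_natl natrX.
have bk1 : 1 <= b%:R ^+ k :> R by rewrite exprn_ege1// ler1n ltnW.
rewrite (_ : _ * _ = b%:R * c * ((b%:R ^+ k)^-1 * (32 ^+ (k + j))^-1)); last first.
  by rewrite exprMn !exprD exprS; field; rewrite !expf_neq0// gt_eqF.
rewrite (_ : B / _ / _ = b%:R * c * ((16 ^+ k)^-1 * (2 ^+ j)^-1)); last first.
  by rewrite /B exprS; field; rewrite !expf_neq0.
apply: ler_wpM2l; first exact: mulr_ge0 (ltW b0) c0.
rewrite exprD invfM mulrA; apply: ler_pM; rewrite ?mulr_ge0 ?invr_ge0 ?exprn_ge0 ?(ltW b0)//.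
  rewrite -[leRHS]mul1r; apply: ler_pM; rewrite ?invr_ge0 ?exprn_ge0 ?(ltW b0)//.
    by rewrite invf_le1// (lt_le_trans _ bk1).
  by rewrite lef_pV2 ?posrE ?exprn_gt0// lerXn2r// ?nnegrE// ler_nat.
by rewrite lef_pV2 ?posrE ?exprn_gt0// lerXn2r// ?nnegrE// ler_nat.
Qed.

(** On smooth paths, [X_t <= x] follows from [X_a + 2/16^k <= x], where [a] is
    the left end of the block; this follows in turn from [F(X_a + 2/16^k) <
    f/16^k] when [f/16^k <= F(x)], [F] being the distribution function of
    [X_a]. The condition no longer depends on [t] and [x] but through their
    cell. *)
Definition lower_path_bracket k c : set S :=
  let q := (c %/ (16 ^ k).+1)%N in let f := (c %% (16 ^ k).+1)%N in
  [set z | cdf_of P (path_at (grid k q)) (path_at (grid k q) z + 2 / 16 ^+ k) < f%:R / 16 ^+ k]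
    `\` rough_block k q.

Definition upper_path_bracket k c : set S :=
  let q := (c %/ (16 ^ k).+1)%N in let f := (c %% (16 ^ k).+1)%N in
  [set z | cdf_of P (path_at (grid k q)) (path_at (grid k q) z - 2 / 16 ^+ k) < f.+1%:R / 16 ^+ k]
    `|` rough_block k q.

(** The cell of [(t, x)] records the block of [t] and, on a scale of [16^-k], the
    quantile level of [x] for the law of the path at the left end of the block. *)
Definition path_cell k (i : E * R) : nat :=
  (grid_index k i.1 * (16 ^ k).+1 +
   Num.truncn (cdf_of P (path_at (grid k (grid_index k i.1))) i.2 * 16 ^+ k))%N.

Definition path_cell_count k : nat := ((b ^ k).+1 * (16 ^ k).+1)%N.

Let mcdf t r : measurable_fun setT (fun z => cdf_of P (path_at t) (path_at t z + r)).
Proof. exact: (@measurable_cdf_shift _ _ _ P (path_at t) M (measurable_path_at t) M_ge0 (marginal_lip t) r). Qed.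

Let quantile_bounds k i : let f := Num.truncn (cdf_of P (path_at (grid k (grid_index k i.1))) i.2 * 16 ^+ k) in
  (f <= 16 ^ k)%N /\ f%:R / 16 ^+ k <= cdf_of P (path_at (grid k (grid_index k i.1))) i.2 < f.+1%:R / 16 ^+ k.
Proof.
set v := cdf_of _ _ _ => /=.
have k16 : 0 < 16 ^+ k :> R by rewrite exprn_gt0.
have v0 : 0 <= v by exact: pr_ge0.
have v1 : v <= 1 by apply: pr_le1; apply: measurable_le_cst; exact: measurable_path_at.
have /andP[h1 h2] := truncn_itv (mulr_ge0 v0 (ltW k16)).
split; last by rewrite ler_pdivrMr// ltr_pdivlMr// h1.
rewrite -(ler_nat R) natrX; apply: (le_trans h1).
by rewrite -[leRHS]mul1r ler_pM2r.
Qed.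

Let cell_decode k i : (path_cell k i %/ (16 ^ k).+1)%N = grid_index k i.1 /\
  (path_cell k i %% (16 ^ k).+1)%N = Num.truncn (cdf_of P (path_at (grid k (grid_index k i.1))) i.2 * 16 ^+ k).
Proof.
have [f16 _] := quantile_bounds k i.
rewrite /path_cell divnMDl// modnMDl (modn_small (d := (16 ^ k).+1))//.
by rewrite divn_small ?addn0.
Qed.

(** A path in the upper bracket and not in the lower one is rough on the block,
    or its value at [a] has a quantile level within [2 M / 16^k] of the
    interval from [f/16^k] to [(f+1)/16^k]; that level is uniform. *)
Theorem fractional_bracketing : exists D : R,
  bracketing P (@lower_halfspace R T) lower_path_bracket upper_path_bracket
    path_cell path_cell_count D (16 * b%:R) 4.
Proof.
have [B B0 hB] := rough_block_pr.
exists (B + (1 + 4 * M)); split.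
- by move=> i; exact: measurable_lower_halfspace.
- split => k c.
    by apply: measurableD; [exact: measurable_lt_cst (mcdf _ _)|exact: measurable_rough_block].
  by apply: measurableU; [exact: measurable_lt_cst (mcdf _ _)|exact: measurable_rough_block].
- move=> k i; have [f16 /andP[fv vf]] := quantile_bounds k i.
  have [qE fE] := cell_decode k i.
  split.
    rewrite /path_cell /path_cell_count.
    apply: (@leq_trans ((grid_index k i.1).+1 * (16 ^ k).+1)).
      by rewrite mulSn addnC -addSn leq_add2r ltnS.
    by rewrite leq_mul2r ltnS grid_index_le ?orbT.
  rewrite /lower_path_bracket /upper_path_bracket qE fE.
  set a := grid k _ in fv vf *; set f := Num.truncn _ in fv vf *.
  split => z.
    move=> [/= h nr]; have sm := smooth_block b_gt1 nr.
    rewrite /lower_halfspace/= -/(path_at i.1 z) leNgt; apply/negP => xz.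
    have : cdf_of P (path_at a) i.2 <= cdf_of P (path_at a) (path_at a z + 2 / 16 ^+ k).
      apply: cdf_mono; first exact: measurable_path_at.
      by move: sm; rewrite ler_norml -/a => /andP[_ sm2]; lra.
    by move=> h2; have := lt_le_trans h (le_trans fv h2); rewrite ltxx.
  rewrite /lower_halfspace/= -/(path_at i.1 z) => zx.
  have [nr|nr] := pselect (rough_block k (grid_index k i.1) z); first by right.
  left; have sm := smooth_block b_gt1 nr; apply: le_lt_trans vf.
  apply: cdf_mono; first exact: measurable_path_at.
  by move: sm; rewrite ler_norml -/a => /andP[sm1 sm2]; lra.
- split; [by rewrite !addr_ge0// mulr_ge0| |by []].
  by rewrite -natrM ler1n muln_gt0/= ltnW.
split => k.
  move=> c; rewrite /lower_path_bracket /upper_path_bracket.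
  set q := (c %/ _)%N; set f := (c %% _)%N.
  have k16 : 0 < 16 ^+ k :> R by rewrite exprn_gt0.
  set a := grid k q; set F := cdf_of P (path_at a); set rho : R := 2 / 16 ^+ k.
  have rho0 : 0 <= rho by rewrite divr_ge0// ltW.
  have f16 : f%:R / 16 ^+ k <= 1 :> R.
    by rewrite ler_pdivrMr// mul1r -natrX ler_nat -ltnS ltn_mod.
  have f0 : 0 <= f%:R / 16 ^+ k :> R by rewrite divr_ge0// ltW.
  have mr := measurable_rough_block T_gt0 b k q.
  pose W := [set z : S | f%:R / 16 ^+ k - M * rho <= F (path_at a z) < f.+1%:R / 16 ^+ k + M * rho].
  have Mr0 : 0 <= M * rho by exact: mulr_ge0.
  have fS : f.+1%:R / 16 ^+ k = f%:R / 16 ^+ k + (16 ^+ k)^-1 :> R by rewrite -natr1 mulrDl mul1r.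
  have i16 : 0 <= (16 ^+ k)^-1 :> R by rewrite invr_ge0 ltW.
  have mW : measurable W.
    rewrite (_ : W = [set z | F (path_at a z + 0) < f.+1%:R / 16 ^+ k + M * rho] `\`
        [set z | F (path_at a z + 0) < f%:R / 16 ^+ k - M * rho]).
      by apply: measurableD; apply: measurable_lt_cst; exact: mcdf.
    apply/seteqP; split => z; rewrite /W/= addr0; first by move=> /andP[h1 h2]; split => //; apply/negP; rewrite -leNgt.
    by move=> [h1 /negP]; rewrite -leNgt h1 => ->.
  apply: (@le_trans _ _ (pr P (rough_block k q `|` W))).
    apply: pr_le.
    - apply: measurableD.
        by apply: measurableU => //; apply: measurable_lt_cst; exact: mcdf.
      by apply: measurableD => //; apply: measurable_lt_cst; exact: mcdf.
    - exact: measurableU.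
    move=> z /= [[h1|]]; last by left.
    have [|nr h2] := pselect (rough_block k q z); first by left.
    right; rewrite /W/=.
    have h3 : f%:R / 16 ^+ k <= F (path_at a z + rho).
      by rewrite leNgt; apply/negP => h3; apply: h2.
    have l1 : F (path_at a z + rho) <= F (path_at a z) + M * rho.
      apply: (le_trans (marginal_lip _ (_ : path_at a z <= path_at a z + rho))); first by rewrite lerDl.
      by rewrite (addrC (path_at a z)) addrK.
    have l2 : F (path_at a z) <= F (path_at a z - rho) + M * rho.
      apply: (le_trans (marginal_lip _ (_ : path_at a z - rho <= path_at a z))); first by rewrite gerBl.
      by rewrite subKr.
    by rewrite -/a -/F -/rho in h1 *; lra.
  apply: (le_trans (prU_le P mr mW)).
  have hW : pr P W <= (1 + 4 * M) / 16 ^+ k.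
    apply: (le_trans (@cdf_between _ _ _ P (path_at a) M (measurable_path_at a) M_ge0 (marginal_lip a) _ _ _ _ _)).
    - by lra.
    - by rewrite fS; lra.
    - by rewrite fS; lra.
    - by rewrite fS /rho le_eqVlt; apply/orP; left; apply/eqP; ring.
  by rewrite mulrDl; apply: lerD.
rewrite /path_cell_count natrM.
have h (n : nat) : (0 < n)%N -> (n ^ k).+1%:R <= 2 * n%:R ^+ k :> R.
  move=> n0; rewrite -natrX -natrM ler_nat mul2n -addnn -add1n leq_add2r expn_gt0 n0//.
apply: (@le_trans _ _ ((2 * b%:R ^+ k) * (2 * 16%:R ^+ k))).
  by apply: ler_pM => //; apply: h => //; exact: ltnW.
by rewrite exprMn le_eqVlt; apply/orP; left; apply/eqP; ring.
Qed.

End with_base.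
End fractional_brackets.

(** * The process and its increments *)

Section almost_sure_equality.
Context {R : realType} {d : measure_display} {T : measurableType d}.
Variable P : probability T R.

Lemma pr_ae_le (A B : set T) : measurable A -> measurable B ->
  {ae P, forall w, A w -> B w} -> pr P A <= pr P B.
Proof.
move=> mA mB [N [mN PN0 hN]]; rewrite (le_trans (pr_setD_le P mA mB))// gerDl.
have : pr P (A `\` B) <= pr P N.
  apply: pr_le => //; first exact: measurableD.
  by move=> w [Aw nBw]; apply: hN => /= h; apply: nBw; exact: h.
by rewrite {2}/pr PN0.
Qed.

Lemma pr_ae_eq (A B : set T) : measurable A -> measurable B ->
  {ae P, forall w, A w <-> B w} -> pr P A = pr P B.
Proof.
move=> mA mB h; apply/eqP; rewrite eq_le; apply/andP; split; apply: pr_ae_le => //.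
  by apply: filterS h => w [].
by apply: filterS h => w [].
Qed.

End almost_sure_equality.

Section normal_variables.
Context {R : realType} {d : measure_display} {T : measurableType d}.
Variables (P : probability T R) (X : T -> R) (s : R).
Hypothesis mX : measurable_fun setT X.
Hypothesis s0 : s != 0.
Hypothesis X_normal : forall B : set (measurableTypeR R), measurable B ->
  P (X @^-1` B) = normal_prob 0 s B.

Let Xm : {mfun T >-> measurableTypeR R} := mfun_of (mX : measurable_fun setT (X : T -> measurableTypeR R)).

Lemma mean_normal (h : measurableTypeR R -> R) : bounded_measurable h ->
  mean P (fun w => h (X w)) = mean (normal_prob 0 s) h.
Proof.
move=> bh; rewrite -(mean_distribution P Xm bh) /mean /Rintegral; congr fine.
by apply: eq_measure_integral => B mB _; exact: X_normal.
Qed.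

Lemma mean_cos_normal_variable (b t : R) :
  mean P (fun w => cos (b + t * X w)) = cos b * expR (- (t ^+ 2 * s ^+ 2 / 2)).
Proof.
rewrite (mean_normal (h := fun x => cos (b + t * x))) ?normal_prob_cos//.
by apply: bounded_measurable_cos; apply: measurable_funD.
Qed.

(** The bounded function [s^2 (1 - cos (x / s))], which is below [x^2] and has
    a known mean, replaces the integration of [x^2] itself. It is used to bound
    the parameter of a normal law by its second moment. *)
Lemma normal_second_moment : ((s ^+ 2 / 4)%:E <= \int[P]_w ((X w) ^+ 2)%:E)%E.
Proof.
have s20 : 0 < s ^+ 2 by rewrite exprn_even_gt0//= s0.
have mcos : bounded_measurable (fun w => cos (0 + s^-1 * X w)).
  by apply: bounded_measurable_cos; apply: measurable_funD => //; apply: measurable_funM.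
pose h w := s ^+ 2 * (1 - cos (0 + s^-1 * X w)).
have bh : bounded_measurable h.
  by apply: bounded_measurableZ; apply: bounded_measurableB => //; exact: bounded_measurable_cst.
have h0 w : 0 <= h w by rewrite mulr_ge0 ?sqr_ge0// subr_ge0 cos_le1.
have hX w : h w <= X w ^+ 2.
  have := cos_abs_le (s^-1 * X w); rewrite distrC => /(le_trans (ler_norm _)) hc.
  rewrite /h add0r; apply: (@le_trans _ _ (s ^+ 2 * (s^-1 * X w) ^+ 2)); first by rewrite ler_wpM2l// sqr_ge0.
  by rewrite exprMn exprVn mulrA mulfV ?mul1r// lt0r_neq0.
apply: (@le_trans _ _ (\int[P]_w (h w)%:E)%E); last first.
  apply: ge0_le_integral => //.
  - by move=> w _; rewrite lee_fin.
  - by apply/measurable_EFinP; case: bh.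
  - by apply/measurable_EFinP; exact: measurable_funX.
  - by move=> w _; rewrite lee_fin.
rewrite integral_mean// lee_fin /h meanZ; last first.
  by apply: bounded_measurableB => //; exact: bounded_measurable_cst.
rewrite meanB//; last exact: bounded_measurable_cst.
rewrite mean_cst mean_cos_normal_variable cos0 mul1r.
rewrite ler_wpM2l ?(ltW s20)//.
rewrite -exprMn mulVf// expr1n expRN.
have e1 : 1 + 1 / 2 <= expR (1 / 2) :> R by exact: expR_ge1Dx.
have e2 : (expR (1 / 2))^-1 <= (3 / 2)^-1 :> R by rewrite lef_pV2 ?posrE ?expR_gt0//; lra.
by lra.
Qed.

Lemma normal_variable_tail (y v : R) : 0 < s -> s <= v -> 0 <= y ->
  pr P [set w | y < `|X w|] <= 2 * expR (2^-1 - y / v).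
Proof.
move=> sp sv y0.
have mB : measurable [set x : measurableTypeR R | y < `|x|].
  by apply: (@measurable_gt_norm R _ (measurableTypeR R) id) => //.
rewrite /pr (X_normal mB) -/(pr _ _); apply: (le_trans (normal_prob_tail s0 y sp)).
rewrite ler_wpM2l// ler_expR lerD2l lerN2 ler_wpM2l// lef_pV2// posrE//.
exact: lt_le_trans sv.
Qed.

End normal_variables.

Section independent_sum.
Context {R : realType} {d : measure_display} {T : measurableType d}.
Variables (P : probability T R) (Y Z : T -> R) (M : R).
Hypotheses (mY : measurable_fun setT Y) (mZ : measurable_fun setT Z).
Hypothesis indep : forall A B : set (measurableTypeR R), measurable A -> measurable B ->
  P (Y @^-1` A `&` Z @^-1` B) = (P (Y @^-1` A) * P (Z @^-1` B))%E.
Hypothesis Z_spread : forall u v : R, u <= v -> (P (Z @^-1` `]u, v]) <= (M * (v - u))%:E)%E.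

Let U := measurableTypeR R.
Let Ym : {mfun T >-> U} := mfun_of (mY : measurable_fun setT (Y : T -> U)).
Let Zm : {mfun T >-> U} := mfun_of (mZ : measurable_fun setT (Z : T -> U)).
Let Jm : {mfun T >-> (U * U)%type} :=
  mfun_of (measurable_fun_pair mY mZ : measurable_fun setT ((fun w => (Y w, Z w)) : T -> (U * U)%type)).

(** Fubini on the product of the laws of [Y] and [Z]: for a fixed value of [Y],
    the sum falls in the interval when [Z] falls in a translate of it. *)
Lemma independent_sum_spread (x y : R) : x <= y ->
  pr P [set w | x < Y w + Z w <= y] <= M * (y - x).
Proof.
move=> xy; pose W := [set q : U * U | x < q.1 + q.2 <= y].
have mW : measurable W.
  have ms : measurable_fun setT (fun q : U * U => q.1 + q.2).
    by apply: measurable_funD; [exact: measurable_fst|exact: measurable_snd].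
  rewrite (_ : W = (fun q : U * U => q.1 + q.2) @^-1` `]x, y]).
    by rewrite -[X in measurable X]setTI; exact: ms.
  by apply/seteqP; split => q; rewrite /W/= in_itv.
have prodE := @product_measure_unique _ _ U U R (distribution P Ym) (distribution P Zm) (distribution P Jm).
have E : P [set w | x < Y w + Z w <= y] = (distribution P Ym \x distribution P Zm)%E W.
  by rewrite prodE// => A B mA mB; exact: indep.
rewrite -lee_fin -prE; last first.
  have mS : measurable_fun setT (fun w => Y w + Z w) by exact: measurable_funD.
  rewrite [X in measurable X](_ : _ = (fun w => Y w + Z w) @^-1` `]x, y]).
    by rewrite -[X in measurable X]setTI; exact: mS.
  by apply/seteqP; split => q /=; rewrite in_itv.
rewrite E /product_measure1.
apply: (@le_trans _ _ (\int[distribution P Ym]_u (M * (y - x))%:E)%E).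
  apply: ge0_le_integral => //.
    by apply: measurable_fun_xsection.
  move=> u _ /=.
  rewrite (_ : xsection W u = `]x - u, y - u]%classic).
    apply: (le_trans (Z_spread _)); first by rewrite lerD2r.
    by rewrite opprB addrA subrK.
  apply/seteqP; split => v; rewrite /xsection/= in_setE /W/= in_itv/= ltrBlDl lerBrDl//.
have hT : distribution P Ym setT = 1%E by exact: probability_setT.
by rewrite integral_cst// [X in (_ * X)%E]hT mule1.
Qed.

End independent_sum.

Section process_laws.
Context {R : realType} {T gamma : R} {d : measure_display} {Omega : measurableType d}.
Variables (Pr : probability Omega R) (Y : time_interval T -> {RV Pr >-> R}) (Z : {RV Pr >-> R}).
Hypothesis gamma_gt0 : 0 < gamma.
Hypothesis Y_gaussian : centered_gaussian_process Y.
Variable c : R.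
Hypothesis c_gt0 : 0 < c.
Hypothesis Y_scale : forall s t : time_interval T,
  ('E_Pr[fun w => ((Y s w - Y t w) ^+ 2)%R] `^ 2^-1)%E = (c * `|\val s - \val t| `^ gamma)%:E.
Hypothesis Z_indep : independent_of_process Z Y.

Let mY t : measurable_fun setT (Y t). Proof. exact: (@measurable_funPT _ _ _ _ (Y t)). Qed.

Lemma scaled_increment_law (s t : time_interval T) (a : R) :
  centered_gaussian_law (fun B => Pr ((fun w => a * (Y s w - Y t w)) @^-1` B)).
Proof.
have := Y_gaussian (fun i : 'I_2 => if i == ord0 then s else t) (fun i => if i == ord0 then a else - a).
rewrite (_ : (fun w => _) = (fun w => a * (Y s w - Y t w)))//.
by apply/funext => w; rewrite !big_ord_recl big_ord0/= addr0 mulrBr mulNr.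
Qed.

Lemma increment_second_moment (s t : time_interval T) :
  (\int[Pr]_w ((Y s w - Y t w) ^+ 2)%:E)%E = ((c * `|\val s - \val t| `^ gamma) ^+ 2)%:E.
Proof.
have := Y_scale s t; rewrite unlock.
have : (0 <= \int[Pr]_w ((Y s w - Y t w) ^+ 2)%:E)%E.
  by apply: integral_ge0 => w _; rewrite lee_fin sqr_ge0.
case: (integral _ _ _) => [r||]//; last by rewrite poweRyr.
rewrite lee_fin poweR_EFin => r0 [<-].
by rewrite powR12_sqrt// sqr_sqrtr.
Qed.

(** The factor [2] comes from the non-optimal bound of [normal_second_moment].
    The degenerate law is separate, and occurs only when the second moment
    vanishes. *)
Lemma increment_law (s t : time_interval T) : exists sigma : R,
  [/\ 0 <= sigma, sigma <= 2 * (c * `|\val s - \val t| `^ gamma),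
    sigma = 0 -> forall y : R, 0 <= y -> pr Pr [set w | y < `|Y s w - Y t w|] = 0,
    sigma = 0 -> c * `|\val s - \val t| `^ gamma = 0 &
    sigma != 0 -> forall B : set (measurableTypeR R), measurable B ->
      Pr ((fun w => Y s w - Y t w) @^-1` B) = normal_prob 0 sigma B].
Proof.
have [sigma sigma0 law] := scaled_increment_law s t 1.
have mD : measurable_fun setT (fun w => Y s w - Y t w) by exact: measurable_funB.
have {}law B : measurable B -> Pr ((fun w => Y s w - Y t w) @^-1` B) =
    if sigma == 0 then \d_(0 : R) B else normal_prob 0 sigma B.
  have -> : (fun w => Y s w - Y t w) = (fun w => 1 * (Y s w - Y t w)).
    by apply/funext => w; rewrite mul1r.
  exact: law.
have v0 : 0 <= c * `|\val s - \val t| `^ gamma by rewrite mulr_ge0 ?powR_ge0// ltW.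
exists sigma; have [s0|s0] := eqVneq sigma 0.
  rewrite s0 in law *; rewrite eqxx in law.
  split => //; first by rewrite mulr_ge0.
    move=> _ y y0; have mB : measurable [set x : measurableTypeR R | y < `|x|].
      by apply: (@measurable_gt_norm R _ (measurableTypeR R) id) => //.
    by rewrite /pr (law _ mB) diracE memNset//= normr0 ltNge y0.
  move=> _; have : (\int[Pr]_w ((Y s w - Y t w) ^+ 2)%:E)%E = 0%E.
    have nul : Pr [set w | Y s w - Y t w != 0] = 0%E.
      have mB : measurable (~` [set 0 : measurableTypeR R]) by exact: measurableC.
      rewrite (_ : [set w | _] = (fun w => Y s w - Y t w) @^-1` (~` [set 0])).
        by rewrite (law _ mB) diracE memNset//= => h; apply: h.
      by apply/seteqP; split => w /= /eqP.
    rewrite (ae_eq_integral (cst 0%E))//; last 2 first.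
    - by apply/measurable_EFinP; exact: measurable_funX.
    - exists [set w | Y s w - Y t w != 0]; split => //.
        rewrite (_ : [set w | _] = (fun w => Y s w - Y t w) @^-1` (~` [set 0])).
          by rewrite -[X in measurable X]setTI; apply: mD => //; exact: measurableC.
        by apply/seteqP; split => w /= /eqP.
      move=> w /= h; apply/negP => /eqP e; apply: h => _; by rewrite e expr0n.
    by rewrite integral_cst// mul0e.
  by rewrite increment_second_moment => -[] /eqP; rewrite sqrf_eq0 => /eqP.
have {}law : forall B : set (measurableTypeR R), measurable B ->
    Pr ((fun w => Y s w - Y t w) @^-1` B) = normal_prob 0 sigma B.
  by move=> B mB; rewrite law// (negbTE s0).
have := normal_second_moment mD s0 law; rewrite increment_second_moment lee_fin => h.
split => //; [|by move/eqP: s0|by move/eqP: s0].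
move: h v0; set v := c * _ => h v0.
have : sigma ^+ 2 <= (2 * v) ^+ 2 by rewrite exprMn; lra.
have v20 : 0 <= 2 * v by exact: mulr_ge0 (ler0n R 2) v0.
by rewrite ler_sqr ?nnegrE.
Qed.

Lemma process_increment_tail (s t : time_interval T) (r y : R) : 0 < r ->
  `|\val s - \val t| <= r -> 0 <= y ->
  pr Pr [set w | y < `|Y s w - Y t w|] <= 2 * expR (2^-1 - y / (2 * c * r `^ gamma)).
Proof.
move=> r0 str y0; have [sigma [sigma0 sle s00 _ law]] := increment_law s t.
have [s0|s0] := eqVneq sigma 0.
  by rewrite s00// mulr_ge0// expR_ge0.
apply: (normal_variable_tail (s := sigma)) => //.
- exact: law.
- by rewrite lt_neqAle eq_sym s0.
apply: (le_trans sle); rewrite -mulrA ler_wpM2l// ler_wpM2l ?(ltW c_gt0)//.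
by apply: ge0_ler_powR; rewrite ?nnegrE// ltW.
Qed.

(** The normal variable from which the limit process is built. The law of the
    quotient by the standard deviation is identified by its characteristic
    function. *)
Lemma standard_increment (s t : time_interval T) : \val s != \val t -> exists a : R,
  forall B : set (measurableTypeR R), measurable B ->
    Pr ((fun w => a * (Y s w - Y t w)) @^-1` B) = normal_prob 0 1 B.
Proof.
move=> st; have [sigma [sigma0 sle _ s00 law]] := increment_law s t.
have s0 : sigma != 0.
  apply/eqP => /s00/eqP; rewrite mulf_eq0 gt_eqF//= powR_eq0 normr_eq0 subr_eq0.
  by rewrite (negbTE st).
exists sigma^-1.
have mD : measurable_fun setT (fun w => Y s w - Y t w) by exact: measurable_funB.
have ma : measurable_fun setT (fun w => sigma^-1 * (Y s w - Y t w)) by exact: measurable_funM.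
pose V : {mfun Omega >-> measurableTypeR R} := mfun_of (ma : measurable_fun setT (_ : Omega -> measurableTypeR R)).
apply: (law_unique_cos (mu := distribution Pr V) (nu := normal_prob 0 1)) => b u.
rewrite normal_prob_cos// mean_distribution; last first.
  by apply: bounded_measurable_cos; apply: measurable_funD.
have -> : mean Pr (fun w => cos (b + u * V w)) = mean Pr (fun w => cos (b + u / sigma * (Y s w - Y t w))).
  by apply: eq_mean => w; rewrite /V/= /mfun_of -mulrA.
rewrite (mean_cos_normal_variable mD s0 (law s0)); congr (_ * expR (- (_ / 2))).
by rewrite expr_div_n expr1n mulr1 divfK// expf_neq0.
Qed.

Variable f : R -> R.
Hypothesis mf : measurable_fun setT f.
Variable M : R.
Hypothesis fM : forall x, 0 <= f x <= M.
Hypothesis Z_density : forall B, measurable B ->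
  distribution Pr Z B = (\int[lebesgue_measure]_(x in B) (f x)%:E)%E.

Lemma process_sum_spread (t : time_interval T) (x y : R) : x <= y ->
  pr Pr [set w | x < Y t w + Z w <= y] <= M * (y - x).
Proof.
move=> xy; apply: independent_sum_spread => //.
  move=> A B mA mB; apply: Z_indep => //.
  by apply: sub_sigma_algebra; exists t; exists A.
move=> u v uv; have := Z_density (measurable_itv `]u, v]); rewrite /distribution/pushforward => ->.
apply: (@le_trans _ _ (\int[lebesgue_measure]_(x in `]u, v]) M%:E)%E).
  apply: ge0_le_integral => //.
  - by move=> z _; rewrite lee_fin; case/andP: (fM z).
  - by apply/measurable_EFinP; exact: measurable_funS mf.
  - by move=> z _; rewrite lee_fin; case/andP: (fM z).
have M0 : 0 <= M by case/andP: (fM 0) => /le_trans h /h.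
have hL : (lebesgue_measure `]u, v]%classic <= (v - u)%:E)%E.
  by rewrite lebesgue_measure_itv/= lte_fin; case: ifPn => // _; rewrite lee_fin subr_ge0.
rewrite integral_cst//= EFinM.
by apply: lee_wpmul2l hL; rewrite lee_fin.
Qed.

End process_laws.

Theorem corollary2 (R : realType) (T gamma : R)
  (T_gt0 : 0 < T) (gamma_gt0 : 0 < gamma) (gamma_lt1 : gamma < 1)
  (d : measure_display) (Omega : measurableType d) (Pr : probability Omega R)
  (Y : time_interval T -> {RV Pr >-> R}) (Z : {RV Pr >-> R})
  (Y_fbm : fractional_brownian_motion gamma Y)
  (Y_cont : sample_continuous Y)
  (Y0 : forall t : time_interval T, \val t = 0 -> {ae Pr, forall w, Y t w = 0})
  (Z_indep : independent_of_process Z Y)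
  (Z_density : has_bounded_density Z)
  (* X is the process Y + Z, as a random element of C([0, T]) *)
  (X : {RV Pr >-> borelType (continuous_paths T)})
  (X_def : {ae Pr, forall w, forall t : time_interval T,
     (\val (X w) : time_interval T -> R) t = Y t w + Z w})
  (PN : probability (sequence_space (borelType (continuous_paths T))) R)
  (PN_product : is_infinite_product (distribution Pr X) PN) :
  satisfies_clt (@measurable_lower_halfspace R T) (distribution Pr X) PN.
Proof.
have [Y_gaussian [c c_gt0 Y_scale]] := Y_fbm.
have [f [mf [M fM] Z_law]] := Z_density.
have M_ge0 : 0 <= M by case/andP: (fM 0) => /le_trans h /h.
set P := distribution Pr X.
have mX : measurable_fun setT X by exact: (@measurable_funPT _ _ _ _ X).
have mY t : measurable_fun setT (Y t) by exact: (@measurable_funPT _ _ _ _ (Y t)).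
have mZ : measurable_fun setT Z by exact: (@measurable_funPT _ _ _ _ Z).
have mpX t : measurable_fun setT (fun w => path_at t (X w)).
  by apply: (measurableT_comp (f := path_at t)) => //; exact: measurable_path_at.
have mpB s t (a : R) : measurable_fun setT (fun w => a * (path_at s (X w) - path_at t (X w))).
  by apply: measurable_funM => //; exact: measurable_funB.
have mYB s t (a : R) : measurable_fun setT (fun w => a * (Y s w - Y t w)).
  by apply: measurable_funM => //; exact: measurable_funB.
have increment_tail (s t : time_interval T) (r y : R) : 0 < r ->
    `|\val s - \val t| <= r -> 0 <= y ->
    pr P [set z | y < `|path_at s z - path_at t z|] <= 2 * expR (2^-1 - y / (2 * c * r `^ gamma)).
  move=> r0 str y0; apply: le_trans (process_increment_tail gamma_gt0 Y_gaussian c_gt0 Y_scale r0 str y0).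
  apply: (@pr_ae_le _ _ _ Pr [set w | y < `|path_at s (X w) - path_at t (X w)|]).
  - by apply: measurable_gt_norm; exact: measurable_funB.
  - by apply: measurable_gt_norm; exact: measurable_funB.
  - apply: filterS X_def => w XE /=; rewrite /path_at !XE.
    by rewrite (_ : _ - _ = Y s w - Y t w)//; ring.
have marginal t x : cdf_of P (path_at t) x = pr Pr [set w | Y t w + Z w <= x].
  apply: (@pr_ae_eq _ _ _ Pr [set w | path_at t (X w) <= x]).
  - exact: measurable_le_cst.
  - by apply: measurable_le_cst; exact: measurable_funD.
  - by apply: filterS X_def => w XE /=; rewrite /path_at XE.
have marginal_lip t (x y : R) : x <= y ->
    cdf_of P (path_at t) y <= cdf_of P (path_at t) x + M * (y - x).
  move=> xy; rewrite !marginal.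
  have mS : measurable_fun setT (fun w => Y t w + Z w) by exact: measurable_funD.
  have mI : measurable [set w | x < Y t w + Z w <= y].
    rewrite (_ : [set w | _] = [set w | Y t w + Z w <= y] `\` [set w | Y t w + Z w <= x]).
      by apply: measurableD; exact: measurable_le_cst.
    apply/seteqP; split => w /=; first by move=> /andP[h1 ->]; split => //; apply/negP; rewrite -ltNge.
    by move=> [-> /negP]; rewrite -ltNge => ->.
  apply: (@le_trans _ _ (pr Pr ([set w | Y t w + Z w <= x] `|` [set w | x < Y t w + Z w <= y]))).
    apply: pr_le.
    - exact: measurable_le_cst.
    - by apply: measurableU => //; exact: measurable_le_cst.
    - by move=> w /= h; have [|xw] := leP (Y t w + Z w) x; [left|right; rewrite h andbT].
  apply: le_trans (prU_le _ _ _) _ => //; first exact: measurable_le_cst.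
  by rewrite lerD2l; exact: (process_sum_spread Z_indep mf fM Z_law).
have [b [b_gt1 b_large]] := grid_base gamma_gt0.
have c2 : 0 < 2 * c by exact: mulr_gt0.
have [D brackets] := fractional_bracketing T_gt0 c2 M_ge0 increment_tail marginal_lip b_gt1 b_large.
(* Z cancels in the increments of X, so that a multiple of the increment of the
   path over the whole interval is standard normal *)
pose tT := time_at T_gt0 T; pose t0 := time_at T_gt0 0.
have tT0 : \val tT != \val t0.
  by rewrite !time_atE ?lexx ?(ltW T_gt0)// gt_eqF.
have [a a_normal] := standard_increment Y_gaussian c_gt0 Y_scale tT0.
have mg : measurable_fun setT (fun z : borelType (continuous_paths T) => a * (path_at tT z - path_at t0 z) : measurableTypeR R).
  by apply: measurable_funM => //; apply: measurable_funB; exact: measurable_path_at.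
have g_normal B : measurable B -> distribution P (mfun_of mg) B = normal_prob 0 1 B.
  move=> mB; rewrite -a_normal//.
  have m1 : measurable ((fun w => a * (path_at tT (X w) - path_at t0 (X w))) @^-1` B).
    by rewrite -[X in measurable X]setTI; exact: mpB.
  have m2 : measurable ((fun w => a * (Y tT w - Y t0 w)) @^-1` B).
    by rewrite -[X in measurable X]setTI; exact: mYB.
  transitivity (Pr ((fun w => a * (path_at tT (X w) - path_at t0 (X w))) @^-1` B)); first by [].
  rewrite !prE//; congr _%:E; apply: pr_ae_eq => //.
  apply: filterS X_def => w XE /=; rewrite /path_at !XE.
  by rewrite (_ : Y tT w + Z w - (Y t0 w + Z w) = Y tT w - Y t0 w)//; ring.
exact: (bracketing_clt PN_product brackets g_normal).
Qed.
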